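(* Let $p$ be a prime, let $G$ be a group of type $\mathrm{VFP}$ over $\mathbb{F}_p$, and let $P$ be a $p$-subgroup of $G$. Then the centralizer $C_G(P)$ of $P$ is also of type $\mathrm{VFP}$ over $\mathbb{F}_p$.
   Context: A group is of type $\mathrm{FP}$ over $\mathbb{F}_p$ if the trivial module $\mathbb{F}_p$ has a finite length resolution by finitely generated projective modules over its group algebra with coefficients in $\mathbb{F}_p$. A group is of type $\mathrm{VFP}$ over $\mathbb{F}_p$ if it has a subgroup of finite index which is of type $\mathrm{FP}$ over $\mathbb{F}_p$. *)

(* Defs.v *)
From HB Require Import structures.
From mathcomp Require Import all_boot all_order all_algebra.
From mathcomp Require Import finmap monalg.
From mathcomp Require Import boolp.

Set Implicit Arguments.
Unset Strict Implicit.
Unset Printing Implicit Defensive.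

Import GRing.Theory.

Local Open Scope ring_scope.

(* Groups, possibly infinite, are values of [groupType]; a subgroup of [G] is a value of
   [groupClosed G], i.e. a predicate on [G] stable under the group operations. *)

Definition subgroup_type (G : groupType) (H : groupClosed G) : Type :=
  {x : G | x \in H}.

Section SubgroupType.
Variables (G : groupType) (H : groupClosed G).

HB.instance Definition _ := [isSub of subgroup_type H for @sval _ _].
HB.instance Definition _ := [Choice of subgroup_type H by <:].

Fact subgroup_type_closed : group_closed (fun x : G => x \in H).
Proof. by split=> [|x y]; [exact: gpred1 | exact: gpredF]. Qed.

HB.instance Definition _ :=
  SubChoice_isSubGroup.Build G (fun x : G => x \in H) (subgroup_type H)
    subgroup_type_closed.

End SubgroupType.

(* [G] is covered by finitely many left cosets [y H]. *)
Definition finite_index (G : groupType) (H : groupClosed G) : Prop :=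
  exists s : seq G, forall x : G, exists2 y, y \in s & (y^-1 * x)%g \in H.

Definition p_subgroup (p : nat) (G : groupType) (P : groupClosed G) : Prop :=
  forall x, x \in P -> exists k : nat, (x ^+ (p ^ k))%g = 1%g.

Definition centralizes (G : groupType) (P : {pred G}) : {pred G} :=
  fun x => `[< forall y, y \in P -> commute x y >].

Section Centralizer.
Variables (G : groupType) (P : {pred G}).

Lemma centralizerP x :
  reflect (forall y, y \in P -> commute x y) (x \in centralizes P).
Proof. exact: asboolP. Qed.

Fact centralizer1 : 1%g \in centralizes P.
Proof. by apply/centralizerP => y _; rewrite /commute mul1g mulg1. Qed.

Fact centralizerM : mulg_closed (centralizes P).
Proof.
move=> u v /centralizerP cu /centralizerP cv; apply/centralizerP => y Py.
by rewrite /commute -mulgA cv // !mulgA cu.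
Qed.

Fact centralizerV : invg_closed (centralizes P).
Proof.
move=> u /centralizerP cu; apply/centralizerP => y Py.
by apply: (mulgI u); rewrite mulgA mulgV mul1g !mulgA cu // -mulgA mulgV mulg1.
Qed.

Definition centralizer : groupClosed G :=
  HB.pack_for (groupClosed G) (centralizes P)
    (isMul1Closed.Build G (centralizes P) centralizer1)
    (isMulClosed.Build G (centralizes P) centralizerM)
    (isInvClosed.Build G (centralizes P) centralizerV).

End Centralizer.

(* The library only makes [{malg k[M]}] a ring when [1] is the sole invertible
   element of the monoid [M], which excludes groups; hence this copy of the
   convolution product. *)
Definition group_algebra (k : comNzRingType) (G : groupType) : Type :=
  {malg k[G]}.

Section GroupAlgebra.
Variables (k : comNzRingType) (G : groupType).

HB.instance Definition _ := GRing.Zmodule.on (group_algebra k G).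

Implicit Types a b c : group_algebra k G.

Definition galg_one : group_algebra k G := << 1 *g 1%g >>.

Definition galg_mul a b : group_algebra k G :=
  \sum_(x <- msupp a) \sum_(y <- msupp b) << a@_x * b@_y *g (x * y)%g >>.

Lemma galg_mulw (d1 d2 : {fset G}) a b :
  (msupp a `<=` d1)%fset -> (msupp b `<=` d2)%fset ->
  galg_mul a b =
    \sum_(x <- d1) \sum_(y <- d2) << a@_x * b@_y *g (x * y)%g >>.
Proof.
move=> le1 le2; rewrite /galg_mul (big_fset_incl _ le1) /=.
  apply/eq_bigr => x _; apply/big_fset_incl => // y _ /mcoeff_outdom ->.
  by rewrite mulr0 monalgU0.
move=> x _ /mcoeff_outdom ax.
by rewrite big1 // => y _; rewrite ax mul0r monalgU0.
Qed.

Lemma galg_mulUU (u v : k) (x y : G) :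
  galg_mul << u *g x >> << v *g y >> = << u * v *g (x * y)%g >>.
Proof. by rewrite (galg_mulw msuppU_le msuppU_le) !big_seq_fset1 !mcoeffUU. Qed.

Lemma galg_mulUg (u : k) (x : G) b :
  galg_mul << u *g x >> b = \sum_(y <- msupp b) << u * b@_y *g (x * y)%g >>.
Proof.
rewrite (galg_mulw msuppU_le (fsubset_refl _)) big_seq_fset1.
by apply/eq_bigr => y _; rewrite mcoeffUU.
Qed.

Lemma galg_mulgU a (v : k) (y : G) :
  galg_mul a << v *g y >> = \sum_(x <- msupp a) << a@_x * v *g (x * y)%g >>.
Proof.
rewrite (galg_mulw (fsubset_refl _) msuppU_le).
by apply/eq_bigr => x _; rewrite big_seq_fset1 mcoeffUU.
Qed.

Lemma galg_mulEl a b :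
  galg_mul a b = \sum_(x <- msupp a) galg_mul << a@_x *g x >> b.
Proof. by apply/eq_bigr => x _; rewrite galg_mulUg. Qed.

Lemma galg_mulEr a b :
  galg_mul a b = \sum_(y <- msupp b) galg_mul a << b@_y *g y >>.
Proof.
rewrite /galg_mul exchange_big /=.
by apply/eq_bigr => y _; rewrite -/(galg_mul _ _) galg_mulgU.
Qed.

Lemma galg_mul0g : left_zero 0 galg_mul.
Proof. by move=> a; rewrite /galg_mul msupp0 big_seq_fset0. Qed.

Lemma galg_mulg0 : right_zero 0 galg_mul.
Proof. by move=> a; rewrite galg_mulEr msupp0 big_seq_fset0. Qed.

Lemma galg_mulDl : left_distributive galg_mul +%R.
Proof.
move=> a b c.
rewrite (galg_mulw (msuppD_le a b) (fsubset_refl (msupp c))).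
rewrite (galg_mulw (fsubsetUl (msupp a) (msupp b)) (fsubset_refl (msupp c))).
rewrite (galg_mulw (fsubsetUr (msupp a) (msupp b)) (fsubset_refl (msupp c))).
rewrite -big_split /=; apply/eq_bigr => x _.
rewrite -big_split /=; apply/eq_bigr => y _.
by rewrite mcoeffD mulrDl monalgUD.
Qed.

Lemma galg_mulDr : right_distributive galg_mul +%R.
Proof.
move=> c a b.
rewrite (galg_mulw (fsubset_refl (msupp c)) (msuppD_le a b)).
rewrite (galg_mulw (fsubset_refl (msupp c)) (fsubsetUl (msupp a) (msupp b))).
rewrite (galg_mulw (fsubset_refl (msupp c)) (fsubsetUr (msupp a) (msupp b))).
rewrite -big_split /=; apply/eq_bigr => x _.
rewrite -big_split /=; apply/eq_bigr => y _.
by rewrite mcoeffD mulrDr monalgUD.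
Qed.

Fact galg_mul1g : left_id galg_one galg_mul.
Proof.
move=> a; rewrite galg_mulUg [RHS]monalgE.
by apply/eq_bigr => x _; rewrite mul1r mul1g.
Qed.

Fact galg_mulg1 : right_id galg_one galg_mul.
Proof.
move=> a; rewrite galg_mulgU [RHS]monalgE.
by apply/eq_bigr => x _; rewrite mulr1 mulg1.
Qed.

Fact galg_mulA : associative galg_mul.
Proof.
move=> a b c.
rewrite [RHS](big_morph (galg_mul^~ _) (fun _ _ => galg_mulDl _ _ _)
  (galg_mul0g _)).
rewrite galg_mulEl; apply/eq_bigr => x _.
rewrite [LHS](big_morph (galg_mul _) (fun _ _ => galg_mulDr _ _ _)
  (galg_mulg0 _)).
rewrite [RHS](big_morph (galg_mul^~ _) (fun _ _ => galg_mulDl _ _ _)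
  (galg_mul0g _)).
apply/eq_bigr => y _.
rewrite [LHS](big_morph (galg_mul _) (fun _ _ => galg_mulDr _ _ _)
  (galg_mulg0 _)).
by rewrite galg_mulEr; apply/eq_bigr => z _; rewrite !galg_mulUU mulrA mulgA.
Qed.

Fact galg_one_neq0 : galg_one != 0.
Proof. by rewrite /galg_one monalgU_eq0 oner_eq0. Qed.

HB.instance Definition _ := GRing.Zmodule_isNzRing.Build (group_algebra k G)
  galg_mulA galg_mul1g galg_mulg1 galg_mulDl galg_mulDr galg_one_neq0.

Definition augmentation a : k := \sum_(x <- msupp a) a@_x.

Lemma augmentationw (d : {fset G}) a :
  (msupp a `<=` d)%fset -> augmentation a = \sum_(x <- d) a@_x.
Proof. by move=> le; apply: big_fset_incl => // x _ /mcoeff_outdom. Qed.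

Lemma augmentationU (u : k) (x : G) : augmentation << u *g x >> = u.
Proof. by rewrite (augmentationw msuppU_le) big_seq_fset1 mcoeffUU. Qed.

Fact augmentationD : {morph augmentation : a b / a + b}.
Proof.
move=> a b; rewrite (augmentationw (msuppD_le a b)).
rewrite (augmentationw (fsubsetUl (msupp a) (msupp b))).
rewrite (augmentationw (fsubsetUr (msupp a) (msupp b))).
by rewrite -big_split /=; apply/eq_bigr => x _; rewrite mcoeffD.
Qed.

Fact augmentation0 : augmentation 0 = 0.
Proof. by rewrite /augmentation msupp0 big_seq_fset0. Qed.

Fact augmentation1 : augmentation 1 = 1.
Proof. exact: augmentationU. Qed.

Fact augmentationM : {morph augmentation : a b / a * b}.
Proof.
move=> a b; rewrite {1}/GRing.mul /= /galg_mul.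
rewrite (big_morph augmentation augmentationD augmentation0).
rewrite {3}/augmentation mulr_suml.
apply/eq_bigr => x _.
rewrite (big_morph augmentation augmentationD augmentation0) mulr_sumr.
by apply/eq_bigr => y _; rewrite augmentationU.
Qed.

End GroupAlgebra.

(* [k] with every element of [G] acting as the identity. *)
Definition trivial_module (k : comNzRingType) (G : groupType) : Type := k.

Section TrivialModule.
Variables (k : comNzRingType) (G : groupType).

HB.instance Definition _ := GRing.Zmodule.on (trivial_module k G).

Definition trivial_scale (a : group_algebra k G) (v : trivial_module k G) :
  trivial_module k G := augmentation a * (v : k).

Fact trivial_scaleA a b v :
  trivial_scale a (trivial_scale b v) = trivial_scale (a * b) v.
Proof. by rewrite /trivial_scale augmentationM mulrA. Qed.

Fact trivial_scale1 : left_id 1 trivial_scale.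
Proof. by move=> v; rewrite /trivial_scale augmentation1 mul1r. Qed.

Fact trivial_scaleDr : right_distributive trivial_scale +%R.
Proof. by move=> a u v; rewrite /trivial_scale mulrDr. Qed.

Fact trivial_scaleDl v : {morph trivial_scale^~ v : a b / a + b}.
Proof. by move=> a b; rewrite /trivial_scale augmentationD mulrDl. Qed.

HB.instance Definition _ :=
  GRing.Zmodule_isLmodule.Build (group_algebra k G) (trivial_module k G)
    trivial_scaleA trivial_scale1 trivial_scaleDr trivial_scaleDl.

End TrivialModule.

Section Modules.
Variable R : pzRingType.

Definition finitely_generated (M : lmodType R) : Prop :=
  exists (n : nat) (e : 'I_n -> M),
    forall x : M, exists c : 'I_n -> R, x = \sum_(i < n) c i *: e i.

Definition surjective (M N : lmodType R) (f : {linear M -> N}) : Prop :=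
  forall y : N, exists x : M, f x = y.

Definition exact_at (L M N : lmodType R)
    (f : {linear L -> M}) (g : {linear M -> N}) : Prop :=
  forall y : M, g y = 0 <-> exists x : L, f x = y.

Definition projective (P : lmodType R) : Prop :=
  forall (M N : lmodType R) (f : {linear M -> N}) (g : {linear P -> N}),
    surjective f -> exists h : {linear P -> M}, forall x : P, f (h x) = g x.

(* An exact complex [0 -> C n -> ... -> C 0 -> M -> 0] of finitely generated
   projectives, extended by zero modules in degrees above [n]; exactness at
   [C n] is then injectivity of the map out of [C n]. *)
Definition finite_fg_projective_resolution (M : lmodType R) : Prop :=
  exists (n : nat) (C : nat -> lmodType R)
         (d : forall i, {linear C i.+1 -> C i}) (eps : {linear C 0%N -> M}),
    [/\ forall i, finitely_generated (C i) /\ projective (C i),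
        forall i, (n < i)%N -> forall x : C i, x = 0,
        surjective eps,
        exact_at (d 0%N) eps
      & forall i, exact_at (d i.+1) (d i)].

End Modules.

Definition type_FP (k : comNzRingType) (G : groupType) : Prop :=
  finite_fg_projective_resolution (trivial_module k G : lmodType (group_algebra k G)).

Definition type_VFP (k : comNzRingType) (G : groupType) : Prop :=
  exists H : groupClosed G, finite_index H /\ type_FP k (subgroup_type H).

(* Main.v *)
Require Import Defs.
From HB Require Import structures.
From mathcomp Require Import all_boot all_order all_algebra.
From mathcomp Require Import fingroup morphism quotient cyclic gseries pgroup maximal.
From mathcomp Require Import generic_quotient ring_quotient.
From mathcomp Require Import finmap monalg.
From mathcomp Require Import boolp classical_sets functions fsbigop.

(** Replacing a subgroup of type FP by its normal core, let H be a normal subgroup of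
    finite index in G which is of type FP over F_p. Such an H has no element of order p:
    if y were one, the Tate cohomology of the group generated by y would vanish on
    finitely generated projective modules, hence, by dimension shifting along a finite
    resolution, on F_p, which it does not ([torsion_free]). So P meets H trivially,
    embeds in G / H, and is a finite p-group acting on H by conjugation. Climbing a
    chain of subgroups of P, each normal and of index p in the next one, leaves one
    automorphism to deal with at each step ([type_FP_centralized]), and the theorem
    becomes [type_FP_fixed]: if sigma is an automorphism of a group H of type FP and
    sigma^p = 1, then the group K of fixed points of sigma is of type FP.

    To detect type FP without constructing resolutions, cohomology is taken with
    coefficients in L / E, for a module L and a submodule E of L, and two properties of
    U-modules M are followed: every class in Ext_U(M, L / E) of a given degree vanishes,
    or every such class vanishes after E is enlarged by finitely many elements of L
    ([Ext], with the values false and true of its boolean). Both pass through short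
    exact sequences ([Ext_quot], [Ext_ker]), both follow from a finite projective
    resolution, the first one in large degrees, and conversely they control finite
    generation (in degree 0) and projectivity (in degree 1). A resolution can therefore
    be built one syzygy at a time, as soon as the properties are known in large degrees
    ([resolution_of_Ext]). In particular type FP descends to subgroups of finite index
    ([type_FP_finite_index]).

    For [type_FP_fixed], let G be the semidirect product of H by the cyclic group Z/p
    acting through sigma, and N the product of K and Z/p inside G.

    (1) The trivial module has the second property over H, hence over G: splice copies
    of the exact sequence 0 -> F_p -> F_p[Z/p] -> F_p[Z/p] -> F_p -> 0 and use Shapiro's
    lemma for the two middle terms ([Ext_whole]).

    (2) Let W be a G-module on which, for every y of order p outside H, the identity is
    the trace over the powers of y of some additive map. Then the cohomology of G in W
    vanishes in large degrees ([acyclic_semidirect]). This is dimension shifting along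
    the p-th tensor power of a finite resolution of F_p over H, on which G acts: Z/p
    permutes the factors. The tensor power of a projective module is a sum of modules
    induced from the trivial subgroup or from subgroups generated by such y, and the
    tensor power of an extension is filtered by modules which are induced from H, except
    for the two extreme layers.

    (3) In the action of G on N \ G, an element y as in (2) fixes at most one coset, and
    so do its nontrivial powers ([fixed_coset]): it acts freely on the others. So the
    quotient of the coinduced module by the induced one satisfies the hypothesis of (2).
    A class of N in Y is a class of G in the module coinduced from Y, by (2) it comes
    from the induced module in large degrees, and there (1) kills it at the cost of
    finitely many elements of Y ([Ext_centralizing]).

    (4) It remains to pass from N, a direct product of K by Z/p, to K. Finitely
    generated projective K-modules have the second property over N, because Z/p is
    finite ([Ext_true_direct_product]). Conversely a K-module which has it over N in
    some even degree 2r is finitely generated: apply it to the product of the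
    tautological class with a generator of the cohomology of Z/p in degree 2r
    ([fg_of_Ext_odd]). With these two facts [resolution_of_Ext] yields a finite
    projective resolution of F_p over K. *)

Set Implicit Arguments.
Unset Strict Implicit.
Unset Printing Implicit Defensive.

Import GRing.Theory.
Local Open Scope ring_scope.

(** * Homogeneous cochains *)

Section Cochains.
Variable G : groupType.
Implicit Types (U : groupClosed G) (s t : seq G).

Definition translate (u : G) (t : seq G) : seq G := [seq (u * x)%g | x <- t].

Lemma translate1 t : translate 1%g t = t.
Proof. by rewrite /translate (eq_map (@mul1g G)) map_id. Qed.

Lemma translateM u v t : translate (u * v)%g t = translate u (translate v t).
Proof. by rewrite /translate -map_comp; apply/eq_map => x /=; rewrite mulgA. Qed.

Lemma translateVK u t : translate u^-1%g (translate u t) = t.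
Proof. by rewrite -translateM mulVg translate1. Qed.

Lemma translateKV u t : translate u (translate u^-1%g t) = t.
Proof. by rewrite -translateM mulgV translate1. Qed.

Lemma size_translate u t : size (translate u t) = size t.
Proof. exact: size_map. Qed.

(** A single function on sequences carries the cochains of all degrees: its values on
    sequences of n + 1 elements form a homogeneous n-cochain. Peeling off the first
    element gives the alternating sum without indices or signs, and turns every homotopy
    below into a short induction. *)
Fixpoint delta (V : zmodType) (f : seq G -> V) (s : seq G) : V :=
  if s is a :: s' then f s' - delta (fun t => f (a :: t)) s' else 0.

Section Delta.
Variable V : zmodType.
Implicit Types f g : seq G -> V.

Lemma deltaB f g s : delta (fun t => f t - g t) s = delta f s - delta g s.
Proof.
elim: s f g => [|a s IH] f g /=; first by rewrite subr0.
by rewrite IH !opprD !opprK addrACA.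
Qed.

Lemma delta0 s : delta (fun _ => 0 : V) s = 0.
Proof. by elim: s => //= a s ->; rewrite subr0. Qed.

Lemma deltaN f s : delta (fun t => - f t) s = - delta f s.
Proof. by elim: s f => [|a s IH] f /=; rewrite ?oppr0 // IH opprB opprK addrC. Qed.

Lemma deltaD f g s : delta (fun t => f t + g t) s = delta f s + delta g s.
Proof.
rewrite -[delta g s]opprK -deltaN -deltaB.
by congr (delta _ s); apply/funext => t; rewrite opprK.
Qed.

Lemma delta_mem (E : V -> Prop) f s :
  E 0 -> (forall v w, E v -> E w -> E (v - w)) ->
  (forall t, (size t).+1 = size s -> E (f t)) -> E (delta f s).
Proof.
move=> E0 EB; elim: s f => [|a s IH] f Ef //=.
by apply: EB; [exact: Ef | apply: IH => t st; apply: Ef; rewrite /= st].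
Qed.

Lemma eq_delta f g s :
  (forall t, (size t).+1 = size s -> f t = g t) -> delta f s = delta g s.
Proof.
move=> fg; apply/eqP; rewrite -subr_eq0 -deltaB; apply/eqP.
by apply: (delta_mem (E := fun v => v = 0)) => [|v w -> ->|t st]; rewrite ?subr0 ?fg ?subrr.
Qed.

Lemma delta_delta f s : delta (delta f) s = 0.
Proof.
by elim: s f => //= a s IH f; rewrite deltaB IH subr0 subrr.
Qed.

Lemma delta_translate f u s :
  delta f (translate u s) = delta (fun t => f (translate u t)) s.
Proof. by elim: s f => //= a s IH f; rewrite IH. Qed.

End Delta.

(** Proofs below combine finitely many cochains by choosing for [V] a type of families
    of elements of [W] and for [phi] a finite sum. *)
Lemma delta_map (V W : zmodType) (phi : V -> W) f s :
  (forall v w, phi (v - w) = phi v - phi w) ->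
  delta (fun t => phi (f t)) s = phi (delta f s).
Proof.
move=> phiB; have phi0 : phi 0 = 0 by rewrite -(subrr 0) phiB subrr.
by elim: s f => [|a s IH] f //=; rewrite IH phiB.
Qed.

Lemma delta_app (X : Type) (Y : zmodType) (f : seq G -> X -> Y) s x :
  delta f s x = delta (fun t => f t x) s.
Proof. by rewrite (delta_map (phi := fun phi : X -> Y => phi x)). Qed.

(** The action is only required to be one on restriction to [U]; the modules of the
    proof carry functions on the whole group which are actions of some subgroup only. *)
Definition gact U (V : zmodType) (a : G -> V -> V) : Prop :=
  [/\ forall u v w, u \in U -> a u (v + w) = a u v + a u w,
      forall v, a 1%g v = v
    & forall u u' v, u \in U -> u' \in U -> a (u * u')%g v = a u (a u' v)].

Definition usub U (V : zmodType) (a : G -> V -> V) (L : V -> Prop) : Prop :=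
  [/\ L 0, forall v w, L v -> L w -> L (v - w)
    & forall u v, u \in U -> L v -> L (a u v)].

Section Actions.
Variables (U : groupClosed G) (V : zmodType) (a : G -> V -> V).
Hypothesis aG : gact U a.

Lemma gactD u v w : u \in U -> a u (v + w) = a u v + a u w.
Proof. by case: aG => aD _ _; exact: aD. Qed.

Lemma gact1 v : a 1%g v = v.
Proof. by case: aG. Qed.

Lemma gactM u u' v : u \in U -> u' \in U -> a (u * u')%g v = a u (a u' v).
Proof. by case: aG => _ _; exact. Qed.

Lemma gact0 u : u \in U -> a u 0 = 0.
Proof. by move=> Uu; apply: (addrI (a u 0)); rewrite -gactD // !addr0. Qed.

Lemma gactN u v : u \in U -> a u (- v) = - a u v.
Proof. by move=> Uu; apply/eqP; rewrite -addr_eq0 -gactD // addNr gact0. Qed.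

Lemma gactB u v w : u \in U -> a u (v - w) = a u v - a u w.
Proof. by move=> Uu; rewrite gactD // gactN. Qed.

Lemma gactKV u v : u \in U -> a u (a u^-1%g v) = v.
Proof. by move=> Uu; rewrite -gactM ?gpredV // mulgV gact1. Qed.

Lemma gactVK u v : u \in U -> a u^-1%g (a u v) = v.
Proof. by move=> Uu; rewrite -gactM ?gpredV // mulVg gact1. Qed.

Lemma gact_sum (I : Type) (r : seq I) (P : pred I) (F : I -> V) u : u \in U ->
  a u (\sum_(i <- r | P i) F i) = \sum_(i <- r | P i) a u (F i).
Proof.
move=> Uu; apply: (big_morph (a u)); last exact: gact0.
by move=> v w; rewrite gactD.
Qed.

Lemma gactMn u v n : u \in U -> a u (v *+ n) = a u v *+ n.
Proof.
move=> Uu; elim: n => [|n IH]; first by rewrite !mulr0n gact0.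
by rewrite !mulrS gactD // IH.
Qed.

End Actions.

Lemma gact_sub (U U' : groupClosed G) (V : zmodType) (a : G -> V -> V) :
  {subset U <= U'} -> gact U' a -> gact U a.
Proof.
move=> UU' [aD a1 aM]; split=> // [u v w /UU'|u u' v /UU' + /UU']; first exact: aD.
exact: aM.
Qed.

Section Subs.
Variables (U : groupClosed G) (V : zmodType) (a : G -> V -> V) (L : V -> Prop).
Hypothesis LU : usub U a L.

Lemma usub0 : L 0. Proof. by case: LU. Qed.
Lemma usubB v w : L v -> L w -> L (v - w). Proof. by case: LU => _ + _; apply. Qed.
Lemma usubN v : L v -> L (- v).
Proof. by rewrite -sub0r; apply: usubB; exact: usub0. Qed.
Lemma usubD v w : L v -> L w -> L (v + w).
Proof. by move=> Lv /usubN; rewrite -{2}[w]opprK; exact: usubB. Qed.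
Lemma usubA u v : u \in U -> L v -> L (a u v).
Proof. by case: LU => _ _; apply. Qed.
Lemma usub_sum (I : Type) (r : seq I) (P : pred I) (F : I -> V) :
  (forall i, P i -> L (F i)) -> L (\sum_(i <- r | P i) F i).
Proof. by move=> LF; apply: big_ind => //; [exact: usub0 | exact: usubD]. Qed.
Lemma usubMn v n : L v -> L (v *+ n).
Proof. by move=> Lv; elim: n => [|n IH]; [exact: usub0 | rewrite mulrS; exact: usubD]. Qed.
Lemma usub_delta f s : (forall t, (size t).+1 = size s -> L (f t)) -> L (delta f s).
Proof. by apply: delta_mem; [exact: usub0 | exact: usubB]. Qed.
Lemma usubC v w : L (v - w) -> L (w - v).
Proof. by move/usubN; rewrite opprB. Qed.
Lemma usub_trans v w x : L (v - w) -> L (w - x) -> L (v - x).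
Proof. by move=> vw /(usubD vw); rewrite addrA subrK. Qed.
Lemma usubW v w : L (v - w) -> L w -> L v.
Proof. by move=> /usubD h /h; rewrite subrK. Qed.
End Subs.

Lemma usub_eq0 (U : groupClosed G) (V : zmodType) (a : G -> V -> V) :
  gact U a -> usub U a (fun v => v = 0).
Proof.
by move=> aG; split=> // [v w -> ->|u v Uu ->]; rewrite ?subr0 // (gact0 aG).
Qed.

(** The pair stands for the U-module [L] modulo [E]. Keeping the ambient group [Y] makes
    cochains honest functions into a fixed type, and enlarging [E] does not change that
    type. *)
Definition coeff U (Y : zmodType) (a : G -> Y -> Y) (L E : Y -> Prop) : Prop :=
  [/\ gact U a, usub U a L, usub U a E & forall y, E y -> L y].

(** The value at the empty sequence, which has degree -1, is set to 0: the complex is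
    not augmented. *)
Definition cochain U (V : zmodType) (a : G -> V -> V) (L : V -> Prop)
    (f : seq G -> V) : Prop :=
  [/\ f [::] = 0, forall t, L (f t)
    & forall u t, u \in U -> f (translate u t) = a u (f t)].

Section CochainTheory.
Variables (U : groupClosed G) (V : zmodType) (a : G -> V -> V).
Hypothesis aG : gact U a.
Implicit Types (L E : V -> Prop) (f g : seq G -> V).

Lemma cochain0 L : usub U a L -> cochain U a L (fun _ => 0).
Proof. by move=> LU; split=> // [_|u t Uu]; [exact: usub0 LU | rewrite (gact0 aG)]. Qed.

Lemma cochainB L f g : usub U a L ->
  cochain U a L f -> cochain U a L g -> cochain U a L (fun t => f t - g t).
Proof.
move=> LU [f0 Lf fU] [g0 Lg gU]; split=> [|t|u t Uu]; first by rewrite f0 g0 subr0.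
  exact: (usubB LU).
by rewrite fU // gU // (gactB aG).
Qed.

Lemma cochain_delta L f : usub U a L -> cochain U a L f -> cochain U a L (delta f).
Proof.
move=> LU [f0 Lf fU]; split=> // [t|u t Uu]; first exact: (usub_delta LU).
rewrite delta_translate -(delta_map (phi := a u)); last by move=> *; rewrite (gactB aG).
by congr (delta _ t); apply/funext => s; rewrite fU.
Qed.

(** Statements about cochains of degree n - 1 constrain a function on sequences of n
    elements only, whereas [cochain] constrains all its values: truncation makes the two
    agree. *)
Definition cutoff n f t := if size t == n then f t else 0.

Lemma cutoffE n f t : size t = n -> cutoff n f t = f t.
Proof. by rewrite /cutoff => ->; rewrite eqxx. Qed.

Lemma delta_cutoff n f t : size t = n.+1 -> delta (cutoff n f) t = delta f t.
Proof. by move=> st; apply: eq_delta => s; rewrite st => -[ss]; rewrite cutoffE. Qed.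

Lemma cochain_cutoff n L L' f : usub U a L' -> cochain U a L f ->
  (forall t, size t = n -> L' (f t)) -> cochain U a L' (cutoff n f).
Proof.
move=> LU [f0 Lf fU] Lf'; rewrite /cutoff; split=> [|t|u t Uu].
- by rewrite f0 if_same.
- by case: eqP => [/Lf' //|_]; exact: usub0 LU.
- by rewrite size_translate fU //; case: ifP => // _; rewrite (gact0 aG).
Qed.

Lemma cochainW L L' f : (forall v, L v -> L' v) -> cochain U a L f -> cochain U a L' f.
Proof. by move=> LL' [f0 Lf fU]; split=> // t; exact: LL'. Qed.

End CochainTheory.

(** A map of left U-sets from the group to [U]: it picks a base point in each right
    coset of [U]. *)
Definition kappa U (x : G) : G :=
  (x * (xget 1 [set y | (x * y^-1)%g \in U])^-1)%g.

Lemma kappa_mem U x : kappa U x \in U.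
Proof.
rewrite /kappa; case: xgetP => [y _ //|/(_ x)].
by rewrite /= mulgV gpred1.
Qed.

Lemma kappaM U u x : u \in U -> kappa U (u * x)%g = (u * kappa U x)%g.
Proof.
move=> Uu; rewrite /kappa mulgA; congr (_ * _^-1)%g.
congr (xget _ _); apply/funext => y /=; apply/propext.
by rewrite -mulgA gpredMl.
Qed.

(** Cochains are often built so as to be equivariant only modulo [E]. Evaluating at the
    translate whose first entry is a base point of its coset restores strict
    equivariance, and by [strictP] moves values within [E] only. *)
Definition strict U (V : zmodType) (a : G -> V -> V) (f : seq G -> V) t : V :=
  if t is x :: _ then a (kappa U x) (f (translate (kappa U x)^-1%g t)) else 0.

Section Strict.
Variables (U : groupClosed G) (V : zmodType) (a : G -> V -> V).
Hypothesis aG : gact U a.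

Lemma cochain_strict (L : V -> Prop) f : usub U a L -> (forall t, L (f t)) ->
  cochain U a L (strict U a f).
Proof.
move=> LU Lf; split=> // [[|x t]|u [|x t] Uu] /=.
- exact: usub0 LU.
- by apply: (usubA LU); rewrite ?kappa_mem.
- by rewrite (gact0 aG).
rewrite kappaM // (gactM aG) ?kappa_mem // invgM.
congr (a u (a _ (f _))); rewrite -[_ :: _]/(translate _ (translate u (x :: t))).
by rewrite translateM translateVK.
Qed.

Lemma strictP (E : V -> Prop) f t : usub U a E -> f [::] = 0 ->
  (forall u t, u \in U -> E (f (translate u t) - a u (f t))) ->
  E (f t - strict U a f t).
Proof.
move=> EU f0 fE; case: t => [|x t]; first by rewrite /= f0 subr0; exact: usub0 EU.
have := fE (kappa U x) (translate (kappa U x)^-1%g (x :: t)) (kappa_mem U x).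
by rewrite translateKV.
Qed.

End Strict.

End Cochains.

(** * Extension classes modulo finitely generated submodules *)

Section Coefficients.
Variable G : groupType.
Implicit Types (U : groupClosed G).

(** The U-submodule generated by [E] and [S], defined by its universal property. *)
Definition gen U (Y : zmodType) (a : G -> Y -> Y) (E : Y -> Prop) (S : seq Y) (y : Y) : Prop :=
  forall Q : Y -> Prop, usub U a Q -> (forall e, E e -> Q e) ->
    (forall s, s \in S -> Q s) -> Q y.

Section Gen.
Variables (U : groupClosed G) (Y : zmodType) (a : G -> Y -> Y).
Implicit Types (E L : Y -> Prop) (S T : seq Y).

Lemma gen_usub E S : usub U a (gen U a E S).
Proof.
split=> [Q QU _ _|v w gv gw Q QU EQ SQ|u v Uu gv Q QU EQ SQ].
- exact: usub0 QU.
- by apply: (usubB QU); [exact: gv | exact: gw].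
- by apply: (usubA QU) => //; exact: gv.
Qed.

Lemma gen_base E S y : E y -> gen U a E S y.
Proof. by move=> Ey Q _ EQ _; exact: EQ. Qed.

Lemma gen_seed E S y : y \in S -> gen U a E S y.
Proof. by move=> Sy Q _ _; exact. Qed.

Lemma gen_min E S L : usub U a L -> (forall y, E y -> L y) ->
  (forall y, y \in S -> L y) -> forall y, gen U a E S y -> L y.
Proof. by move=> LU EL SL y; apply. Qed.

Lemma gen_nil E : usub U a E -> gen U a E [::] = E.
Proof.
move=> EU; apply/funext => y; apply/propext; split; last exact: gen_base.
by apply: gen_min.
Qed.

Lemma gen_cat E S T : gen U a E (S ++ T) = gen U a (gen U a E S) T.
Proof.
apply/funext => y; apply/propext; split.
  apply: gen_min => [|x Ex|x]; first exact: gen_usub.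
    by do 2!apply: gen_base.
  by rewrite mem_cat => /orP[Sx|]; [apply: gen_base; exact: gen_seed | exact: gen_seed].
apply: gen_min => [|x|x Tx]; first exact: gen_usub.
  apply: gen_min => [|z Ez|z Sz]; [exact: gen_usub | exact: gen_base |].
  by apply: gen_seed; rewrite mem_cat Sz.
by apply: gen_seed; rewrite mem_cat Tx orbT.
Qed.

Lemma coeff_gen L E S : coeff U a L E -> (forall y, y \in S -> L y) ->
  coeff U a L (gen U a E S).
Proof.
move=> [aG LU EU EL] SL; split=> //; first exact: gen_usub.
by apply: gen_min.
Qed.
End Gen.

(** A homomorphism to [L] modulo [E], lifted to a plain function to [L]. *)
Definition homP (M Y : zmodType) (L E : Y -> Prop) (phi : M -> Y) : Prop :=
  (forall m, L (phi m)) /\ (forall m m', E (phi (m + m') - phi m - phi m')).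

Definition fact (M : Type) (Y : zmodType) (aM : G -> M -> M) (aY : G -> Y -> Y)
    (g : G) (phi : M -> Y) : M -> Y :=
  fun m => aY g (phi (aM g^-1%g m)).

Lemma gact_fact U (M : Type) (Y : zmodType) (aM : G -> M -> M) (aY : G -> Y -> Y) :
  (forall m, aM 1%g m = m) ->
  (forall u u' m, u \in U -> u' \in U -> aM (u * u')%g m = aM u (aM u' m)) ->
  gact U aY -> gact U (fact aM aY).
Proof.
move=> aM1 aMM aYG; split=> [u v w Uu|v|u u' v Uu Uu']; apply/funext => m.
- by rewrite /fact (gactD aYG).
- by rewrite /fact invg1 aM1 (gact1 aYG).
- by rewrite /fact (gactM aYG) // invgM aMM ?gpredV.
Qed.

Lemma gact_fact_mod U (M Y : zmodType) (aM : G -> M -> M) (aY : G -> Y -> Y) :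
  gact U aM -> gact U aY -> gact U (fact aM aY).
Proof. by move=> [_ aM1 aMM] aYG; exact: gact_fact. Qed.

Section HomP.
Variables (U : groupClosed G) (M Y : zmodType) (aM : G -> M -> M) (aY : G -> Y -> Y).
Variables (L E : Y -> Prop).
Hypotheses (aMG : gact U aM) (LE : coeff U aY L E).

Lemma homP_usub : usub U (fact aM aY) (homP (M := M) L E).
Proof.
have [aG LU EU EL] := LE; split.
- by split=> [m|m m']; [exact: usub0 LU | rewrite !subr0; exact: usub0 EU].
- move=> v w [Lv Ev] [Lw Ew]; split=> [m|m m']; first exact: (usubB LU).
  have -> : (v - w) (m + m') - (v - w) m - (v - w) m' =
      (v (m + m') - v m - v m') - (w (m + m') - w m - w m').
    by rewrite /= !opprD !opprK !addrA -!(addrAC _ (- w (m + m'))) -!(addrAC _ (w m)).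
  exact: (usubB EU).
- move=> u v Uu [Lv Ev]; split=> [m|m m']; first exact: (usubA LU).
  rewrite /fact (gactD aMG) ?gpredV // -!(gactB aG) //; exact: (usubA EU).
Qed.

Lemma homP0 phi : homP L E phi -> E (phi (0 : M)).
Proof.
have [aG LU EU EL] := LE; move=> [_ /(_ 0 0)]; rewrite addr0 subrr sub0r.
by move/(usubN EU); rewrite opprK.
Qed.

Lemma homPB phi (m m' : M) : homP L E phi -> E (phi (m - m') - (phi m - phi m')).
Proof.
have [aG LU EU EL] := LE; move=> [_ /(_ (m - m') m')]; rewrite subrK => h.
by apply: (usubC EU); rewrite addrAC.
Qed.

Lemma homPD phi (m m' : M) : homP L E phi -> E (phi (m + m') - (phi m + phi m')).
Proof. by move=> [_ /(_ m m')]; rewrite opprD addrA. Qed.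

Lemma homPMn phi (m : M) n : homP L E phi -> E (phi (m *+ n) - phi m *+ n).
Proof.
have [aG LU EU EL] := LE; move=> hphi; elim: n => [|n IH].
  by rewrite !mulr0n subr0; exact: homP0.
rewrite !mulrS; apply: (usub_trans EU (homPD _ _ hphi)).
by rewrite opprD addrACA subrr add0r.
Qed.

Lemma homP_sum (I : Type) (r : seq I) (P : pred I) (F : I -> M) phi : homP L E phi ->
  E (phi (\sum_(i <- r | P i) F i) - \sum_(i <- r | P i) phi (F i)).
Proof.
have [aG LU EU EL] := LE; move=> hphi; elim: r => [|i r IH].
  by rewrite !big_nil subr0; exact: homP0.
rewrite !big_cons; case: (P i) => //; apply: (usub_trans EU (homPD _ _ hphi)).
by rewrite opprD addrACA subrr add0r.
Qed.
End HomP.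

Lemma homPW (M Y : zmodType) (L E E' : Y -> Prop) (phi : M -> Y) :
  (forall y, E y -> E' y) -> homP L E phi -> homP L E' phi.
Proof. by move=> EE' [Lp Ep]; split=> // m m'; exact: EE'. Qed.

End Coefficients.

Section ExtDef.
Variables (p : nat) (G : groupType).

Definition killed (Y : zmodType) : Prop := forall y : Y, y *+ p = 0.

(** A cocycle modulo [E] becomes a coboundary after [E] is enlarged by finitely many
    elements of [L], or by none when [b] is false. For [M] an F_p-vector space this is a
    property of the classes in Ext over [U] from [M] to [L] modulo [E]. As [n] counts
    the entries of sequences, the degree of these classes is n - 1. *)
Definition Ext (b : bool) (U : groupClosed G) (M : zmodType) (aM : G -> M -> M) (n : nat) : Prop :=
  forall (Y : zmodType) (aY : G -> Y -> Y) (L E : Y -> Prop),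
  coeff U aY L E -> killed Y -> forall f : seq G -> M -> Y,
  cochain U (fact aM aY) (homP L E) f ->
  (forall t m, size t = n.+1 -> E (delta f t m)) ->
  exists S : seq Y, [/\ b || nilp S, forall y, y \in S -> L y
    & exists2 g, cochain U (fact aM aY) (homP L (gen U aY E S)) g
    & forall t m, size t = n -> gen U aY E S (f t m - delta g t m)].

Variables (U : groupClosed G).

Lemma Ext0 b M aM : gact U aM -> @Ext b U M aM 0.
Proof.
move=> aMG Y aY L E LE kY f cf _; have [aG LU EU EL] := LE.
exists [::]; split=> //; first by rewrite orbT.
rewrite gen_nil //; exists (fun _ => 0).
  by apply: cochain0; [exact: gact_fact_mod aMG aG | exact: homP_usub aMG LE].
move=> t m /size0nil ->; have [-> _ _] := cf.
by rewrite delta0 subr0; exact: usub0 EU.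
Qed.

Lemma Ext_true M aM n : gact U aM -> @Ext false U M aM n -> @Ext true U M aM n.
Proof.
move=> aMG h Y aY L E LE kY f cf df; have [S [nS SL hg]] := h Y aY L E LE kY f cf df.
by exists S; split.
Qed.

(** Extensions are given by functions between groups with actions, so that the same
    lemma serves modules over a group algebra and bare permutation modules. *)
Definition shortexact (Z C B : zmodType) aZ aC aB (i : Z -> C) (q : C -> B) : Prop :=
  [/\ [/\ gact U aZ, gact U aC & gact U aB],
      [/\ forall z z', i (z - z') = i z - i z',
          (forall u z, u \in U -> i (aZ u z) = aC u (i z)) & injective i],
      [/\ forall c c', q (c - c') = q c - q c',
          (forall u c, u \in U -> q (aC u c) = aB u (q c))
        & forall b, exists c, q c = b]
    & forall c, q c = 0 <-> exists z, i z = c].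

Section ShortExact.
Variables (Z C B : zmodType) (aZ : G -> Z -> Z) (aC : G -> C -> C) (aB : G -> B -> B).
Variables (i : Z -> C) (q : C -> B) (r : C -> Z).
Hypotheses (ex : shortexact aZ aC aB i q).
Hypotheses (rB : forall c c', r (c - c') = r c - r c') (rK : forall z, r (i z) = z).

Let aZG : gact U aZ. Proof. by case: ex => -[]. Qed.
Let aCG : gact U aC. Proof. by case: ex => -[]. Qed.
Let aBG : gact U aB. Proof. by case: ex => -[]. Qed.
Let iB z z' : i (z - z') = i z - i z'. Proof. by case: ex => _ []. Qed.
Let iU u z : u \in U -> i (aZ u z) = aC u (i z). Proof. by case: ex => _ [_ + _ _ _]; apply. Qed.
Let qB c c' : q (c - c') = q c - q c'. Proof. by case: ex => _ _ []. Qed.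
Let qU u c : u \in U -> q (aC u c) = aB u (q c). Proof. by case: ex => _ _ [_ + _] _; apply. Qed.
Let qi0 c : q c = 0 <-> exists z, i z = c. Proof. by case: ex. Qed.
Let i0 : i 0 = 0. Proof. by rewrite -(subrr 0) iB subrr. Qed.
Let q0 : q 0 = 0. Proof. by rewrite -(subrr 0) qB subrr. Qed.
Let r0 : r 0 = 0. Proof. by rewrite -(subrr 0) rB subrr. Qed.
Let iD z z' : i (z + z') = i z + i z'.
Proof. by rewrite -{1}[z']opprK iB -[- z']sub0r iB i0 sub0r opprK. Qed.
Let qD z z' : q (z + z') = q z + q z'.
Proof. by rewrite -{1}[z']opprK qB -[- z']sub0r qB q0 sub0r opprK. Qed.
Let rD z z' : r (z + z') = r z + r z'.
Proof. by rewrite -{1}[z']opprK rB -[- z']sub0r rB r0 sub0r opprK. Qed.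

Let sec (b : B) : C := xget 0 [set c | q c = b].
Let secK b : q (sec b) = b.
Proof.
rewrite /sec; case: xgetP => [c _ /= //|noc]; case: ex => _ _ [_ _ /(_ b)[c qc]] _.
by have := noc c qc.
Qed.

Section Coef.
Variables (Y : zmodType) (aY : G -> Y -> Y) (L E : Y -> Prop).
Hypothesis (LE : coeff U aY L E).
Let aYG : gact U aY. Proof. by case: LE. Qed.
Let LU : usub U aY L. Proof. by case: LE. Qed.
Let EU : usub U aY E. Proof. by case: LE. Qed.

Lemma cochain_quot f : cochain U (fact aB aY) (homP L E) f ->
  cochain U (fact aC aY) (homP L E) (fun t c => f t (q c)).
Proof.
move=> [f0 Lf fU]; split=> [|t|u t Uu]; first by rewrite f0.
  by have [Lft Eft] := Lf t; split=> [m|m m'] //; rewrite qD.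
by rewrite fU // /fact; apply/funext => c; rewrite qU ?gpredV.
Qed.

Lemma cochain_restr f : cochain U (fact aC aY) (homP L E) f ->
  cochain U (fact aZ aY) (homP L E) (fun t z => f t (i z)).
Proof.
move=> [f0 Lf fU]; split=> [|t|u t Uu]; first by rewrite f0.
  by have [Lft Eft] := Lf t; split=> [m|m m'] //; rewrite iD.
by rewrite fU // /fact; apply/funext => c; rewrite iU ?gpredV.
Qed.

(** Composition with an additive retraction extends cochains from [Z] to [C], up to
    equivariance, which [strict] repairs. *)
Lemma cochain_extend f : cochain U (fact aZ aY) (homP L E) f ->
  exists2 g, cochain U (fact aC aY) (homP L E) g & forall t z, g t (i z) = f t z.
Proof.
move=> [f0 Lf fU]; exists (strict U (fact aC aY) (fun t c => f t (r c))).
  apply: cochain_strict; [exact: gact_fact_mod | exact: homP_usub |].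
  by move=> t; have [Lft Eft] := Lf t; split=> [m|m m'] //; rewrite rD.
case=> [|x t] z; first by rewrite /= f0.
rewrite /strict /fact -iU ?gpredV ?kappa_mem // rK.
rewrite fU ?gpredV ?kappa_mem // /fact invgK (gactKV aYG) ?kappa_mem //.
by rewrite (gactKV aZG) ?kappa_mem.
Qed.

Lemma cochain_descend w : cochain U (fact aC aY) (homP L E) w ->
  (forall t z, E (w t (i z))) ->
  exists2 g, cochain U (fact aB aY) (homP L E) g & forall t c, E (w t c - g t (q c)).
Proof.
move=> [w0 Lw wU] wE.
have wq t c c' : q c = q c' -> E (w t c - w t c').
  move=> qcc; have [|z zE] := (qi0 (c - c')).1; first by rewrite qB qcc subrr.
  have := homPB LE c c' (Lw t); rewrite -zE => /(usubC EU) h.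
  exact: (usubW EU h).
pose v t b := w t (sec b).
have vL t : homP L E (v t).
  have [Lwt Ewt] := Lw t; split=> [m|m m']; first exact: Lwt.
  have h := Ewt (sec m) (sec m').
  rewrite -addrA -opprD; apply: (usub_trans EU (w := w t (sec m + sec m'))).
    by apply: wq; rewrite qD !secK.
  by rewrite opprD addrA.
exists (strict U (fact aB aY) v).
  by apply: cochain_strict => //; [exact: gact_fact_mod | exact: homP_usub].
move=> t c; apply: (usub_trans EU (w := v t (q c))); first by apply: wq; rewrite secK.
have EU' : usub U (fact aB aY) (fun phi => forall b, E (phi b)).
  split=> [b|f g Ef Eg b|u f Uu Ef b]; [exact: usub0 EU| exact: (usubB EU)|].
  exact: (usubA EU).
have {}EU' := strictP (f := v) t EU'; apply: EU'.
  by rewrite /v w0.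
move=> u s Uu b; rewrite /v wU // /fact /=.
rewrite -[X in E X]/(aY u (w s (aC u^-1%g (sec b))) - aY u (w s (sec (aB u^-1%g b)))).
rewrite -(gactB aYG) //; apply: (usubA EU) => //; apply: wq.
by rewrite qU ?gpredV // !secK.
Qed.

End Coef.

(** The part of the long exact sequence between [C] and [Z]: a class on [B] pulled back
    to [C] is a coboundary, whose primitive restricts to a cocycle of one degree less on
    [Z]. The two enlargements of [E] add up. *)
Lemma Ext_quot b n : Ext b U aC n -> Ext b U aZ n.-1 -> Ext b U aB n.
Proof.
case: n => [|n] extC extZ; first exact: Ext0.
move=> Y aY L E LE kY f cf df; have [aYG LU EU EL] := LE.
have [||S1 [nS1 LS1 [g1 cg1 fg1]]] := extC Y aY L E LE kY (fun t c => f t (q c)).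
- exact: cochain_quot.
- move=> t c st; rewrite delta_app.
  by have := df t (q c) st; rewrite delta_app.
set E1 := gen U aY E S1 in cg1 fg1; have LE1 : coeff U aY L E1 by exact: coeff_gen.
have [_ _ E1U _] := LE1; have EE1 y : E y -> E1 y by exact: gen_base.
have [||S2 [nS2 LS2 [e ce ge]]] := extZ Y aY L E1 LE1 kY (fun t z => g1 t (i z)).
- exact: (cochain_restr cg1).
- move=> t z st; rewrite delta_app -(delta_app g1).
  have := fg1 t (i z) st => /(usubC E1U) h; apply: (usubW E1U h).
  have [] := cf => _ Lf _; rewrite (qi0 (i z)).2; last by exists z.
  by apply: EE1; exact: (homP0 LE (Lf t)).
set E2 := gen U aY E1 S2 in ce ge; have LE2 : coeff U aY L E2 by exact: coeff_gen.
have [_ _ E2U _] := LE2; have E12 y : E1 y -> E2 y by exact: gen_base.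
have [e' ce' e'e] := cochain_extend LE2 ce.
have faG : gact U (fact aC aY) by exact: gact_fact_mod.
have hE2 := homP_usub aCG LE2.
have cg1' : cochain U (fact aC aY) (homP L E2) g1.
  by apply: cochainW cg1 => phi; exact: homPW.
pose w t := g1 t - delta e' t.
have cw : cochain U (fact aC aY) (homP L E2) w.
  by apply: cochainB => //; exact: cochain_delta.
have cw' : cochain U (fact aC aY) (homP L E2) (cutoff n w).
  by apply: (cochain_cutoff faG hE2 cw); case: cw.
have [|g cg wg] := cochain_descend LE2 cw'.
  move=> t z; rewrite /cutoff; case: eqP => [st|_]; last exact: usub0 E2U.
  have := ge t z st; rewrite /w -[X in _ -> E2 X]/(g1 t (i z) - delta e' t (i z)).
  rewrite !delta_app; suff -> : (fun s => e' s (i z)) = (fun s => e s z) by [].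
  by apply/funext => s; rewrite e'e.
exists (S1 ++ S2); split.
- by case: b nS1 nS2 {extC extZ} => //=; rewrite /nilp size_cat => /eqP -> /eqP ->.
- by move=> y; rewrite mem_cat => /orP[/LS1|/LS2].
rewrite gen_cat -/E1 -/E2; exists g => // t m st.
have h1 := E12 _ (fg1 t (sec m) st); rewrite secK in h1.
apply: (usub_trans E2U h1).
have -> : delta g1 t (sec m) = delta (cutoff n w) t (sec m).
  rewrite delta_cutoff // /w deltaB delta_delta subr0 //.
rewrite !delta_app -deltaB; apply: (usub_delta E2U) => s _.
by have := wg s (sec m); rewrite secK.
Qed.

(** The part of the long exact sequence between [B] and [C]: the coboundary of an
    extension to [C] of a cocycle on [Z] descends to [B]. *)
Lemma Ext_ker b n : Ext b U aB n.+1 -> Ext b U aC n -> Ext b U aZ n.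
Proof.
move=> extB extC Y aY L E LE kY f cf df; have [aYG LU EU EL] := LE.
have [f' cf' f'f] := cochain_extend LE cf.
have faG : gact U (fact aC aY) by exact: gact_fact_mod.
have hE := homP_usub aCG LE.
have cd' := cochain_delta faG hE cf'.
have cd : cochain U (fact aC aY) (homP L E) (cutoff n.+1 (delta f')).
  by apply: (cochain_cutoff faG hE cd'); case: cd'.
have [|g0 cg0 dg0] := cochain_descend LE cd.
  move=> t z; rewrite /cutoff; case: eqP => [st|_]; last exact: usub0 EU.
  have := df t z st; rewrite !delta_app.
  suff -> : (fun s => f' s (i z)) = (fun s => f s z) by [].
  by apply/funext => s; rewrite f'f.
have [|S1 [nS1 LS1 [e ce ge]]] := extB Y aY L E LE kY g0 cg0.
  move=> t m st; rewrite -[m]secK; set c := sec m.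
  have -> : delta g0 t (q c) =
      - (delta (fun s => cutoff n.+1 (delta f') s c - g0 s (q c)) t).
    rewrite deltaB -!delta_app delta_cutoff // delta_delta sub0r opprK.
    by rewrite delta_app.
  by apply: (usubN EU); apply: (usub_delta EU) => s _; exact: dg0.
set E1 := gen U aY E S1 in ce ge; have LE1 : coeff U aY L E1 by exact: coeff_gen.
have [_ _ E1U _] := LE1; have EE1 y : E y -> E1 y by exact: gen_base.
have hE1 := homP_usub aCG LE1.
have cw : cochain U (fact aC aY) (homP L E1) (fun t => f' t - (fun c => e t (q c))).
  apply: cochainB => //; last exact: (cochain_quot ce).
  by apply: cochainW cf' => phi; exact: homPW.
have [|S2 [nS2 LS2 [g cg wg]]] := extC Y aY L E1 LE1 kY _ cw.
  move=> t c st; rewrite deltaB -[X in E1 X]/(delta f' t c - delta (fun s c => e s (q c)) t c).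
  apply: (usub_trans E1U (w := g0 t (q c))).
    by apply: EE1; have := dg0 t c; rewrite cutoffE.
  by have := ge t (q c) st; rewrite !delta_app.
set E2 := gen U aY E1 S2 in cg wg; have LE2 : coeff U aY L E2 by exact: coeff_gen.
have [_ _ E2U _] := LE2; have E12 y : E1 y -> E2 y by exact: gen_base.
exists (S1 ++ S2); split.
- by case: b nS1 nS2 {extC extB} => //=; rewrite /nilp size_cat => /eqP -> /eqP ->.
- by move=> y; rewrite mem_cat => /orP[/LS1|/LS2].
rewrite gen_cat -/E1 -/E2; exists (fun t z => g t (i z)); first exact: (cochain_restr cg).
move=> t z st; have := wg t (i z) st; rewrite !delta_app.
rewrite -[(f' t - _) (i z)]/(f' t (i z) - e t (q (i z))) f'f => h.
have e0 : E2 (e t (q (i z))).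
  rewrite (qi0 (i z)).2; last by exists z.
  by case: ce => _ Le _; apply: E12; exact: (homP0 LE1 (Le t)).
by apply: (usubW E2U _ e0); rewrite addrAC.
Qed.

End ShortExact.
End ExtDef.

(** * Kernels and resolutions *)

Section Retraction.
Variable p : nat.
Hypothesis pr_p : prime p.

Lemma killed_inv (n : nat) : ~~ (p %| n)%N ->
  exists m, forall (Y : zmodType) (y : Y), killed p Y -> y *+ n *+ m = y.
Proof.
move=> pn; have n0 : (0 < n)%N by case: n pn => //; rewrite dvdn0.
have cop : coprime n p by rewrite coprime_sym prime_coprime.
case: (egcdnP p n0) => km kn eq _; exists km => Y y kY.
by rewrite -mulrnA mulnC eq (eqP cop) mulrnDr mulrnA kY mulr1n add0r.
Qed.

(** A subspace of an F_p-vector space is a direct summand. The groups are not given as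
    vector spaces, so the complement is a maximal subgroup avoiding the image of [i],
    obtained by Zorn. *)
Lemma retraction (Z C : zmodType) (i : Z -> C) : killed p C ->
  (forall z z', i (z - z') = i z - i z') -> injective i ->
  exists2 r : C -> Z, (forall c c', r (c - c') = r c - r c') & forall z, r (i z) = z.
Proof.
move=> kC iB iI; have i0 : i 0 = 0 by rewrite -(subrr 0) iB subrr.
pose P (X : set C) := (forall x y, X x -> X y -> X (x - y)) /\
   (forall z, X (i z) -> z = 0).
have [F FP tot|A [[AB Ai] Amax]] := Zorn_bigcup (P := P).
  split=> [x y [X FX Xx] [X' FX' Xy]|z [X FX Xz]]; last by have [_] := FP X FX; apply.
  have [XX|XX] := tot X X' FX FX'.
    by exists X' => //; apply: (FP _ FX').1 => //; exact: XX.
  by exists X => //; apply: (FP _ FX).1 => //; exact: XX.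
have A0 : A 0.
  have [[a Aa]|noA] := pselect (exists a, A a); first by rewrite -(subrr a); exact: AB.
  case: (Amax (fun c => c = 0)).
    split=> [a Aa|]; first by case: noA; exists a.
    by move=> /(_ 0 erefl) A0; apply: noA; exists 0.
  by split=> [x y -> ->|z]; rewrite ?subr0 //= -i0 => /iI.
have AN a : A a -> A (- a) by rewrite -sub0r; exact: AB.
have AD a b : A a -> A b -> A (a + b) by rewrite -{2}[b]opprK => Aa /AN; exact: AB.
have AMn a n : A a -> A (a *+ n).
  by move=> Aa; elim: n => [|n IH]; rewrite ?mulr0n // mulrS; exact: AD.
have iD z z' : i (z + z') = i z + i z'.
  by rewrite -{1}[z']opprK iB -[- z']sub0r iB i0 sub0r opprK.
have iMn z n : i (z *+ n) = i z *+ n.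
  by elim: n => [|n IH]; rewrite ?mulr0n // !mulrS iD IH.
have complement c : exists z, A (c - i z).
  apply: contrapT => noz; case: (Amax (fun x => exists a n, A a /\ x = a + c *+ n)).
    split=> [a Aa|]; first by exists a, 0%N; rewrite mulr0n addr0.
    move=> /(_ c) Ac; apply: noz; exists 0; rewrite i0 subr0; apply: Ac.
    by exists 0, 1%N; rewrite add0r.
  split=> [x y [a [n [Aa ->]]] [b [m [Ab ->]]]|z [a [n [Aa zE]]]].
    exists (a - b), (n + p.-1 * m)%N; split; first exact: AB.
    rewrite mulrnDr opprD addrACA; congr (_ + (_ + _)).
    apply/eqP; rewrite eq_sym -addr_eq0 -mulrnDr addnC -mulSn prednK ?prime_gt0 //.
    by rewrite mulrnA kC mul0rn.
  have [/dvdnP[k nE]|/killed_inv[m nm]] := boolP (p %| n)%N.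
    by apply: Ai; rewrite zE nE mulnC mulrnA kC mul0rn addr0.
  (* Here n is prime to p: an element of i Z in the subgroup generated by A and c would
     express c through A and i Z. *)
  case: noz; exists (z *+ m); rewrite iMn zE -{1}(nm C c kC) -mulrnBl opprD.
  by rewrite addrCA subrr addr0; apply/AMn/AN.
pose r c := xget 0 [set z | A (c - i z)].
have rA c : A (c - i (r c)).
  rewrite /r; case: xgetP => [z _ //|no].
  by have [z Az] := complement c; case: (no z).
have ru c z : A (c - i z) -> r c = z.
  move=> Az; apply/eqP; rewrite eq_sym -subr_eq0; apply/eqP/Ai; rewrite iB.
  by have := AB _ _ (rA c) Az; rewrite opprB addrC addrA subrK.
exists r => [c c'|z]; apply: ru; last by rewrite subrr.
rewrite iB; have := AB _ _ (rA c) (rA c'); rewrite !opprD !opprK addrACA.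
by [].
Qed.

End Retraction.

Section Kernel.
Variables (R : pzRingType) (M N : lmodType R) (f : {linear M -> N}).

Definition in_kernel : {pred M} := fun x => f x == 0.

Fact in_kernel_closed : submod_closed in_kernel.
Proof.
split=> [|a x y /eqP fx /eqP fy]; rewrite /in_kernel unfold_in ?linear0 //.
by rewrite linearP fx fy scaler0 addr0.
Qed.

HB.instance Definition _ := GRing.isSubmodClosed.Build R M in_kernel in_kernel_closed.

Definition kernel : Type := {x : M | x \in in_kernel}.
HB.instance Definition _ := [isSub of kernel for @sval _ _].
HB.instance Definition _ := [Choice of kernel by <:].
HB.instance Definition _ := [SubChoice_isSubLmodule of kernel by <:].

Lemma kernelP (x : M) : f x = 0 <-> exists z : kernel, val z = x.
Proof.
split=> [fx|[[z fz] <-]]; last by apply/eqP.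
by have fx' : x \in in_kernel; [apply/eqP | exists (Sub x fx')].
Qed.
End Kernel.

Section Corestriction.
Variables (R : pzRingType) (L M N : lmodType R).
Variables (f : {linear L -> M}) (g : {linear M -> N}).
Hypothesis gf : forall x, g (f x) = 0.

Fact corestr_mem x : f x \in in_kernel g.
Proof. by apply/eqP. Qed.

Definition corestr (x : L) : kernel g := Sub (f x) (corestr_mem x).

Lemma val_corestr x : val (corestr x) = f x.
Proof. by []. Qed.

Fact corestr_linear : linear corestr.
Proof. by move=> a x y; apply/val_inj; rewrite [RHS]linearP /= linearP. Qed.
HB.instance Definition _ := GRing.isLinear.Build R L (kernel g) _ corestr corestr_linear.
End Corestriction.

Section Resolved.
Variable R : pzRingType.

(** A resolution of length at most [n] described by its successive syzygies, the form in
    which inductions use it. *)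
Fixpoint resolved (n : nat) (M : lmodType R) : Prop :=
  if n is m.+1 then
    exists (C : lmodType R) (q : {linear C -> M}),
      [/\ finitely_generated C, projective C, surjective q & resolved m (kernel q)]
  else forall x : M, x = 0.

Lemma resolved_of_resolution M : finite_fg_projective_resolution M ->
  exists n, resolved n M.
Proof.
case=> n [C [d [eps [fgC trivC seps ex0 exd]]]]; exists n.+1.
have {}trivC i : (n.+1 <= i)%N -> forall x : C i, x = 0 by exact: trivC.
elim: n.+1 M C d eps fgC trivC seps ex0 exd => [|m IH] M C d eps fgC trivC seps ex0 exd.
  by move=> x; have [c <-] := seps x; rewrite (trivC 0%N _ c) // linear0.
exists (C 0%N), eps; split=> //; try exact: (fgC 0%N).1; try exact: (fgC 0%N).2.
have de x : eps (d 0%N x) = 0 by apply/ex0; exists x.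
apply: (IH _ (fun i => C i.+1) (fun i => d i.+1)
  (corestr de : {linear C 1%N -> kernel eps})) => //.
- by move=> i lei; exact: trivC.
- move=> z; have /ex0[x dx] : eps (val z) = 0 by apply/kernelP; exists z.
  by exists x; apply/val_inj; rewrite val_corestr.
- move=> y; rewrite -(exd 0%N y); split=> [/(congr1 val)|dy].
    by rewrite val_corestr.
  by apply/val_inj; rewrite val_corestr dy.
Qed.

Lemma resolution_of_resolved n M : resolved n M -> finite_fg_projective_resolution M.
Proof.
elim: n M => [|n IH] M /=.
  move=> M0; exists 0%N, (fun _ => M), (fun _ => idfun : {linear M -> M}),
    (idfun : {linear M -> M}).
  have M1 (x y : M) : x = y by rewrite (M0 x) (M0 y).
  split=> // [i|y|y|i y]; [|by exists y|by split=> // _; exists y|by split=> // _; exists y].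
  split.
    exists 0%N, (fun _ => 0) => x; exists (fun _ => 0); exact: M1.
  move=> A B f g _; exists (\0 : {linear M -> A}) => x /=.
  by rewrite linear0 (M0 x) linear0.
case=> C [q [fgC prC sq /IH[m [C' [d [eps [fgC' trivC' seps ex0 exd]]]]]]].
pose C'' i := if i is j.+1 then C' j else C.
pose d'' i : {linear C'' i.+1 -> C'' i} :=
  if i is j.+1 then d j else (val \o eps : {linear C' 0%N -> C}).
exists m.+1, C'', d'', q; split=> //.
- by case=> [|i]; [split | exact: fgC'].
- by case=> // i lti; exact: trivC'.
- move=> y; rewrite kernelP; split=> [[z <-]|[x <-]].
    by have [x <-] := seps z; exists x.
  by exists (eps x).
case=> [|i] y; last exact: exd.
rewrite -(ex0 y); split=> [ey|ey]; first by apply/val_inj; exact: ey.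
by rewrite /= ey.
Qed.
End Resolved.

(** * Modules over the group algebra *)

Section GroupAlgebraModules.
Variable p : nat.
Hypothesis pr_p : prime p.
Variable K : groupType.
Local Notation A := (group_algebra 'F_p K).

Definition gunit (x : K) : A := << 1 *g x >>.

Lemma gunitM x y : gunit (x * y)%g = gunit x * gunit y.
Proof. by rewrite [RHS]galg_mulUU mulr1. Qed.

Lemma gunit1 : gunit 1%g = 1.
Proof. by []. Qed.

Lemma killed_FpD (Y : zmodType) (y : Y) (c d : 'F_p) : killed p Y ->
  y *+ (c + d)%R = y *+ c + y *+ d.
Proof.
move=> kY; rewrite -mulrnDr [in RHS](divn_eq (c + d)%N p) mulrnDr mulnC mulrnA kY mul0rn add0r.
by congr (_ *+ (_ %% _)%N); exact: Fp_cast.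
Qed.

Lemma killed_algebra (M : lmodType A) : killed p M.
Proof.
move=> m; rewrite -scaler_nat; suff -> : p%:R = 0 :> A by rewrite scale0r.
have -> : p%:R = << p%:R *g 1%g >> :> A by rewrite monalgUMn.
by rewrite pchar_Fp_0 // monalgU0.
Qed.

Lemma monalgU_gunit (c : 'F_p) x : << c *g x >> = gunit x *+ c :> A.
Proof. by rewrite /gunit -monalgUMn natr_Zp. Qed.

Section Pairing.
Variable Y : zmodType.
Hypothesis kY : killed p Y.
Implicit Types (a b : A) (w : K -> Y).

(** The F_p-linear extension of [w] to the group algebra. *)
Definition pairing a w : Y := \sum_(x <- msupp a) w x *+ a@_x.

Lemma pairingw (d : {fset K}) a w : (msupp a `<=` d)%fset ->
  pairing a w = \sum_(x <- d) w x *+ a@_x.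
Proof. by move=> le; apply: big_fset_incl => // x _ /mcoeff_outdom ->. Qed.

Lemma pairingD a b w : pairing (a + b) w = pairing a w + pairing b w.
Proof.
rewrite (pairingw w (msuppD_le a b)) (pairingw w (fsubsetUl (msupp a) (msupp b))).
rewrite (pairingw w (fsubsetUr (msupp a) (msupp b))) -big_split /=.
by apply: eq_bigr => x _; rewrite mcoeffD killed_FpD.
Qed.

Lemma pairing0 w : pairing 0 w = 0.
Proof. by rewrite /pairing msupp0 big_seq_fset0. Qed.

Lemma pairingU (c : 'F_p) x w : pairing << c *g x >> w = w x *+ c.
Proof. by rewrite (pairingw w msuppU_le) big_seq_fset1 mcoeffUU. Qed.

Lemma pairingBr a w w' : pairing a (fun x => w x - w' x) = pairing a w - pairing a w'.
Proof. by rewrite /pairing -sumrB; apply: eq_bigr => x _; rewrite mulrnBl. Qed.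

Lemma pairing_shift u a w : pairing (gunit u * a) w = pairing a (fun x => w (u * x)%g).
Proof.
rewrite [in LHS](monalgE a) mulr_sumr.
rewrite (big_morph (pairing^~ w) (fun _ _ => pairingD _ _ _) (pairing0 w)).
by apply: eq_bigr => x _; rewrite [gunit u * _]galg_mulUU mul1r pairingU.
Qed.

End Pairing.

Lemma scale_pairing (M : lmodType A) (a : A) (m : M) :
  a *: m = pairing a (fun x => gunit x *: m).
Proof.
rewrite [in LHS](monalgE a) scaler_suml; apply: eq_bigr => x _.
by rewrite monalgU_gunit scalerMnl.
Qed.

Lemma dual_basis (C : lmodType A) : finitely_generated C -> projective C ->
  exists (n : nat) (b : 'I_n -> C) (phi : 'I_n -> C -> A),
  [/\ forall j c c', phi j (c - c') = phi j c - phi j c',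
      forall j a c, phi j (a *: c) = a * phi j c
    & forall c, c = \sum_j phi j c *: b j].
Proof.
case=> n [b bE] prC; pose F := {ffun 'I_n -> A^o}.
pose q (x : F) : C := \sum_j x j *: b j.
have q_lin : linear q.
  move=> a x y; rewrite /q scaler_sumr -big_split; apply: eq_bigr => j _ /=.
  by rewrite !ffunE scalerDl scalerA.
pose Q : {linear F -> C} := HB.pack q (GRing.isLinear.Build _ _ _ _ q q_lin).
have [|h hE] := prC F C Q (idfun : {linear C -> C}).
  by move=> c; have [x ->] := bE c; exists [ffun j => x j]; apply: eq_bigr => j _; rewrite ffunE.
exists n, b, (fun j c => h c j); split.
- by move=> j c c'; rewrite linearB !ffunE.
- by move=> j a c; rewrite linearZ !ffunE.
- by move=> c; rewrite -{1}[c]/(idfun c) -hE.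
Qed.

Lemma free_cover (M : lmodType A) : finitely_generated M ->
  exists (F : lmodType A) (q : {linear F -> M}),
    [/\ finitely_generated F, projective F & surjective q].
Proof.
case=> n [b bE]; pose F := {ffun 'I_n -> A^o}.
have lin (N : lmodType A) (e : 'I_n -> N) :
    linear (fun x : F => \sum_j x j *: e j).
  move=> a x y; rewrite scaler_sumr -big_split; apply: eq_bigr => j _ /=.
  by rewrite !ffunE scalerDl scalerA.
pose Q (N : lmodType A) (e : 'I_n -> N) : {linear F -> N} :=
  HB.pack (fun x : F => \sum_j x j *: e j) (GRing.isLinear.Build _ _ _ _ _ (lin N e)).
pose d j : F := [ffun i => (i == j)%:R].
have dE (x : F) : x = \sum_j x j *: d j.
  apply/ffunP => i; rewrite sum_ffunE (bigD1 i) //= big1 => [|j ji].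
    by rewrite !ffunE eqxx addr0 [_ *: _]mulr1.
  by rewrite !ffunE eq_sym (negPf ji) scaler0.
exists F, (Q M b); split.
- by exists n, d => x; exists (fun j => x j).
- move=> N N' f g sf; have [m mE] := choice (fun j => sf (g (d j))).
  exists (Q N m) => x /=; rewrite [in RHS](dE x) !linear_sum.
  by apply: eq_bigr => j _; rewrite !linearZ mE.
- by move=> m; have [x ->] := bE m; exists [ffun j => x j]; apply: eq_bigr => j _; rewrite ffunE.
Qed.

Section Restricted.
Variables (G : groupType) (tau : G -> K).

(** The module [M] seen as a representation of another group, through [tau]. *)
Definition ract (M : lmodType A) (g : G) (m : M) : M := gunit (tau g) *: m.

Lemma gact_ract (U : groupClosed G) (M : lmodType A) :
  tau 1%g = 1%g -> {in U &, {morph tau : x y / (x * y)%g}} -> gact U (@ract M).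
Proof.
move=> t1 tM; split=> [u v w _|v|u u' v Uu Uu']; rewrite /ract.
- by rewrite scalerDr.
- by rewrite t1 gunit1 scale1r.
- by rewrite tM // gunitM scalerA.
Qed.

Lemma shortexact_kernel (U : groupClosed G) (C M : lmodType A) (q : {linear C -> M}) :
  tau 1%g = 1%g -> {in U &, {morph tau : x y / (x * y)%g}} -> surjective q ->
  shortexact U (@ract (kernel q)) (@ract C) (@ract M) (val : kernel q -> C) q.
Proof.
move=> t1 tM sq; split.
- by split; apply: gact_ract.
- by split=> //; exact: val_inj.
- by split=> // [c c'|u c _]; rewrite ?linearB // /ract linearZ.
- exact: kernelP.
Qed.

Lemma kernel_retraction (C M : lmodType A) (q : {linear C -> M}) :
  exists2 r : C -> kernel q, (forall c c', r (c - c') = r c - r c')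
    & forall z, r (val z) = z.
Proof.
apply: (@retraction p pr_p (kernel q) C val (@killed_algebra C)) => [z z'|]; last exact: val_inj.
by [].
Qed.

End Restricted.
End GroupAlgebraModules.

Section ExtProjective.
Variable p : nat.
Hypothesis pr_p : prime p.
Variables (H G : groupType) (iota : H -> G).
Hypotheses (iotaM : forall x y, iota (x * y)%g = (iota x * iota y)%g) (iotaI : injective iota).
Local Notation A := (group_algebra 'F_p H).

Lemma iota1 : iota 1%g = 1%g.
Proof. by apply: (mulgI (iota 1%g)); rewrite -iotaM !mulg1. Qed.

Lemma iotaV x : iota x^-1%g = (iota x)^-1%g.
Proof. by apply: (mulgI (iota x)); rewrite -iotaM !mulgV iota1. Qed.

(** Any left inverse of [iota] does: on a subgroup of the image of [iota] it is a
    homomorphism. *)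
Definition retr (g : G) : H := xget 1%g (fun h => iota h = g).

Lemma retrK h : retr (iota h) = h.
Proof.
rewrite /retr; case: xgetP => [h' _ /iotaI //|no].
by case: (no h).
Qed.

Lemma retr1 : retr 1%g = 1%g.
Proof. by rewrite -iota1 retrK. Qed.

Section Subgroup.
Variable U : groupClosed G.
Hypothesis Uiota : forall u, u \in U -> exists h, iota h = u.

Lemma retrM : {in U &, {morph retr : x y / (x * y)%g}}.
Proof.
by move=> x y /Uiota[h <-] /Uiota[k <-]; rewrite -iotaM !retrK.
Qed.

Local Notation act := (ract (p := p) retr).

Lemma gact_retr (M : lmodType A) : gact U (@ract p H G retr M).
Proof. exact: gact_ract retr1 retrM. Qed.

Section Projective.
Variables (C : lmodType A) (r : nat) (b : 'I_r -> C) (phi : 'I_r -> C -> A).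
Hypotheses (phiB : forall j c c', phi j (c - c') = phi j c - phi j c')
  (phiZ : forall j a c, phi j (a *: c) = a * phi j c)
  (phiE : forall c, c = \sum_j phi j c *: b j).

Let phiD j c c' : phi j (c + c') = phi j c + phi j c'.
Proof.
have phi0 : phi j 0 = 0 by rewrite -(subrr 0) phiB subrr.
by rewrite -{1}[c']opprK phiB -[- c']sub0r phiB phi0 sub0r opprK.
Qed.

Lemma homP_expand (aY : G -> C -> C) (Y : zmodType) (aY' : G -> Y -> Y) (L E : Y -> Prop)
    (f : C -> Y) m :
  coeff U aY' L E -> homP L E f ->
  E (f m - \sum_j pairing (phi j m) (fun h => f (gunit p h *: b j))).
Proof.
move=> LE hf; have [_ _ EU _] := LE.
rewrite {1}[m]phiE; apply: (usub_trans EU (homP_sum LE _ _ _ hf)).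
rewrite -sumrB; apply: (usub_sum EU) => j _; rewrite scale_pairing.
apply: (usub_trans EU (homP_sum LE _ _ _ hf)).
by rewrite -sumrB; apply: (usub_sum EU) => h _; exact: (homPMn LE).
Qed.

(** Dual bases give the contraction of the standard complex of a projective module:
    prepend a group element and read the coefficients of [m]. *)
Lemma Ext_projective n : Ext p false U (@ract p H G retr C) n.+2.
Proof.
move=> Y aY L E LE kY f cf df; have [aYG LU EU EL] := LE; have [f0 Lf fU] := cf.
exists [::]; split=> //; rewrite gen_nil //.
pose g t m := \sum_j pairing (phi j m) (fun h => f (iota h :: t) (gunit p h *: b j)).
have faG : gact U (fact (@ract p H G retr C) aY) by exact: gact_fact_mod (gact_retr _) _.
have hE := homP_usub (gact_retr C) LE.
have gL t : homP L E (g t).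
  split=> [m|m m'].
    by apply: (usub_sum LU) => j _; apply: (usub_sum LU) => h _; apply: (usubMn LU); case: (Lf (iota h :: t)).
  rewrite /g -!sumrB; under eq_bigr => j _ do rewrite phiD pairingD // addrAC addrK subrr.
  by rewrite big1_eq; exact: usub0 EU.
exists (cutoff n.+1 g).
  split=> // [t|u t Uu]; rewrite /cutoff ?size_translate; case: eqP => // _.
  - exact: usub0 hE.
  - apply/funext => m; have [h0 h0u] := Uiota Uu; rewrite /fact /g.
    rewrite (gact_sum aYG) //; apply: eq_bigr => j _.
    rewrite /ract -h0u -iotaV retrK phiZ pairing_shift // /pairing (gact_sum aYG) ?h0u //.
    apply: eq_bigr => h _; rewrite (gactMn aYG) //; congr (_ *+ _).
    have := fU u (iota (h0^-1 * h)%g :: t) Uu.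
    rewrite /= iotaM iotaV h0u mulVKg => ->; rewrite /fact.
    by rewrite /ract -h0u -iotaV retrK gunitM scalerA.
  - by apply/funext => m; rewrite /fact /= (gact0 aYG).
move=> t m st; rewrite !delta_app.
rewrite (eq_delta (g := fun t => g t m)); last by move=> s; rewrite st /cutoff => -[->]; rewrite eqxx.
pose W t h j := f (iota h :: t) (gunit p h *: b j).
pose ev (w : H -> 'I_r -> Y) := \sum_j pairing (phi j m) (w^~ j).
have evB w w' : ev (w - w') = ev w - ev w'.
  by rewrite /ev -sumrB; apply: eq_bigr => j _; exact: pairingBr.
have -> : (fun t => g t m) = fun t => ev (W t) by [].
rewrite (delta_map (V := H -> 'I_r -> Y) (W := Y) W t evB).
have -> : delta (V := H -> 'I_r -> Y) W t =
    (fun h j => f t (gunit p h *: b j)) - (fun h j => delta f (iota h :: t) (gunit p h *: b j)).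
  apply/funext => h; apply/funext => j.
  rewrite delta_app [LHS](delta_app (fun t => W t h)) /=.
  by rewrite -[RHS]/(f t _ - (f t _ - delta (fun s => f (iota h :: s)) t _)) subKr delta_app.
rewrite evB opprB addrCA; apply: (usubD EU); last first.
  exact: (homP_expand (@ract p H G retr C) m LE (Lf t)).
apply: (usub_sum EU) => j _; apply: (usub_sum EU) => h _; apply: (usubMn EU).
by apply: df; rewrite /= st.
Qed.

(** In degree 0 a homomorphism on a finitely generated module takes, up to the action of
    [U], finitely many values on a dual basis, as [U] has finite index in [H]. *)
Lemma Ext_projective1 (s : seq H) :
  (forall h, exists2 y, y \in s & iota (h * y^-1)%g \in U) ->
  Ext p true U (@ract p H G retr C) 1.
Proof.
move=> sU Y aY L E LE kY f cf df; have [aYG LU EU EL] := LE; have [f0 Lf fU] := cf.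
pose S := [seq f [:: 1%g] (gunit p y *: b j) | y <- s, j <- enum 'I_r].
have SL y : y \in S -> L y by case/allpairsP => -[x j] /= [_ _ ->]; case: (Lf [:: 1%g]).
exists S; split=> //; have LE' := coeff_gen LE SL; have [_ _ EU' _] := LE'.
have hE := homP_usub (gact_retr C) LE'.
exists (fun _ => 0).
  by apply: cochain0 => //; exact: gact_fact_mod (gact_retr _) _.
move=> [|x [|y t]] m // _; rewrite delta0 subr0.
have fx h j : gen U aY E S (f [:: x] (gunit p h *: b j)).
  have [y ys yU] := sU h; set u := iota _ in yU.
  have -> : h = ((h * y^-1) * y)%g by rewrite mulgVK.
  have := df [:: x; u] (gunit p (h * y^-1 * y)%g *: b j) erefl.
  rewrite /= subr0 => fxu.
  have {}fxu := usubC EU' (gen_base (U := U) (a := aY) (S := S) fxu).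
  apply: (usubW EU' fxu); have [h0 h0u] := Uiota yU.
  have := fU u [:: 1%g] yU; rewrite /= mulg1 => ->; rewrite /fact.
  apply: (usubA EU') => //; apply: gen_seed.
  rewrite /ract -h0u -iotaV retrK scalerA -gunitM.
  have -> : h0 = (h * y^-1)%g by apply: iotaI.
  rewrite mulgA mulVg mul1g; apply/allpairsP; exists (y, j).
  by rewrite ys mem_enum.
have [_ _ EU'' _] := LE'.
have hf : homP L (gen U aY E S) (f [:: x]) by apply: homPW (Lf _) => z; exact: gen_base.
apply: (usubW EU' (homP_expand (@ract p H G retr C) m LE' hf)).
by apply: (usub_sum EU') => j _; apply: (usub_sum EU') => h _; apply: (usubMn EU').
Qed.

End Projective.
End Subgroup.
End ExtProjective.

(** * Recognising modules of type FP *)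

Section ExtCongr.
Variables (p : nat) (G : groupType) (U : groupClosed G).

Lemma cochain_congr (V : zmodType) (a a' : G -> V -> V) (L : V -> Prop) f :
  (forall u v, u \in U -> a u v = a' u v) -> cochain U a L f -> cochain U a' L f.
Proof. by move=> aa [f0 Lf fU]; split=> // u t Uu; rewrite fU // aa. Qed.

Lemma Ext_congr b (M : zmodType) (a a' : G -> M -> M) n :
  (forall u m, u \in U -> a u m = a' u m) -> Ext p b U a n -> Ext p b U a' n.
Proof.
move=> aa ext Y aY L E LE kY f cf df.
have [||S [nS SL [g cg fg]]] := ext Y aY L E LE kY f => //.
  apply: cochain_congr cf => u phi Uu; apply/funext => m.
  by rewrite /fact aa // gpredV.
exists S; split=> //; exists g => //; apply: cochain_congr cg => u phi Uu.
by apply/funext => m; rewrite /fact aa // gpredV.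
Qed.

Lemma Ext_trivial b (M : zmodType) (a : G -> M -> M) n :
  gact U a -> (forall m : M, m = 0) -> Ext p b U a n.
Proof.
move=> aG M0 Y aY L E LE kY f cf df; have [aYG LU EU EL] := LE.
exists [::]; split=> //; first exact: orbT.
rewrite gen_nil //; exists (fun _ => 0).
  by apply: cochain0; [exact: gact_fact_mod aG aYG | exact: homP_usub aG LE].
move=> t m _; rewrite delta0 subr0 (M0 m); case: cf => _ Lf _.
exact: (homP0 LE (Lf t)).
Qed.

End ExtCongr.

Definition triv (G : groupType) (p : nat) (g : G) (m : 'F_p) : 'F_p := m.

Section ExtResolved.
Variable p : nat.
Hypothesis pr_p : prime p.
Variables (H G : groupType) (iota : H -> G).
Hypotheses (iotaM : forall x y, iota (x * y)%g = (iota x * iota y)%g) (iotaI : injective iota).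
Variable U : groupClosed G.
Hypothesis Uiota : forall u, u \in U -> exists h, iota h = u.
Local Notation A := (group_algebra 'F_p H).
Local Notation act M := (@ract p H G (retr iota) M).

Let t1 : retr iota 1%g = 1%g. Proof. exact: retr1. Qed.
Let tM : {in U &, {morph retr iota : x y / (x * y)%g}}. Proof. exact: retrM. Qed.

Lemma Ext_fgproj (C : lmodType A) n : finitely_generated C -> projective C ->
  Ext p false U (act C) n.+2.
Proof.
move=> fgC prC; have [r [b [phi [phiB phiZ phiE]]]] := dual_basis fgC prC.
exact: (Ext_projective pr_p iotaM iotaI Uiota phiB phiZ phiE).
Qed.

Lemma Ext_true_fgproj (C : lmodType A) (s : seq H) n :
  (forall h, exists2 y, y \in s & iota (h * y^-1)%g \in U) ->
  finitely_generated C -> projective C -> Ext p true U (act C) n.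
Proof.
move=> sU fgC prC; case: n => [|[|n]].
- exact/Ext0/gact_ract.
- have [r [b [phi [phiB phiZ phiE]]]] := dual_basis fgC prC.
  exact: (Ext_projective1 iotaM iotaI Uiota phiE sU).
- by apply: Ext_true; [exact: gact_ract | exact: Ext_fgproj].
Qed.

Lemma Ext_resolved n (M : lmodType A) k : resolved n M -> (n < k)%N ->
  Ext p false U (act M) k.
Proof.
elim: n M k => [|n IH] M k /=; first by move=> M0 _; apply: Ext_trivial => //; exact: gact_ract.
case=> C [q [fgC prC sq res]]; case: k => [|[|k]] // ltnk.
have [r rB rK] := kernel_retraction pr_p q.
apply: (Ext_quot (shortexact_kernel t1 tM sq) rB rK); first exact: Ext_fgproj.
exact: IH.
Qed.

Lemma Ext_true_resolved n (M : lmodType A) (s : seq H) k :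
  (forall h, exists2 y, y \in s & iota (h * y^-1)%g \in U) ->
  resolved n M -> Ext p true U (act M) k.
Proof.
move=> sU; elim: n M k => [|n IH] M k /=.
  by move=> M0; apply: Ext_trivial => //; exact: gact_ract.
case=> C [q [fgC prC sq res]]; have [r rB rK] := kernel_retraction pr_p q.
apply: (Ext_quot (shortexact_kernel t1 tM sq) rB rK); last exact: IH.
exact: Ext_true_fgproj sU fgC prC.
Qed.

Lemma ract_trivial g (m : trivial_module 'F_p H) : act (trivial_module 'F_p H) g m = m.
Proof.
rewrite /ract -[LHS]/(augmentation (gunit p (retr iota g)) * (m : 'F_p)).
by rewrite augmentationU mul1r.
Qed.

End ExtResolved.

Section Criterion.
Variable p : nat.
Hypothesis pr_p : prime p.
Variables (K G : groupType) (tau : G -> K) (lam : K -> G) (N U : groupClosed G).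
Hypotheses (tau1 : tau 1%g = 1%g) (UN : {subset U <= N}).
Hypothesis tauM : {in N &, {morph tau : x y / (x * y)%g}}.
Hypotheses (lamU : forall k, lam k \in U) (lamK : forall k, tau (lam k) = k).
Local Notation A := (group_algebra 'F_p K).
Local Notation act M := (@ract p K G tau M).

Let tauMU : {in U &, {morph tau : x y / (x * y)%g}}.
Proof. by move=> x y /UN Nx /UN; exact: tauM. Qed.

Lemma fg_of_gen (M : lmodType A) (S : seq M) :
  (forall m, gen N (act M) (fun m => m = 0) S m) -> finitely_generated M.
Proof.
move=> genM; exists (size S), (fun i => nth 0 S i) => m.
pose Q (m : M) := exists c : 'I_(size S) -> A, m = \sum_(i < size S) c i *: nth 0 S i.
apply: (genM m Q) => [|e ->|s sS].
- split; first by exists (fun _ => 0); rewrite big1 // => i _; rewrite scale0r.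
    move=> v w [c ->] [d ->]; exists (fun i => c i - d i).
    by rewrite -sumrB; apply: eq_bigr => i _; rewrite scalerBl.
  move=> u v _ [c ->]; exists (fun i => gunit p (tau u) * c i).
  by rewrite /ract scaler_sumr; apply: eq_bigr => i _; rewrite scalerA.
- by exists (fun _ => 0); rewrite big1 // => i _; rewrite scale0r.
- have lts : (index s S < size S)%N by rewrite index_mem.
  exists (fun i => (i == Ordinal lts)%:R); rewrite (bigD1 (Ordinal lts)) //= big1 => [|i /negPf ->].
    by rewrite eqxx scale1r addr0 nth_index.
  by rewrite scale0r.
Qed.

(** Tested on the identity of [M], as a homomorphism to [M] modulo 0, the property says
    that finitely many elements generate [M]. *)
Lemma fg_of_Ext1 (M : lmodType A) : Ext p true N (act M) 1 -> finitely_generated M.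
Proof.
move=> ext; have aG : gact N (act M) by exact: gact_ract.
pose f (t : seq G) (m : M) := if t is [::] then 0 else m.
have LE : coeff N (act M) (fun _ => True) (fun m => m = 0).
  by split=> //; exact: usub_eq0.
have [||S [_ _ [g [g0 _ _] fg]]] := ext M (act M) _ _ LE (@killed_algebra p pr_p K M) f.
- split=> // [t|u [|x t] Nu].
  + by split=> // m m'; case: t => [|x t] /=; rewrite ?subr0 // addrAC addrK subrr.
  + by apply/funext => m; rewrite /fact /= (gact0 aG).
  + by apply/funext => m; rewrite /fact /= (gactKV aG).
- by case=> [|x [|y [|z t]]] // m _ /=; rewrite subr0 -[LHS]/(m - m) subrr.
apply: (@fg_of_gen M S) => m; have := fg [:: 1%g] m erefl.
by rewrite /= g0 !subr0.
Qed.

Lemma additive_linear (M N' : lmodType A) (h : M -> N') :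
  (forall m m', h (m - m') = h m - h m') ->
  (forall k m, h (gunit p k *: m) = gunit p k *: h m) -> linear h.
Proof.
move=> hB hG; have h0 : h 0 = 0 by rewrite -(subrr 0) hB subrr.
have hD m m' : h (m + m') = h m + h m'.
  by rewrite -{1}[m']opprK hB -[- m']sub0r hB h0 sub0r opprK.
have hMn m n : h (m *+ n) = h m *+ n.
  by elim: n => [|n IH]; rewrite ?mulr0n // !mulrS hD IH.
move=> a m m'; rewrite hD !scale_pairing /pairing; congr (_ + _).
rewrite (big_morph h hD h0); apply: eq_bigr => x _.
by rewrite hMn hG.
Qed.

(** The obstruction to lifting a homomorphism g along a surjection f is a class of
    degree 1 with values in the kernel of f. *)
Lemma projective_of_Ext2 (B : lmodType A) : Ext p false U (act B) 2 -> projective B.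
Proof.
move=> ext M M' f g sf.
have aG (X : lmodType A) : gact U (act X) by exact: gact_ract.
have [r rB rK] := kernel_retraction pr_p f.
have [sec secE] := choice sf.
have f_r m : f (val (r m)) = 0 by apply/kernelP; exists (r m).
(* An additive lift of g, by a retraction on the kernel of f; its coboundary is the
   obstruction. *)
pose g0 b := sec (g b) - val (r (sec (g b))).
have fg0 b : f (g0 b) = g b by rewrite linearB f_r subr0 secE.
have ker_r m : f m = 0 -> val (r m) = m by move=> /kernelP[z <-]; rewrite rK.
have g0B b b' : g0 (b - b') = g0 b - g0 b'.
  rewrite /g0 linearB; set s := sec _; set s1 := sec _; set s2 := sec _.
  have fs : f (s - (s1 - s2)) = 0 by rewrite !(linearB f) /s /s1 /s2 !secE subrr.
  have := ker_r _ fs; rewrite !rB.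
  rewrite -[val (r s - (r s1 - r s2))]/(val (r s) - (val (r s1) - val (r s2))).
  move=> /eqP; rewrite subr_eq => /eqP e.
  have -> : s1 - val (r s1) - (s2 - val (r s2)) = s1 - s2 - (val (r s1) - val (r s2)).
    by rewrite !opprD !opprK addrACA.
  apply/eqP; rewrite subr_eq e addrC -addrA [X in _ == _ + X]addrC !subrK.
  by [].
have g00 : g0 0 = 0 by rewrite -(subrr 0) g0B subrr.
have g0D b b' : g0 (b + b') = g0 b + g0 b'.
  by rewrite -{1}[b']opprK g0B -[- b']sub0r g0B g00 sub0r opprK.
pose L (m : M) := f m = 0.
have LE : coeff U (act M) (fun _ => True) (fun m => m = 0).
  by split=> //; exact: usub_eq0.
have LE0 : coeff U (act M) L (fun m => m = 0).
  split=> //; [|exact: usub_eq0 | by move=> y ->; rewrite /L linear0].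
  split=> [|v w Lv Lw|u v _ Lv]; rewrite /L ?linear0 // ?linearB ?Lv ?Lw ?subr0 //.
  by rewrite linearZ /= Lv scaler0.
pose gh := strict U (fact (act B) (act M)) (fun _ => g0).
have cgh : cochain U (fact (act B) (act M)) (homP (fun _ => True) (fun m => m = 0)) gh.
  apply: cochain_strict; [exact: gact_fact_mod | exact: homP_usub|].
  by move=> _; split=> // m m'; rewrite g0D addrAC addrK subrr.
have fgh x t b : f (gh (x :: t) b) = g b.
  rewrite /gh /strict /fact /ract linearZ /= fg0 linearZ /= scalerA -gunitM //.
  by rewrite -tauMU ?kappa_mem ?gpredV ?kappa_mem // mulgV tau1 gunit1 scale1r.
have [||S [nS _ [e ce ge]]] := ext M (act M) _ _ LE0 (@killed_algebra p pr_p K M) (cutoff 2 (delta gh)).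
- have hE := homP_usub (aG B) LE.
  have cd := cochain_delta (gact_fact_mod (aG B) (aG M)) hE cgh.
  apply: (cochain_cutoff (gact_fact_mod (aG B) (aG M)) (homP_usub (aG B) LE0) cd).
  move=> [|x [|y [|z t]]] // _; case: cd => _ /(_ [:: x; y])[_ hadd] _.
  split=> [m|m m']; last exact: hadd.
  rewrite /L delta_app /= subr0 -[X in f X]/(gh [:: y] m - gh [:: x] m).
  by rewrite linearB !fgh subrr.
- by move=> t m st; rewrite delta_cutoff // delta_delta.
case: S nS ge ce => //= _; rewrite gen_nil; last exact: usub_eq0.
move=> ge [e0 Le eU].
pose w t b := gh t b - e t b.
have wconst x y b : w [:: x] b = w [:: y] b.
  have := ge [:: x; y] b erefl; rewrite cutoffE // !delta_app /= !subr0.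
  move/eqP; rewrite -[X in X == 0 -> _]/((gh [:: y] b - gh [:: x] b) - (e [:: y] b - e [:: x] b)).
  rewrite subr_eq0 subr_eq /w => /eqP ->.
  by rewrite addrAC (addrAC (e [:: y] b)) subrr sub0r addrC.
pose h b := w [:: 1%g] b.
have cw : cochain U (fact (act B) (act M)) (homP (fun _ => True) (fun m => m = 0)) w.
  apply: (cochainB (gact_fact_mod (aG B) (aG M)) (homP_usub (aG B) LE) cgh).
  apply: cochainW (And3 e0 Le eU) => phi [Lphi Ephi]; split=> //.
have [_ wadd wU] := cw.
have h_lin : linear h.
  apply: additive_linear => [m m'|k m].
    by apply/eqP; rewrite -subr_eq0; apply/eqP; apply: (homPB LE); exact: wadd.
  have := wU (lam k) [:: 1%g] (lamU k); rewrite /= mulg1 => /(congr1 (fun F => F (gunit p k *: m))).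
  rewrite (wconst _ 1%g) /fact => e1; rewrite [LHS]e1 /ract lamK scalerA -gunitM.
  have -> : tau (lam k)^-1%g = k^-1%g.
    by apply: (mulgI k); rewrite mulgV -{1}[k]lamK -tauMU ?gpredV // mulgV.
  by rewrite mulVg gunit1 scale1r.
exists (HB.pack_for {linear B -> M} h (GRing.isLinear.Build _ _ _ _ h h_lin)) => b /=.
have [Leb _] := Le [:: 1%g].
by rewrite /h /w linearB fgh Leb subr0.
Qed.

(** Induction on the degree [d] above which Ext over [U] vanishes. Finite generation
    gives a free cover, and its kernel inherits all hypotheses with one degree less, by
    [Ext_ker]. The group [N] tests finiteness, the group [U] tests projectivity; they
    differ in the main application, where only [U] has finite cohomological dimension. *)
Lemma resolution_of_Ext n1 d (B : lmodType A) :
  (forall (F : lmodType A) n, finitely_generated F -> projective F ->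
     (n1 <= n)%N -> Ext p true N (act F) n) ->
  (forall (F : lmodType A) n, finitely_generated F -> projective F ->
     Ext p false U (act F) n.+2) ->
  (forall M : lmodType A, (forall n, (n1 <= n)%N -> Ext p true N (act M) n) ->
     finitely_generated M) ->
  (forall n, (n1 <= n)%N -> Ext p true N (act B) n) ->
  (forall n, (d.+1 < n)%N -> Ext p false U (act B) n) ->
  finite_fg_projective_resolution B.
Proof.
move=> extF extF' fgM extB extB'.
suff [m res] : exists m, resolved m B by exact: resolution_of_resolved res.
elim: d B extB extB' => [|d IH] B extB extB'.
  exists 1%N, B, (idfun : {linear B -> B}); split.
  - exact: fgM.
  - by apply: projective_of_Ext2; exact: extB'.
  - by move=> b; exists b.
  - by move=> z; apply/val_inj; apply/(kernelP (idfun : {linear B -> B})); exists z.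
have [F [q [fgF prF sq]]] := free_cover (fgM _ extB).
have [r rB rK] := kernel_retraction pr_p q.
have [||m res] := IH (kernel q).
- move=> n len; apply: (Ext_ker (shortexact_kernel tau1 tauM sq) rB rK).
    by apply: extB; exact: leqW.
  exact: extF.
- case=> [|[|n]] // ltdn; apply: (Ext_ker (shortexact_kernel tau1 tauMU sq) rB rK).
    exact: extB'.
  exact: extF'.
by exists m.+1, F, q.
Qed.

End Criterion.

(** * Type FP and subgroups of finite index *)

Section FiniteIndex.
Variable p : nat.
Hypothesis pr_p : prime p.

(** The bound depends on the resolution only, and thus holds for every subgroup of [H]
    in every overgroup; the second property needs a subgroup of finite index. *)
Lemma Ext_of_type_FP (H : groupType) : type_FP 'F_p H ->
  exists n0, forall (G : groupType) (iota : H -> G) (U : groupClosed G),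
    (forall x y, iota (x * y)%g = (iota x * iota y)%g) -> injective iota ->
    (forall u, u \in U -> exists h, iota h = u) ->
    (forall k, (n0 < k)%N -> Ext p false U (@triv G p) k) /\
    (forall (s : seq H) k, (forall h, exists2 y, y \in s & iota (h * y^-1)%g \in U) ->
       Ext p true U (@triv G p) k).
Proof.
move/resolved_of_resolution => [n0 res]; exists n0 => G iota U iotaM iotaI Uiota.
split=> [k ltk|s k sU].
  have h := Ext_resolved pr_p iotaM iotaI Uiota res ltk.
  refine (Ext_congr (M := (trivial_module 'F_p H : lmodType _)) (a' := @triv G p) _ h).
  by move=> u m _; exact: ract_trivial.
have h := Ext_true_resolved (k := k) pr_p iotaM iotaI Uiota sU res.
refine (Ext_congr (M := (trivial_module 'F_p H : lmodType _)) (a' := @triv G p) _ h).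
by move=> u m _; exact: ract_trivial.
Qed.

Lemma type_FP_of_Ext (G : groupType) (U : groupClosed G) n0 :
  (forall k, (n0 < k)%N -> Ext p false U (@triv G p) k) ->
  (forall k, Ext p true U (@triv G p) k) ->
  type_FP 'F_p (subgroup_type U).
Proof.
move=> ext extt; set K := subgroup_type U; pose iota : K -> G := val.
have iotaM x y : iota (x * y)%g = (iota x * iota y)%g by [].
have iotaI : injective iota by exact: val_inj.
have Uiota u : u \in U -> exists h, iota h = u by move=> Uu; exists (Sub u Uu).
have lamU k : iota k \in U by exact: valP.
have t1 := retr1 iotaM iotaI; have tM := retrM iotaM iotaI Uiota.
have tK := retrK iotaI.
(* Both roles in the criterion are played by U itself. *)
apply: (resolution_of_Ext pr_p t1 (fun x h => h) tM lamU tK (n1 := 0%N) (d := n0)).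
- move=> F n fgF prF _.
  apply: (Ext_true_fgproj pr_p iotaM iotaI Uiota (s := [:: 1%g])) => // h.
  by exists 1%g; rewrite ?inE.
- by move=> F n fgF prF; exact: Ext_fgproj.
- by move=> M extM; apply: (fg_of_Ext1 pr_p t1 tM); exact: extM.
- move=> n _; refine (Ext_congr (M := (trivial_module 'F_p K : lmodType _)) _ (extt n)).
  by move=> u m _; exact/esym/ract_trivial.
- move=> n ltn; refine (Ext_congr (M := (trivial_module 'F_p K : lmodType _)) _ (ext n _)).
    by move=> u m _; exact/esym/ract_trivial.
  exact: ltnW.
Qed.

Lemma type_FP_finite_index (H G : groupType) (iota : H -> G) (U : groupClosed G) (s : seq H) :
  (forall x y, iota (x * y)%g = (iota x * iota y)%g) -> injective iota ->
  (forall u, u \in U -> exists h, iota h = u) ->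
  (forall h, exists2 y, y \in s & iota (h * y^-1)%g \in U) ->
  type_FP 'F_p H -> type_FP 'F_p (subgroup_type U).
Proof.
move=> iotaM iotaI Uiota sU /Ext_of_type_FP[n0 ext].
have [extf extt] := ext G iota U iotaM iotaI Uiota.
by apply: (type_FP_of_Ext extf) => k; exact: extt sU.
Qed.

End FiniteIndex.

(** * The semidirect product by an automorphism of order p *)

(** The hypotheses are parameters of the type, so that its group structure can
    be inferred from it. *)
Definition semidirect (p : nat) (H : groupType) (sigma : H -> H)
    (pr_p : prime p) (sigmaM : {morph sigma : x y / (x * y)%g})
    (sigmap : forall x, iter p sigma x = x) : Type := (H * 'F_p)%type.

Section Semidirect.
Variables (p : nat) (H : groupType).
Hypothesis pr_p : prime p.
Variable sigma : H -> H.
Hypotheses (sigmaM : {morph sigma : x y / (x * y)%g}) (sigmap : forall x, iter p sigma x = x).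

Lemma iter_Fp (i j : 'F_p) x : iter (i + j)%R sigma x = iter i sigma (iter j sigma x).
Proof.
rewrite -iterD [in RHS](divn_eq (i + j)%N p) addnC iterD.
have -> : iter ((i + j) %/ p * p) sigma x = x.
  by elim: (_ %/ _)%N => [//|n IH]; rewrite mulSn iterD IH sigmap.
by congr (iter (_ %% _)%N _ _); exact: Fp_cast.
Qed.

Lemma iter_sigmaM n : {morph iter n sigma : x y / (x * y)%g}.
Proof. by move=> x y; elim: n => //= n ->; rewrite sigmaM. Qed.

Lemma iter_sigma1 n : iter n sigma 1%g = 1%g.
Proof. by apply: (mulgI (iter n sigma 1%g)); rewrite -iter_sigmaM !mulg1. Qed.

HB.instance Definition _ := Choice.copy (semidirect pr_p sigmaM sigmap) (H * 'F_p)%type.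
Local Notation semidirect := (semidirect pr_p sigmaM sigmap).

Definition sd_mul (g h : H * 'F_p) : H * 'F_p :=
  ((g.1 * iter g.2 sigma h.1)%g, g.2 + h.2).
Definition sd_one : H * 'F_p := (1%g, 0).
Definition sd_inv (g : H * 'F_p) : H * 'F_p :=
  (iter (- g.2)%R sigma g.1^-1%g, - g.2).

Fact sd_mulA : associative sd_mul.
Proof.
move=> [g i] [h j] [k l]; congr pair => /=; last by rewrite addrA.
by rewrite iter_sigmaM iter_Fp mulgA.
Qed.
Fact sd_mul1 : left_id sd_one sd_mul.
Proof. by move=> [g i]; rewrite /sd_mul /= mul1g add0r. Qed.
Fact sd_mulr1 : right_id sd_one sd_mul.
Proof. by move=> [g i]; rewrite /sd_mul /= iter_sigma1 mulg1 addr0. Qed.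
Fact sd_mulV : left_inverse sd_one sd_inv sd_mul.
Proof.
move=> [g i]; rewrite /sd_mul /= addNr; congr pair.
by rewrite -iter_sigmaM mulVg iter_sigma1.
Qed.
Fact sd_mulrV : right_inverse sd_one sd_inv sd_mul.
Proof.
move=> [g i]; congr pair; last exact: addrN.
rewrite -[LHS]/(g * iter i sigma (iter (- i)%R sigma g^-1))%g.
by rewrite -iter_Fp addrN /= mulgV.
Qed.

HB.instance Definition _ := isGroup.Build semidirect
  sd_mulA sd_mul1 sd_mulr1 sd_mulV sd_mulrV.

End Semidirect.

(** * From the normal subgroup to the semidirect product *)

Section SubgroupOf.
Variables (G : groupType) (P : G -> Prop).
Hypotheses (P1 : P 1%g) (PM : forall x y, P x -> P y -> P (x * y)%g)
  (PV : forall x, P x -> P x^-1%g).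

Let S : {pred G} := fun x => `[< P x >].

Fact subgroup_of1 : 1%g \in S. Proof. exact/asboolP. Qed.
Fact subgroup_ofM : mulg_closed S.
Proof. by move=> x y /asboolP Px /asboolP Py; apply/asboolP; exact: PM. Qed.
Fact subgroup_ofV : invg_closed S.
Proof. by move=> x /asboolP Px; apply/asboolP; exact: PV. Qed.

Definition subgroup_of : groupClosed G :=
  HB.pack_for (groupClosed G) S (isMul1Closed.Build G S subgroup_of1)
    (isMulClosed.Build G S subgroup_ofM) (isInvClosed.Build G S subgroup_ofV).

Lemma subgroup_ofP x : x \in subgroup_of <-> P x.
Proof. by split=> [/asboolP|Px]; last exact/asboolP. Qed.
End SubgroupOf.

Definition whole (G : groupType) : groupClosed G :=
  subgroup_of (P := fun _ : G => True) I (fun _ _ _ _ => I) (fun _ _ => I).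

Lemma in_whole (G : groupType) (x : G) : x \in whole G.
Proof. exact/subgroup_ofP. Qed.

Section Periodicity.
Variables (p : nat) (H : groupType).
Hypothesis pr_p : prime p.
Variable sigma : H -> H.
Hypotheses (sigmaM : {morph sigma : x y / (x * y)%g}) (sigmap : forall x, iter p sigma x = x).
Local Notation G := (semidirect pr_p sigmaM sigmap).

Lemma sdM (g h : G) : (g * h)%g = ((g.1 * iter g.2 sigma h.1)%g, g.2 + h.2) :> G.
Proof. by []. Qed.
Lemma sdV (g : G) : (g^-1)%g = (iter (- g.2)%R sigma g.1^-1%g, - g.2) :> G.
Proof. by []. Qed.
Definition sd_inj (h : H) : G := (h, 0).
Definition sd_rot (i : 'F_p) : G := (1%g, i).

Lemma sd_injM h k : sd_inj (h * k)%g = (sd_inj h * sd_inj k)%g.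
Proof. by rewrite sdM /= add0r. Qed.

Lemma sd_inj_inj : injective sd_inj.
Proof. by move=> h k []. Qed.

Lemma sd_rotD i j : sd_rot (i + j) = (sd_rot i * sd_rot j)%g.
Proof. by rewrite sdM /= iter_sigma1 // mulg1. Qed.

Lemma sd_decomp (g : G) : g = (sd_inj g.1 * sd_rot g.2)%g.
Proof. by case: g => g i; rewrite sdM /= mulg1 add0r. Qed.

Lemma sd_rot_inj i h : (sd_rot i * sd_inj h)%g = (sd_inj (iter i sigma h) * sd_rot i)%g.
Proof. by rewrite !sdM /= mul1g mulg1 addr0 add0r. Qed.

(** The copy of [H] in the semidirect product. *)
Definition base : groupClosed G.
Proof.
refine (subgroup_of (P := fun g : G => g.2 = 0) _ _ _) => //.
- by move=> x y; rewrite sdM /= => -> ->; rewrite addr0.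
- by move=> x; rewrite sdV /= => ->; rewrite oppr0.
Defined.

Lemma baseP g : g \in base <-> g.2 = 0.
Proof. exact: subgroup_ofP. Qed.

Lemma base_inj h : sd_inj h \in base.
Proof. exact/baseP. Qed.

Local Notation Q := {ffun 'F_p -> ('F_p)^o}.

(** The permutation module on the quotient of [G] by [base]. *)
Definition actQ (g : G) (q : Q) : Q := [ffun i => q (i - g.2)].

Lemma gact_actQ U : gact U actQ.
Proof.
split=> [u v w _|v|u u' v _ _]; apply/ffunP => i; rewrite !ffunE //.
- by rewrite subr0.
- by rewrite /= opprD addrA.
Qed.

Definition single (i : 'F_p) (m : 'F_p) : Q := [ffun j => if j == i then m else 0].

Lemma act_single g i m : actQ g (single i m) = single (i + g.2) m.
Proof. by apply/ffunP => j; rewrite !ffunE subr_eq. Qed.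

Lemma sum_single (q : Q) : q = \sum_i single i (q i).
Proof.
apply/ffunP => j; rewrite sum_ffunE (bigD1 j) //= ffunE eqxx big1 ?addr0 // => i ij.
by rewrite ffunE eq_sym (negPf ij).
Qed.

(** Shapiro's lemma for [Q], which is induced from the trivial module of [base]. *)
Lemma Ext_induced n : Ext p true base (@triv G p) n -> Ext p true (whole G) actQ n.
Proof.
move=> ext Y aY L E LE kY f cf df; have [aYG LU EU EL] := LE; have [f0 Lf fU] := cf.
have wG (g : G) := in_whole g.
have sub : {subset base <= whole G} by move=> x _.
have to_base X : usub (whole G) aY X -> usub base aY X.
  by case=> X0 XB XA; split=> // u v _; exact: XA.
have LEb : coeff base aY L E.
  by split=> //; [exact: gact_sub sub aYG | exact: to_base | exact: to_base].
have [||S [_ SL [g1 cg1 fg1]]] := ext Y aY L E LEb kY (fun t m => f t (single 0 m)).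
- split=> [|t|u t /baseP u0]; first by rewrite f0.
    have [Lft Eft] := Lf t; split=> [m|m m'] //.
    have -> : single 0 (m + m') = single 0 m + single 0 m' => //.
    by apply/ffunP => j; rewrite !ffunE; case: eqP; rewrite ?addr0.
  rewrite fU //; apply/funext => m; rewrite /fact act_single sdV /= u0 oppr0 addr0.
  by [].
- move=> t m st; rewrite delta_app.
  by have := df t (single 0 m) st; rewrite delta_app.
have LE2 := coeff_gen LE SL; set E2 := gen _ _ _ _ in LE2; have [_ _ E2U _] := LE2.
have E12 y : gen base aY E S y -> E2 y.
  apply: gen_min => [|e|s]; [exact: to_base | exact: gen_base | exact: gen_seed].
have [g10 Lg1 g1U] := cg1.
pose g t (q : Q) := \sum_i aY (sd_rot i) (g1 (translate (sd_rot i)^-1%g t) (q i)).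
exists S; split=> //; exists g.
  split=> [|t|u t _].
  - apply/funext => q; rewrite /g big1 // => i _.
    by rewrite /= g10 (gact0 aYG).
  - split=> [q|q q'].
      by apply: (usub_sum LU) => i _; apply: (usubA LU) => //; case: (Lg1 (translate (sd_rot i)^-1%g t)).
    rewrite /g -!sumrB; apply: (usub_sum E2U) => i _; rewrite -!(gactB aYG) //.
    by apply: (usubA E2U) => //; rewrite ffunE; apply: E12; case: (Lg1 (translate (sd_rot i)^-1%g t)).
  - apply/funext => q; rewrite /fact /g (gact_sum aYG) //.
    rewrite (reindex_inj (addIr u.2)) /=; apply: eq_bigr => i _.
    rewrite ffunE sdV /= opprK -(gactM aYG) //.
    set h := sd_inj (iter (- (i + u.2))%R sigma u.1).
    have uE : (u * sd_rot i)%g = (sd_rot (i + u.2) * h)%g.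
      rewrite /h -[sd_inj _]mulg1.
      rewrite {1}[u]sd_decomp -mulgA -sd_rotD [u.2 + i]addrC.
      by rewrite mulg1 sd_rot_inj -iter_Fp // addrN.
    rewrite uE (gactM aYG) //; congr (aY _ _).
    have -> : translate (sd_rot (i + u.2))^-1%g (translate u t) =
              translate h (translate (sd_rot i)^-1%g t).
      rewrite -!translateM; congr (translate _ t).
      apply: (mulgI (sd_rot (i + u.2))); rewrite mulVKg mulgA -uE -mulgA mulgV mulg1.
      by [].
    by rewrite g1U ?base_inj.
move=> t q st; have [Lft Eft] := Lf t.
rewrite {1}[q]sum_single.
apply: (usub_trans E2U (w := \sum_i f t (single i (q i)))).
  exact: (gen_base (U := whole G) (a := aY) (S := S) (homP_sum LE _ _ _ (Lf t))).
rewrite delta_app /g.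
pose ph (F : 'F_p -> Y) := \sum_i F i.
have phB F F' : ph (F - F') = ph F - ph F' by rewrite /ph -sumrB.
pose gi t i := aY (sd_rot i) (g1 (translate (sd_rot i)^-1%g t) (q i)).
rewrite (delta_map (V := 'F_p -> Y) (phi := ph) gi t phB) /ph -sumrB.
apply: (usub_sum E2U) => i _; rewrite delta_app /gi.
rewrite (delta_map (phi := aY (sd_rot i)) (fun t => g1 (translate (sd_rot i)^-1%g t) (q i))); last first.
  by move=> v w; rewrite (gactB aYG).
rewrite -(delta_translate (fun t => g1 t (q i))) -delta_app.
have -> : f t (single i (q i)) = aY (sd_rot i) (f (translate (sd_rot i)^-1%g t) (single 0 (q i))).
  by rewrite fU // /fact invgK act_single add0r (gactKV aYG).
rewrite -(gactB aYG) //; apply: (usubA E2U) => //; apply: E12; apply: fg1.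
by rewrite size_translate.
Qed.

End Periodicity.

Section Periodicity2.
Variables (p : nat) (H : groupType).
Hypothesis pr_p : prime p.
Variable sigma : H -> H.
Hypotheses (sigmaM : {morph sigma : x y / (x * y)%g}) (sigmap : forall x, iter p sigma x = x).
Local Notation G := (semidirect pr_p sigmaM sigmap).
Local Notation Q := {ffun 'F_p -> ('F_p)^o}.
Local Notation aQ := (@actQ p H pr_p sigma sigmaM sigmap).

Definition sumQ (q : Q) : ('F_p)^o := \sum_i q i.
Fact sumQ_linear : linear sumQ.
Proof.
move=> a q q'; rewrite /sumQ scaler_sumr -big_split; apply: eq_bigr => i _ /=.
by rewrite !ffunE.
Qed.
HB.instance Definition _ := GRing.isLinear.Build _ _ _ _ sumQ sumQ_linear.

Lemma sumQ_act (g : G) q : sumQ (aQ g q) = sumQ q.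
Proof.
rewrite /sumQ [RHS](reindex_inj (addIr (- g.2))) /=.
by apply: eq_bigr => i _; rewrite ffunE.
Qed.

Definition diffQ (q : Q) : Q := [ffun i => q i - q (i - 1)].

Fact diffQ_linear : linear diffQ.
Proof.
move=> a q q'; apply/ffunP => i; rewrite !ffunE scalerBr opprD.
by rewrite addrACA.
Qed.
HB.instance Definition _ := GRing.isLinear.Build _ _ _ _ diffQ diffQ_linear.

Lemma sumQ_diff q : sumQ (diffQ q) = 0.
Proof.
rewrite /sumQ; under eq_bigr do rewrite ffunE.
by rewrite sumrB [X in _ - X](reindex_inj (addIr 1)) /=;
   under [X in _ - X]eq_bigr do rewrite addrK; rewrite subrr.
Qed.

Definition actW (g : G) (w : kernel sumQ) : kernel sumQ := insubd w (aQ g (val w)).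

Lemma val_actW g w : val (actW g w) = aQ g (val w).
Proof.
have mem : aQ g (val w) \in in_kernel sumQ.
  have e : sumQ (val w) = 0 by apply/kernelP; exists w.
  by apply/eqP; exact: (etrans (sumQ_act _ _) e).
by rewrite insubdK.
Qed.

Lemma gact_actW (U : groupClosed G) : gact U actW.
Proof.
have [aD a1 aM] := gact_actQ U.
split=> [u v w Uu|v|u u' v Uu Uu']; apply/val_inj; rewrite !val_actW /=.
- by rewrite aD // !val_actW.
- by rewrite a1.
- by rewrite aM // !val_actW.
Qed.

Lemma gact_triv (U : groupClosed G) : gact U (@triv G p).
Proof. by []. Qed.

Lemma killed_Q : killed p Q.
Proof.
move=> q; apply/ffunP => i; rewrite ffunMnE ffunE.
by rewrite -mulr_natr pchar_Fp_0 // mulr0.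
Qed.

Lemma shortexact_sumQ (U : groupClosed G) :
  shortexact U actW aQ (@triv G p) (val : kernel sumQ -> Q) sumQ.
Proof.
split.
- by split; [exact: gact_actW | exact: gact_actQ | exact: gact_triv].
- by split; [|move=> u z _; exact: val_actW | exact: val_inj].
- split=> [c c'|u c _|b]; [exact: linearB | exact: sumQ_act |].
  exists (single 0 b); rewrite /sumQ (bigD1 0) //= ffunE eqxx big1 ?addr0 // => i i0.
  by rewrite ffunE (negPf i0).
- by move=> c; exact: (kernelP (sumQ : {linear Q -> ('F_p)^o}) c).
Qed.

Definition constQ (m : 'F_p) : Q := [ffun=> m].

Lemma diffQ_const q : diffQ q = 0 -> q = constQ (q 0).
Proof.
move=> /ffunP dq; apply/ffunP => i; rewrite [RHS]ffunE.
have st (j : 'F_p) : q j = q (j - 1).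
  by have := dq j; rewrite !ffunE => /eqP; rewrite subr_eq0 => /eqP.
rewrite -[i]natr_Zp; elim: (i : nat) => [//|n IH].
by rewrite [LHS]st mulrSr addrK.
Qed.

Lemma diffQ_surj q : sumQ q = 0 -> exists q', diffQ q' = q.
Proof.
move=> sq; exists [ffun i : 'F_p => \sum_(j : 'F_p | (j <= i)%N) q j].
apply/ffunP => i; rewrite !ffunE; have [->|i0] := eqVneq i 0.
  have -> : \sum_(j : 'F_p | (j <= (0 - 1 : 'F_p)%R)%N) q j = 0.
    rewrite -[RHS]sq /sumQ; apply: eq_bigl => j.
    rewrite sub0r -ltnS (leq_trans (ltn_ord j)) // /=.
    have h n : (1 < n.+2)%N by []. rewrite (modn_small (m := 1)) ?h //.
    by rewrite subn1 /= modn_small.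
  rewrite subr0 (bigD1 (0 : 'F_p)) //= big1 ?addr0 // => j /andP[]; rewrite leqn0 => j0.
  by rewrite -(inj_eq val_inj) /= j0.
have i1 : ((i - 1 : 'F_p)%R).+1 = i :> nat.
  have i_gt0 : (0 < i)%N by rewrite lt0n; apply: contra i0 => i0; apply/eqP/val_inj/eqP.
  have : i = (i.-1)%:R + 1 :> 'F_p by rewrite natr1 prednK // natr_Zp.
  move=> iE; rewrite {1}iE addrK val_Fp_nat // modn_small ?prednK //.
  by apply: leq_trans (ltnW (ltn_ord i)) _; rewrite Fp_cast.
rewrite (bigD1 i) //= -addrA -[RHS]addr0; congr (_ + _).
apply/eqP; rewrite subr_eq0; apply/eqP; apply: eq_bigl => j.
by rewrite -[RHS]ltnS i1 [RHS]ltn_neqAle [RHS]andbC.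
Qed.

Let diffW (q : Q) : kernel sumQ := corestr sumQ_diff q.

Lemma shortexact_diffQ (U : groupClosed G) :
  shortexact U (@triv G p) aQ actW constQ diffW.
Proof.
split.
- by split; [exact: gact_triv | exact: gact_actQ | exact: gact_actW].
- split=> [z z'|u z _|z z' /ffunP/(_ 0)]; last by rewrite !ffunE.
    by apply/ffunP => i; rewrite !ffunE.
  by apply/ffunP => i; rewrite !ffunE.
- split=> [c c'|u c _|b].
  + by apply/val_inj; rewrite /diffW linearB.
  + apply/val_inj; rewrite val_actW /=; apply/ffunP => i; rewrite !ffunE.
    by rewrite addrAC.
  + have [|q qb] := diffQ_surj (q := val b); first by apply/kernelP; exists b.
    by exists q; apply/val_inj.
- move=> c; split=> [/(congr1 val) /= dc|[z <-]].
    by exists (c 0); rewrite -diffQ_const.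
  by apply/val_inj/ffunP => i; rewrite /= !ffunE subrr.
Qed.

(** The trivial module is its own second syzygy relative to [Q]: sums of coordinates map
    [Q] onto it, and successive differences map [Q] onto the kernel, with the constants
    as kernel. So two steps of [Ext_quot] lower the degree by two. *)
Lemma Ext_whole n : (forall k, Ext p true (base pr_p sigmaM sigmap) (@triv G p) k) ->
  Ext p true (whole G) (@triv G p) n.
Proof.
move=> ext; have extQ k : Ext p true (whole G) aQ k by exact: Ext_induced.
have [r rB rK] := retraction pr_p killed_Q (i := val : kernel sumQ -> Q) (fun z z' => erefl) val_inj.
have [[_ _ _] [constB _ constI] _ _] := shortexact_diffQ (whole G).
have [r' r'B r'K] := retraction pr_p killed_Q constB constI.
elim/ltn_ind: n => n IH.
apply: (Ext_quot (shortexact_sumQ (whole G)) rB rK) => //.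
apply: (Ext_quot (shortexact_diffQ (whole G)) r'B r'K) => //.
by case: n IH => [|[|n]] IH; [exact: Ext0 | exact: Ext0 | exact: IH].
Qed.

End Periodicity2.

(** * Acyclic coefficients *)

Section Acyclic.
Variable G : groupType.

(** Vanishing of the cohomology of [U] in [L] modulo [E], in degree n - 1. *)
Definition acyclic (U : groupClosed G) (V : zmodType) (aV : G -> V -> V)
    (L E : V -> Prop) (n : nat) : Prop :=
  forall f, cochain U aV L f -> (forall t, size t = n.+1 -> E (delta f t)) ->
  exists2 g, cochain U aV L g & forall t, size t = n -> E (f t - delta g t).

(** The piece of the long exact sequence for [E] in [L'] in [L] which deduces vanishing
    for [L'] modulo [E]. *)
Lemma acyclic_sub (U : groupClosed G) (V : zmodType) (aV : G -> V -> V)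
    (L L' E : V -> Prop) n :
  gact U aV -> usub U aV L -> usub U aV L' -> usub U aV E ->
  (forall v, L' v -> L v) -> (forall v, E v -> L' v) ->
  acyclic U aV L E n.+1 -> acyclic U aV L L' n -> acyclic U aV L' E n.+1.
Proof.
move=> aG LU L'U EU L'L EL' acE acL f cf df.
have [g cg fg] := acE f (cochainW L'L cf) df; have [_ L'f _] := cf.
have [|e ce ge] := acL g cg.
  move=> t st; rewrite -[delta g t]opprK -[- delta g t](addKr (f t)).
  rewrite opprD opprK; apply: (usubB L'U) => //; apply: EL'; exact: fg.
have cw : cochain U aV L' (cutoff n (fun t => g t - delta e t)).
  apply: (cochain_cutoff aG L'U (L := L)) => //.
  by apply: cochainB => //; exact: cochain_delta.
exists (cutoff n (fun t => g t - delta e t)) => // t st.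
by rewrite delta_cutoff // deltaB delta_delta subr0; exact: fg.
Qed.

End Acyclic.

Lemma acyclic_of_Ext (G : groupType) p (U : groupClosed G) (Y : zmodType) (aY : G -> Y -> Y)
    (L E : Y -> Prop) n : prime p ->
  Ext p false U (@triv G p) n -> coeff U aY L E -> killed p Y -> acyclic U aY L E n.
Proof.
move=> pr_p ext LE kY f cf df; have [aYG LU EU EL] := LE; have [f0 Lf fU] := cf.
have [||S [nS _ [g cg fg]]] := ext Y aY L E LE kY (fun t (m : 'F_p) => f t *+ m).
- split=> [|t|u t Uu].
  + by apply/funext => m; rewrite f0 mul0rn.
  + split=> [m|m m']; first exact: (usubMn LU).
    by rewrite killed_FpD // addrAC addrK subrr; exact: usub0 EU.
  + by apply/funext => m; rewrite /fact fU // (gactMn aYG).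
- move=> t m st; rewrite delta_app (delta_map (phi := fun y => y *+ m)).
    by apply: (usubMn EU); exact: df.
  by move=> v w; rewrite mulrnBl.
case: S nS g cg fg => //= _ g [g0 Lg gU]; rewrite gen_nil // in Lg * => fg.
exists (fun t => g t 1).
  split=> [|t|u t Uu]; first by rewrite g0.
    by case: (Lg t).
  by rewrite gU.
move=> t st; have := fg t 1 st; rewrite delta_app.
by have -> : f t *+ (1 : 'F_p)%R = f t.
Qed.

Section Tensor.
Variables (p : nat) (H : groupType).
Hypothesis pr_p : prime p.
Variable sigma : H -> H.
Hypotheses (sigmaM : {morph sigma : x y / (x * y)%g}) (sigmap : forall x, iter p sigma x = x).
Local Notation G := (semidirect pr_p sigmaM sigmap).
Local Notation A := (group_algebra 'F_p H).
Local Notation rot := (sd_rot pr_p sigmaM sigmap).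
Local Notation base := (base pr_p sigmaM sigmap).

Lemma sd_shift (u : G) i : exists2 h : G, h \in base & (u * rot i)%g = (rot (i + u.2) * h)%g.
Proof.
exists (sd_inj pr_p sigmaM sigmap (iter (- (i + u.2))%R sigma u.1)); first exact: base_inj.
rewrite {1}[u]sd_decomp -mulgA -sd_rotD [u.2 + i]addrC.
by rewrite sd_rot_inj -iter_Fp // addrN.
Qed.

(** Relative projectivity: if the trace of [theta] from [base] to [G] is the identity,
    then averaging over [G] modulo [base] makes every class of [G] a corestriction from
    [base]. Modulo [E], [theta] has to be equivariant for [base] only. *)
Lemma transfer (V : zmodType) (aV : G -> V -> V) (L E : V -> Prop) (theta : V -> V) n :
  coeff (whole G) aV L E ->
  (forall v w, theta (v - w) = theta v - theta w) ->
  (forall v, L v -> L (theta v)) -> (forall v, E v -> E (theta v)) ->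
  (forall u v, u \in base -> L v -> E (theta (aV u v) - aV u (theta v))) ->
  (forall v, L v -> E (v - \sum_i aV (rot i) (theta (aV (rot i)^-1%g v)))) ->
  acyclic base aV L E n -> acyclic (whole G) aV L E n.
Proof.
move=> LE thB thL thE thU thU' ac f cf df; have [aG LU EU EL] := LE.
have [f0 Lf fU] := cf; have wG (g : G) := in_whole g.
have th0 : theta 0 = 0 by rewrite -{1}(subrr 0) thB subrr.
have [||g [g0 Lg gU] fg] := ac f => //; first by split=> // u t _; exact: fU.
pose gt t := \sum_i aV (rot i) (theta (g (translate (rot i)^-1%g t))).
have gtL t : L (gt t) by apply: (usub_sum LU) => i _; apply: (usubA LU) => //; exact: thL.
exists (strict (whole G) aV gt); first by apply: cochain_strict.
have gt0 : gt [::] = 0.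
  by rewrite /gt big1 // => i _; rewrite /= g0 th0 (gact0 aG).
have gtU u t : u \in whole G -> E (gt (translate u t) - aV u (gt t)).
  move=> _; rewrite /gt (gact_sum aG) // (reindex_inj (addIr u.2)) /= -sumrB.
  apply: (usub_sum EU) => i _; have [h bh uE] := sd_shift u i.
  rewrite -(gactM aG) // uE (gactM aG) // -(gactB aG) //; apply: (usubA EU) => //.
  have -> : translate (rot (i + u.2))^-1%g (translate u t) =
            translate h (translate (rot i)^-1%g t).
    rewrite -!translateM; congr (translate _ t).
    apply: (mulgI (rot (i + u.2))); rewrite mulVKg mulgA -uE -mulgA mulgV mulg1.
    by [].
  by rewrite gU //; exact: thU.
move=> t st.
have Es s : E (gt s - strict (whole G) aV gt s) by exact: (strictP s EU gt0 gtU).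
apply: (usub_trans EU (w := delta gt t)); last first.
  by rewrite -deltaB; apply: (usub_delta EU) => s _; exact: Es.
apply: (usub_trans EU (thU' _ (Lf t))); rewrite /gt.
pose ph (F : 'F_p -> V) := \sum_i F i.
have phB F F' : ph (F - F') = ph F - ph F' by rewrite /ph -sumrB.
pose gi t i := aV (rot i) (theta (g (translate (rot i)^-1%g t))).
rewrite (delta_map (V := 'F_p -> V) (phi := ph) gi t phB) /ph -sumrB.
apply: (usub_sum EU) => i _; rewrite delta_app /gi.
have aB v w : aV (rot i) (theta (v - w)) = aV (rot i) (theta v) - aV (rot i) (theta w).
  by rewrite thB (gactB aG).
rewrite (delta_map (phi := fun v => aV (rot i) (theta v)) (fun t => g (translate (rot i)^-1%g t)) t aB).
rewrite -fU // -(delta_translate g) -aB.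
by apply: (usubA EU) => //; apply: thE; apply: fg; rewrite size_translate.
Qed.

End Tensor.

(** * Tensor induction: the intermediate layers *)

Lemma coeff_sub (G : groupType) (U U' : groupClosed G) (Y : zmodType) (a : G -> Y -> Y)
    (L E : Y -> Prop) :
  {subset U <= U'} -> coeff U' a L E -> coeff U a L E.
Proof.
move=> UU' [aG LU EU EL]; split=> //; first exact: gact_sub UU' aG.
  by case: LU => L0 LB LA; split=> // u v /UU'; exact: LA.
by case: EU => E0 EB EA; split=> // u v /UU'; exact: EA.
Qed.

Lemma funMnE (T : Type) (Y : zmodType) (f : T -> Y) n x : (f *+ n) x = f x *+ n.
Proof. by elim: n => [|n IH]; rewrite ?mulr0n // !mulrS -IH. Qed.

Lemma killed_fun p (T : Type) (Y : zmodType) : killed p Y -> killed p (T -> Y).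
Proof. by move=> kY f; apply/funext => x; rewrite funMnE kY. Qed.

Section TensorInduction.
Variables (p : nat) (H : groupType).
Hypothesis pr_p : prime p.
Variable sigma : H -> H.
Hypotheses (sigmaM : {morph sigma : x y / (x * y)%g}) (sigmap : forall x, iter p sigma x = x).
Local Notation G := (semidirect pr_p sigmaM sigmap).
Local Notation A := (group_algebra 'F_p H).
Local Notation rot := (sd_rot pr_p sigmaM sigmap).
Local Notation base := (base pr_p sigmaM sigmap).

Lemma sdM1 (g h : G) : (g * h)%g.1 = (g.1 * iter g.2 sigma h.1)%g. Proof. by []. Qed.
Lemma sdM2 (g h : G) : (g * h)%g.2 = g.2 + h.2. Proof. by []. Qed.
Lemma sdV2 (g : G) : (g^-1)%g.2 = - g.2. Proof. by []. Qed.

Definition upd (M : Type) (c : 'F_p -> M) (j : 'F_p) (a : M) : 'F_p -> M :=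
  fun i => if i == j then a else c i.

Lemma upd_id (M : Type) (c : 'F_p -> M) j : upd c j (c j) = c.
Proof. by apply/funext => i; rewrite /upd; case: eqP => [->|]. Qed.

(** Homomorphisms from the p-th tensor power of [M] to [L], without constructing the
    tensor power. *)
Definition multi (M W : zmodType) (L : W -> Prop) (f : ('F_p -> M) -> W) : Prop :=
  (forall c, L (f c)) /\
  (forall c j a b, f (upd c j (a - b)) = f (upd c j a) - f (upd c j b)).

Section Multi.
Variables (M W : zmodType) (L : W -> Prop) (f : ('F_p -> M) -> W).
Hypothesis mf : multi L f.

Lemma multi_coord0 c j : c j = 0 -> f c = 0.
Proof.
move=> cj; have e : upd c j 0 = c by rewrite -cj upd_id.
by case: mf => _ /(_ c j 0 0); rewrite (subr0 (0 : M)) e subrr.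
Qed.

Lemma multiD c j a b : f (upd c j (a + b)) = f (upd c j a) + f (upd c j b).
Proof.
have fN x : f (upd c j (- x)) = - f (upd c j x).
  have [_ mB] := mf; rewrite -sub0r mB (multi_coord0 (j := j)) ?sub0r //.
  by rewrite /upd eqxx.
by have [_ mB] := mf; rewrite -{1}[b]opprK mB fN opprK.
Qed.
End Multi.

(** The tensor-induced module: an element of the semidirect product acts on the factor
    of index [i] through the corresponding twist by [sigma], and its second component
    shifts the factors. *)
Definition actT (M : lmodType A) (g : G) (c : 'F_p -> M) : 'F_p -> M :=
  fun i => gunit p (iter (- i)%R sigma g.1) *: c (i - g.2).

Lemma actT1 (M : lmodType A) (c : 'F_p -> M) : actT 1%g c = c.
Proof. by apply/funext => i; rewrite /actT iter_sigma1 // scale1r subr0. Qed.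

Lemma actTM (M : lmodType A) (g h : G) (c : 'F_p -> M) : actT (g * h)%g c = actT g (actT h c).
Proof.
apply/funext => i; rewrite /actT sdM1 sdM2 iter_sigmaM // gunitM scalerA opprD addrA.
suff -> : iter (- i)%R sigma (iter g.2 sigma h.1) = iter (- (i - g.2))%R sigma h.1 by [].
by rewrite -iter_Fp // opprB addrC.
Qed.

Lemma actTVK (M : lmodType A) (g : G) (c : 'F_p -> M) : actT g^-1%g (actT g c) = c.
Proof. by rewrite -actTM mulVg actT1. Qed.

Lemma actTKV (M : lmodType A) (g : G) (c : 'F_p -> M) : actT g (actT g^-1%g c) = c.
Proof. by rewrite -actTM mulgV actT1. Qed.

Lemma actT_upd (M : lmodType A) (g : G) (c : 'F_p -> M) j a :
  actT g (upd c j a) =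
  upd (actT g c) (j + g.2) (gunit p (iter (- (j + g.2))%R sigma g.1) *: a).
Proof.
apply/funext => i; rewrite /actT /upd subr_eq; case: eqP => // ->.
by [].
Qed.

Lemma gact_actT (M : lmodType A) (W : zmodType) (aW : G -> W -> W) U :
  gact U aW -> gact U (fact (@actT M) aW).
Proof. by apply: gact_fact => [m|u u' m _ _]; [exact: actT1 | exact: actTM]. Qed.

Section Coefficients.
Variables (W : zmodType) (aW : G -> W -> W) (L : W -> Prop).
Hypotheses (aWG : gact (whole G) aW) (LU : usub (whole G) aW L).
Let wG (g : G) : g \in whole G. Proof. exact: in_whole. Qed.

Lemma multi_usub (M : lmodType A) : usub (whole G) (fact (@actT M) aW) (multi L).
Proof.
split.
- by split=> [c|c j a b]; [exact: usub0 LU | rewrite subr0].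
- move=> v w [Lv mv] [Lw mw]; split=> [c|c j a b]; first exact: (usubB LU).
  rewrite -[LHS]/(v _ - w _) mv mw -[RHS]/((v _ - w _) - (v _ - w _)).
  by rewrite !opprD !opprK addrACA.
- move=> u v _ [Lv mv]; split=> [c|c j a b]; first exact: (usubA LU).
  by rewrite /fact !actT_upd scalerBr mv (gactB aWG).
Qed.

Section Layers.
Variables (C B : lmodType A) (q : {linear C -> B}) (r : C -> kernel q).
Hypotheses (rB : forall c c', r (c - c') = r c - r c') (rK : forall z, r (val z) = z).

Definition zeros (c : 'F_p -> C) : {set 'F_p} := [set i | q (c i) == 0].

Lemma zeros_act (g : G) c i : (i \in zeros (actT g c)) = (i - g.2 \in zeros c).
Proof.
rewrite !inE /actT linearZ /=; apply/eqP/eqP => [|->]; last by rewrite scaler0.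
move=> e; rewrite -[LHS]scale1r -gunit1.
set h := iter _ _ _ in e.
by rewrite -(mulVg h) gunitM -scalerA e scaler0.
Qed.

Lemma card_zeros_act (g : G) c : #|zeros (actT g c)| = #|zeros c|.
Proof.
rewrite -[RHS](card_imset _ (addIr g.2)); congr #|pred_of_set _|; apply/setP => i.
rewrite zeros_act; apply/idP/imsetP => [zi|[k zk ->]]; last by rewrite addrK.
by exists (i - g.2); rewrite ?subrK.
Qed.

(** For an extension of [B] by the kernel Z of [q], the filtration of the tensor power
    of [C] by the number of factors in Z, seen on multilinear maps. Layer 0 consists of
    the maps which factor through [B]. *)
Definition layer k (f : ('F_p -> C) -> W) : Prop :=
  multi L f /\ forall c, (k < #|zeros c|)%N -> f c = 0.

Lemma layer_usub k : usub (whole G) (fact (@actT C) aW) (layer k).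
Proof.
have [m0 mB mA] := multi_usub C; split.
- by split.
- move=> v w [mv v0] [mw w0]; split; first exact: mB.
  by move=> c ck; rewrite -[LHS]/(v c - w c) v0 // w0 // subr0.
- move=> u v wu [mv v0]; split; first exact: mA.
  by move=> c ck; rewrite /fact v0 ?card_zeros_act // (gact0 aWG).
Qed.

Lemma layerS k f : layer k f -> layer k.+1 f.
Proof. by move=> [mf f0]; split=> // c /ltnW; exact: f0. Qed.

Lemma layer_top f : layer p f <-> multi L f.
Proof.
split=> [[]//|mf]; split=> // c; rewrite ltnNge.
have -> : (#|zeros c| <= p)%N; last by [].
by apply: leq_trans (max_card _) _; rewrite card_Fp.
Qed.

Let rD c c' : r (c + c') = r c + r c'.
Proof.
have r0 : r 0 = 0 by rewrite -(subrr 0) rB subrr.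
by rewrite -{1}[c']opprK rB -[- c']sub0r rB r0 sub0r opprK.
Qed.

(** The retraction decomposes [C] as a sum of Z and a complement; this is the component
    of a pure tensor with factors in Z exactly at [I]. *)
Definition split_at (I : {set 'F_p}) (c : 'F_p -> C) : 'F_p -> C :=
  fun i => if i \in I then val (r (c i)) else c i - val (r (c i)).

Lemma split_upd I c j a : split_at I (upd c j a) =
  upd (split_at I c) j (if j \in I then val (r a) else a - val (r a)).
Proof.
by apply/funext => i; rewrite /split_at /upd; case: eqP => [->|].
Qed.

Lemma multi_split I f : multi L f -> multi L (fun c => f (split_at I c)).
Proof.
move=> [Lf mf]; split=> // c j a b; rewrite !split_upd -mf; congr (f (upd _ _ _)).
have -> : val (r (a - b)) = val (r a) - val (r b) by rewrite rB.
by case: ifP => _ //; rewrite !opprD !opprK addrACA.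
Qed.

Lemma val_r c : q c = 0 -> val (r c) = c.
Proof. by move/kernelP => [z <-]; rewrite rK. Qed.

Lemma q_val (z : kernel q) : q (val z) = 0.
Proof. by apply/kernelP; exists z. Qed.

Lemma split_vanish (I : {set 'F_p}) f c : multi L f -> ~~ (zeros c \subset I) -> f (split_at I c) = 0.
Proof.
move=> mf /subsetPn[i]; rewrite inE => /eqP qi iI.
by apply: (multi_coord0 mf (j := i)); rewrite /split_at (negPf iI) val_r // subrr.
Qed.

(** On a map of layer k, replacing by their complement component the factors outside a
    set of k factors already in Z changes nothing, since the difference has one more
    factor in Z. *)
Lemma split_zeros k f c : layer k f -> #|zeros c| = k -> f (split_at (zeros c) c) = f c.
Proof.
move=> [mf f0] zk; pose d (s : seq 'F_p) i := if i \in s then split_at (zeros c) c i else c i.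
have qd s i : (q (d s i) == 0) = (q (c i) == 0).
  rewrite /d; case: ifP => // _; rewrite /split_at; case: ifP => [|_].
    by rewrite inE => /eqP qi; rewrite q_val qi eqxx.
  by rewrite linearB q_val subr0.
have -> : split_at (zeros c) c = d (enum 'F_p).
  by apply/funext => i; rewrite /d mem_enum.
elim: (enum _) => [|j s IH]; first by congr f; apply/funext.
have [js|js] := boolP (j \in s).
  rewrite -IH; congr f; apply/funext => i; rewrite /d inE.
  by case: eqP => [->|//]; rewrite js.
have -> : d (j :: s) = upd (d s) j (split_at (zeros c) c j).
  by apply/funext => i; rewrite /d inE /upd; case: eqP => [->|//].
rewrite -IH -[in RHS](upd_id (d s) j).
have -> : d s j = c j by rewrite /d (negPf js).
rewrite /split_at; case: ifP => [|/negbT zj].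
  by rewrite inE => /eqP qj; rewrite val_r.
have [_ mB] := mf; rewrite mB [X in _ - X]f0 ?subr0 // -zk.
have -> : zeros (upd (d s) j (val (r (c j)))) = j |: zeros c.
  apply/setP => i; rewrite !inE /upd; case: (i =P j) => [->|_]; last exact: qd.
  by rewrite q_val eqxx.
by rewrite cardsU1 zj.
Qed.

(** A set of k indices is balanced when its sum vanishes in F_p. Shifting it by [i] adds
    k [i] to the sum, so for 0 < k < p each orbit of shifts contains exactly one
    balanced set. *)
Definition balanced (I : {set 'F_p}) : bool := \sum_(i in I) i == 0.

(** Projection onto the summands indexed by balanced sets of [k] indices. *)
Definition balanced_part k (f : ('F_p -> C) -> W) : ('F_p -> C) -> W :=
  fun c => \sum_(I : {set 'F_p} | (#|I| == k) && balanced I) f (split_at I c).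

Lemma balanced_partB k f g : balanced_part k (f - g) = balanced_part k f - balanced_part k g.
Proof.
apply/funext => c; rewrite /balanced_part -[RHS]/(\sum_(_ | _) _ - \sum_(_ | _) _).
by rewrite -sumrB.
Qed.

Lemma multi_balanced_part k f : multi L f -> multi L (balanced_part k f).
Proof.
move=> mf; split=> [c|c j a b].
  by apply: (usub_sum LU) => I _; case: (multi_split I mf).
rewrite /balanced_part -sumrB; apply: eq_bigr => I _.
by have [_ mI] := multi_split I mf; exact: mI.
Qed.

Lemma layer_balanced_part k f : layer k f -> layer k (balanced_part k f).
Proof.
move=> [mf f0]; split; first exact: multi_balanced_part.
move=> c ck; rewrite /balanced_part big1 // => I /andP[/eqP Ik _]; apply: split_vanish => //.
by apply: contraL ck => /subset_leq_card; rewrite Ik -leqNgt.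
Qed.

Lemma balanced_part_low k f : layer k f -> balanced_part k.+1 f = 0.
Proof.
move=> [mf f0]; apply/funext => c; rewrite /balanced_part big1 // => I /andP[/eqP Ik _].
have sub : {subset (I : {set 'F_p}) <= zeros (split_at I c)}.
  by move=> i iI; rewrite inE /split_at iI q_val.
by apply: f0; rewrite -Ik; apply/subset_leq_card/fintype.subsetP.
Qed.

Lemma balanced_part_exact k f c : layer k f -> #|zeros c| = k ->
  balanced_part k f c = f c *+ balanced (zeros c).
Proof.
move=> lf zk; rewrite /balanced_part (bigID (pred1 (zeros c))) /= [X in _ + X]big1 ?addr0.
  rewrite (eq_bigl (fun I => (I == zeros c) && balanced (zeros c))); last first.
    by move=> I; case: (I =P zeros c) => [->|_]; rewrite ?andbF // zk eqxx andbT.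
  rewrite big_mkcondr /= big_pred1_eq (split_zeros lf zk).
  by case: balanced.
move=> I /andP[/andP[/eqP Ik _] zI]; case: lf => mf _; apply: split_vanish => //.
by apply: contra zI => sub; rewrite eq_sym eqEcard sub Ik zk leqnn.
Qed.

Lemma balanced_unique k (Z : {set 'F_p}) : (0 < k < p)%N -> #|Z| = k ->
  \sum_(i : 'F_p) (\sum_(j in Z) j - k%:R * i == 0 : nat) = 1%N.
Proof.
move=> /andP[k0 kp] Zk; set s := \sum_(j in Z) j.
have kN0 : k%:R != 0 :> 'F_p.
  by rewrite -(inj_eq val_inj) /= val_Fp_nat // modn_small // -lt0n.
rewrite (bigD1 (s / k%:R)) //= mulrC divfK // subrr eqxx big1 // => i ik.
apply/eqP; rewrite eqb0; apply: contra ik; rewrite subr_eq0 => /eqP ->.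
by rewrite mulrC mulKf.
Qed.

(** The quotient of layer k + 1 by layer k is the sum, over the sets of k + 1 indices,
    of a module on which the shifts permute the summands freely. The projection onto
    balanced sets therefore has trace 1, and acyclicity comes from [base], where it is a
    hypothesis on the trivial module. *)
Lemma acyclic_layer k n : (k.+1 < p)%N -> killed p W ->
  Ext p false base (@triv G p) n ->
  acyclic (whole G) (fact (@actT C) aW) (layer k.+1) (layer k) n.
Proof.
move=> kp kW ext; have fG := gact_actT C aWG.
have cf : coeff (whole G) (fact (@actT C) aW) (layer k.+1) (layer k).
  by split=> //; [exact: layer_usub | exact: layer_usub | exact: layerS].
apply: (transfer (theta := balanced_part k.+1)) => //.
- exact: balanced_partB.
- exact: layer_balanced_part.
- by move=> v /balanced_part_low ->; exact: usub0 (layer_usub _).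
- move=> u v bu lv; have lw := usubA (layer_usub _) (in_whole u) lv.
  split.
    apply: (usubB (multi_usub C)); first by apply: multi_balanced_part; case: lw.
    by apply: (usubA (multi_usub C)) => //; apply: multi_balanced_part; case: lv.
  move=> c; rewrite leq_eqVlt => /orP[/eqP ck|ck].
    rewrite -[LHS]/(balanced_part _ _ c - aW u (balanced_part k.+1 v (actT u^-1%g c))).
    rewrite !balanced_part_exact ?card_zeros_act // -[zeros (actT u^-1%g c)](_ : zeros c = _).
      by rewrite (gactMn aWG) // subrr.
    apply/setP => i; rewrite zeros_act sdV2 opprK.
    by have /baseP -> := bu; rewrite addr0.
  have [_ l1] := layer_balanced_part lw.
  have [_ l2] := usubA (layer_usub _) (in_whole u) (layer_balanced_part lv).
  by rewrite -[LHS]/(balanced_part _ _ c - fact (@actT C) aW u (balanced_part k.+1 v) c) l1 // l2 // subr0.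
- move=> v lv.
  have lt i : layer k.+1 (fact (@actT C) aW (rot i) (balanced_part k.+1 (fact (@actT C) aW (rot i)^-1%g v))).
    by apply: (usubA (layer_usub _)) => //; apply: layer_balanced_part; apply: (usubA (layer_usub _)).
  have [ls1 ls2] : layer k.+1 (v - \sum_i
      fact (@actT C) aW (rot i) (balanced_part k.+1 (fact (@actT C) aW (rot i)^-1%g v))).
    by apply: (usubB (layer_usub _)) => //; apply: (usub_sum (layer_usub _)) => i _.
  split=> //.
  move=> c; rewrite leq_eqVlt => /orP[/eqP ck|ck]; last exact: ls2.
  rewrite -[LHS]/(v c - (\sum_i
    fact (@actT C) aW (rot i) (balanced_part k.+1 (fact (@actT C) aW (rot i)^-1%g v))) c).
  have sumE (F : 'F_p -> ('F_p -> C) -> W) : (\sum_i F i) c = \sum_i F i c.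
    by apply: (big_morph (fun F : ('F_p -> C) -> W => F c)).
  rewrite sumE; apply/eqP; rewrite subr_eq0; apply/eqP.
  transitivity (\sum_i v c *+ (\sum_(j in zeros c) j - k.+1%:R * i == 0 : nat)).
    by rewrite sumrMnr balanced_unique // mulr1n.
  apply: eq_bigr => i _; rewrite {1}/fact balanced_part_exact; last by rewrite card_zeros_act.
    rewrite (gactMn aWG) // {1}/fact invgK actTKV (gactKV aWG) //; congr (_ *+ nat_of_bool (_ == 0)).
    rewrite [in LHS]ck -sum1_card natr_sum mulr_suml -sumrB.
    rewrite [LHS](reindex_inj (addIr i)) /=; apply: eq_big => [j|j _].
      by rewrite zeros_act sdV2 opprK.
    by rewrite mul1r addrK.
  by apply: (usubA (layer_usub _)).
apply: (acyclic_of_Ext pr_p ext); first by apply: coeff_sub cf.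
exact: killed_fun.
Qed.

End Layers.
End Coefficients.
End TensorInduction.

(** * Tensor induction: dimension shifting *)

Section TensorStep.
Variables (p : nat) (H : groupType).
Hypothesis pr_p : prime p.
Variable sigma : H -> H.
Hypotheses (sigmaM : {morph sigma : x y / (x * y)%g}) (sigmap : forall x, iter p sigma x = x).
Local Notation G := (semidirect pr_p sigmaM sigmap).
Local Notation A := (group_algebra 'F_p H).
Local Notation base := (base pr_p sigmaM sigmap).
Local Notation actT := (@actT p H pr_p sigma sigmaM sigmap).

(** The restriction of the module to every subgroup of order p which meets [base]
    trivially is relatively projective, hence cohomologically trivial. *)
Definition has_traces (W : zmodType) (aW : G -> W -> W) (L : W -> Prop) : Prop :=
  forall y : G, y.2 != 0 -> (y ^+ p)%g = 1%g ->
  exists theta : W -> W,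
    [/\ forall v w, theta (v - w) = theta v - theta w,
        forall v, L v -> L (theta v)
      & forall v, L v -> v = \sum_(i : 'F_p) aW (y ^+ i)%g (theta (aW (y ^- i)%g v))].

(** Vanishing of the cohomology of [G] with coefficients in the multilinear maps from
    the tensor-induced module to any module with traces. *)
Definition tensor_acyclic (M : lmodType A) (n : nat) : Prop :=
  forall (W : zmodType) (aW : G -> W -> W) (L : W -> Prop),
    gact (whole G) aW -> killed p W -> usub (whole G) aW L -> has_traces aW L ->
    acyclic (whole G) (fact (@actT M) aW) (multi L) (fun f => f = 0) n.

Section Step.
Variables (C B : lmodType A) (q : {linear C -> B}).
Hypothesis sq : surjective q.
Variables (W : zmodType) (aW : G -> W -> W) (L : W -> Prop).
Hypotheses (aWG : gact (whole G) aW) (LU : usub (whole G) aW L).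
Let wG (g : G) : g \in whole G. Proof. exact: in_whole. Qed.

(** The quotient of layer p by layer p - 1 consists of the multilinear maps on the
    kernel of [q]. *)
Lemma acyclic_top n :
  acyclic (whole G) (fact (@actT (kernel q)) aW) (multi L) (fun f => f = 0) n ->
  acyclic (whole G) (fact (@actT C) aW) (layer L q p) (layer L q p.-1) n.
Proof.
move=> ac f cf df; have [f0 Lf fU] := cf.
have [r rB rK] := kernel_retraction pr_p q.
have lU k := layer_usub aWG LU q k.
pose v (z : 'F_p -> kernel q) : 'F_p -> C := fun i => val (z i).
have vact g z : v (actT g z) = actT g (v z) by [].
have zv z : zeros q (v z) = finset.setT.
  by apply/setP => i; rewrite !inE; apply/eqP; apply/kernelP; exists (z i).
have vE c : (p.-1 < #|zeros q c|)%N -> c = v (fun i => r (c i)).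
  rewrite prednK ?prime_gt0 // -{1}(card_Fp pr_p) -cardsT => le.
  have /eqP/setP zT : zeros q c == finset.setT by rewrite eqEcard finset.subsetT.
  apply/funext => i; have := zT i; rewrite !inE => /eqP qi.
  by rewrite /v val_r.
have mv F : multi L F -> multi L (fun z => F (v z)).
  move=> [LF mF]; split=> // c j a b.
  have vu x : v (upd c j x) = upd (v c) j (val x).
    by apply/funext => i; rewrite /v /upd; case: eqP.
  by rewrite !vu -mF.
have mr F : multi L F -> multi L (fun c : 'F_p -> C => F (fun i => r (c i))).
  move=> [LF mF]; split=> // c j a b.
  have vu x : (fun i => r (upd c j x i)) = upd (fun i => r (c i)) j (r x).
    by apply/funext => i; rewrite /upd; case: eqP.
  by rewrite !vu rB -mF.
have mf t : multi L (f t) by case: (Lf t).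
have [||g [g0 Lg gU] fg] := ac (fun t z => f t (v z)).
- split=> [|t|u t Uu]; first by rewrite f0.
    exact: mv.
  by rewrite fU.
- move=> t st; apply/funext => z; rewrite delta_app.
  have [_ /(_ (v z))] := df t st; rewrite delta_app => -> //.
  by rewrite zv cardsT card_Fp // prednK // prime_gt0.
pose g' t (c : 'F_p -> C) := g t (fun i => r (c i)).
have g'L t : layer L q p (g' t) by apply/layer_top => //; exact: (mr _ (Lg t)).
have faG := gact_actT C aWG (U := whole G).
exists (strict (whole G) (fact (@actT C) aW) g'); first exact: cochain_strict.
have Es s : layer L q p.-1 (g' s - strict (whole G) (fact (@actT C) aW) g' s).
  apply: (strictP s (lU p.-1)) => [|u t _]; first by rewrite /g' g0.
  split.
    apply: (usubB (multi_usub aWG LU C)); first by case: (g'L (translate u t)).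
    by apply: (usubA (multi_usub aWG LU C)) => //; case: (g'L t).
  move=> c /vE ->; set z := fun i => _.
  rewrite -[LHS]/(g (translate u t) (fun i => r (val (z i))) - aW u (g t (fun i => r (actT u^-1%g (v z) i)))).
  have -> : (fun i => r (val (z i))) = z by apply/funext => i; rewrite rK.
  have -> : (fun i => r (actT u^-1%g (v z) i)) = actT u^-1%g z.
    by apply/funext => i; rewrite -vact rK.
  by rewrite gU // subrr.
move=> t st; apply: (usub_trans (lU p.-1) (w := delta g' t)); last first.
  by rewrite -deltaB; apply: (usub_delta (lU p.-1)) => s _; exact: Es.
split.
  apply: (usubB (multi_usub aWG LU C)) => //.
  by apply: (usub_delta (multi_usub aWG LU C)) => s _; case: (g'L s).
move=> c /vE ->; set z := fun i => _.
rewrite -[LHS]/(f t (v z) - delta g' t (v z)) delta_app.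
have -> : (fun s => g' s (v z)) = fun s => g s z.
  by apply/funext => s; rewrite /g' /v; congr (g s _); apply/funext => i; rewrite rK.
by have := congr1 (fun F => F z) (fg t st); rewrite /= -delta_app.
Qed.

Lemma layer0_eq f c c' : layer L q 0 f -> (forall i, q (c i) = q (c' i)) -> f c = f c'.
Proof.
move=> [mf f0] qcc; pose d (s : seq 'F_p) i := if i \in s then c i else c' i.
have -> : c = d (enum 'F_p) by apply/funext => i; rewrite /d mem_enum.
elim: (enum _) => [|j s IH]; first by congr f; apply/funext.
have [js|js] := boolP (j \in s).
  rewrite -IH; congr f; apply/funext => i; rewrite /d inE.
  by case: eqP => [->|//]; rewrite js.
have -> : d (j :: s) = upd (d s) j (c j).
  by apply/funext => i; rewrite /d inE /upd; case: eqP => [->|//].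
rewrite -IH -[in RHS](upd_id (d s) j).
have -> : d s j = c' j by rewrite /d (negPf js).
have [_ mB] := mf; apply/eqP; rewrite -subr_eq0 -mB; apply/eqP/f0.
rewrite card_gt0; apply/set0Pn; exists j.
by rewrite inE /upd eqxx linearB qcc subrr.
Qed.

Lemma acyclic_bottom n :
  acyclic (whole G) (fact (@actT C) aW) (layer L q 0) (fun f => f = 0) n ->
  acyclic (whole G) (fact (@actT B) aW) (multi L) (fun f => f = 0) n.
Proof.
move=> ac f [f0 Lf fU] df.
pose qq (c : 'F_p -> C) : 'F_p -> B := fun i => q (c i).
have qact g c : qq (actT g c) = actT g (qq c).
  by apply/funext => i; rewrite /qq linearZ.
have qupd c j a : qq (upd c j a) = upd (qq c) j (q a).
  by apply/funext => i; rewrite /qq /upd; case: eqP.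
have [||g [g0 Lg gU] fg] := ac (fun t c => f t (qq c)).
- split=> [|t|u t Uu]; first by rewrite f0.
    have [Lft mft] := Lf t; split; first by split=> // c j a b; rewrite !qupd linearB mft.
    move=> c; rewrite card_gt0 => /set0Pn[i]; rewrite inE => /eqP qi.
    exact: (multi_coord0 (Lf t) (j := i)).
  by rewrite fU // /fact; apply/funext => c; rewrite qact.
- move=> t st; apply/funext => c; rewrite delta_app.
  by have := congr1 (fun F => F (qq c)) (df t st); rewrite /= delta_app.
have [sec secK] := choice sq.
pose ss (b : 'F_p -> B) : 'F_p -> C := fun i => sec (b i).
exists (fun t b => g t (ss b)).
  split=> [|t|u t Uu]; first by rewrite g0.
    have [[Lgt mgt] _] := Lg t; split=> // b j x y.
    have -> : ss (upd b j x) = upd (ss b) j (sec x).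
      by apply/funext => i; rewrite /ss /upd; case: eqP.
    have -> : ss (upd b j y) = upd (ss b) j (sec y).
      by apply/funext => i; rewrite /ss /upd; case: eqP.
    rewrite -mgt; apply: layer0_eq => // i; rewrite /ss secK /upd.
    by case: eqP; rewrite ?secK // linearB !secK.
  rewrite gU // /fact; apply/funext => b; congr (aW u _); apply: layer0_eq => // i.
  by rewrite -[LHS]/(qq (actT u^-1%g (ss b)) i) qact /actT /qq /ss !secK.
move=> t st; apply/funext => b; rewrite -[LHS]/(f t b - _) delta_app -delta_app.
have := congr1 (fun F => F (ss b)) (fg t st).
rewrite -[_ (ss b)]/(f t (qq (ss b)) - delta g t (ss b)).
have -> : qq (ss b) = b by apply/funext => i; exact: secK.
by rewrite !delta_app.
Qed.

End Step.

(** Walk down the layers from all of the multilinear maps on [C] to those which factor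
    through [B]: each step costs one long exact sequence, whose third term is the top
    layer or an intermediate one. *)
Lemma tensor_acyclic_quot (C B : lmodType A) (q : {linear C -> B}) n :
  surjective q -> Ext p false base (@triv G p) n ->
  tensor_acyclic C n.+1 -> tensor_acyclic (kernel q) n -> tensor_acyclic B n.+1.
Proof.
move=> sq ext acC acZ W aW L aWG kW LU tr.
have faG := gact_actT C aWG (U := whole G).
have lU k := layer_usub aWG LU q k.
have E0 : usub (whole G) (fact (@actT C) aW) (fun f => f = 0) by exact: usub_eq0.
have [r rB rK] := kernel_retraction pr_p q.
apply: (acyclic_bottom sq).
have top : acyclic (whole G) (fact (@actT C) aW) (layer L q p) (fun f => f = 0) n.+1.
  have -> : layer L q p = multi L by apply/funext => f; apply/propext; exact: layer_top.
  exact: acC.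
have down k : acyclic (whole G) (fact (@actT C) aW) (layer L q k.+1) (fun f => f = 0) n.+1 ->
    acyclic (whole G) (fact (@actT C) aW) (layer L q k.+1) (layer L q k) n ->
    acyclic (whole G) (fact (@actT C) aW) (layer L q k) (fun f => f = 0) n.+1.
  apply: acyclic_sub => // [f|f ->]; first exact: layerS.
  exact: usub0 (lU k).
suff all k : (k <= p)%N ->
    acyclic (whole G) (fact (@actT C) aW) (layer L q (p - k)) (fun f => f = 0) n.+1.
  by have := all p (leqnn p); rewrite subnn.
elim: k => [_|k IH ltkp]; first by rewrite subn0.
apply: down; rewrite -subSn // subSS; first exact: IH (ltnW ltkp).
case: k IH ltkp => [|k] _ ltkp.
  by rewrite subn0 subn1; apply: acyclic_top => //; exact: acZ.
have -> : (p - k.+1 = (p - k.+2).+1)%N by rewrite -subSn.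
apply: (acyclic_layer aWG LU rB rK) => //.
by rewrite -subSn // subSS ltn_subrL /= prime_gt0.
Qed.

(** The tensor power of the trivial module is trivial: multiplication of coordinates
    embeds [W] into the multilinear maps, and evaluation at the family of ones splits
    it. *)
Lemma acyclic_of_trivial n (W : zmodType) (aW : G -> W -> W) (L : W -> Prop) :
  tensor_acyclic (trivial_module 'F_p H) n ->
  gact (whole G) aW -> killed p W -> usub (whole G) aW L -> has_traces aW L ->
  acyclic (whole G) aW L (fun w => w = 0) n.
Proof.
move=> ac aWG kW LU tr f [f0 Lf fU] df.
have act_triv g (c : 'F_p -> trivial_module 'F_p H) : actT g c = fun i => c (i - g.2).
  apply/funext => i; rewrite /actT -[LHS]/(augmentation (gunit p _) * (c (i - g.2) : 'F_p)).
  by rewrite augmentationU mul1r.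
pose pr (c : 'F_p -> trivial_module 'F_p H) : 'F_p := \prod_i (c i : 'F_p).
have pract g c : pr (actT g c) = pr c.
  rewrite /pr act_triv [RHS](reindex_inj (addIr (- g.2))) /=.
  by apply: eq_bigr.
have prupd c j a : pr (upd c j a) = (a : 'F_p) * \prod_(i | i != j) (c i : 'F_p).
  rewrite /pr (bigD1 j) //= /upd eqxx; congr (_ * _).
  by apply: eq_bigr => i /negPf ->.
have [||g [g0 Lg gU] fg] := ac W aW L aWG kW LU tr (fun t c => f t *+ pr c).
- split=> [|t|u t Uu].
  + by apply/funext => c; rewrite f0 mul0rn.
  + split=> [c|c j a b]; first exact: (usubMn LU).
    apply/eqP; rewrite !prupd eq_sym subr_eq -killed_FpD // -mulrDl.
    by rewrite -[X in _ == f t *+ nat_of_ord (X * _)%R]/((a : 'F_p) - (b : 'F_p) + (b : 'F_p)) subrK.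
  + by apply/funext => c; rewrite /fact fU // pract (gactMn aWG).
- move=> t st; apply/funext => c; rewrite delta_app (delta_map (phi := fun y => y *+ pr c)).
    by rewrite df // mul0rn.
  by move=> v w; rewrite mulrnBl.
pose ones : 'F_p -> trivial_module 'F_p H := fun _ => 1 : 'F_p.
exists (fun t => g t ones).
  split=> [|t|u t Uu]; first by rewrite g0.
    by case: (Lg t).
  by rewrite gU // /fact act_triv.
move=> t st; have := congr1 (fun F => F ones) (fg t st).
rewrite -[_ ones]/(f t *+ pr ones - delta g t ones) delta_app.
have -> : pr ones = 1 by rewrite /pr big1.
by [].
Qed.

End TensorStep.

(** * Tensor induction: projective modules *)

Section TensorProjective.
Variables (p : nat) (H : groupType).
Hypothesis pr_p : prime p.
Variable sigma : H -> H.
Hypotheses (sigmaM : {morph sigma : x y / (x * y)%g}) (sigmap : forall x, iter p sigma x = x).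
Local Notation G := (semidirect pr_p sigmaM sigmap).
Local Notation A := (group_algebra 'F_p H).
Local Notation actT := (@actT p H pr_p sigma sigmaM sigmap).
Local Notation T := {ffun 'F_p -> H}.

Lemma mcoeff_shift (k h : H) (a : A) : (gunit p k * a)@_(k * h)%g = a@_h.
Proof.
rewrite [in LHS](monalgE a) [in RHS](monalgE a) mulr_sumr !raddf_sum.
apply: eq_bigr => x _ /=; rewrite [gunit p k * _]galg_mulUU mul1r !mcoeffU.
by rewrite (inj_eq (mulgI k)).
Qed.

Section FiniteSums.
Variables (W : zmodType).

(** The sums over all indexing families have finite support depending on the argument,
    as elements of the group algebra have finite support. A sum with finite support over
    the whole type can be reindexed by the action of [G], which does not preserve any
    fixed finite set. *)
Definition sumT (F : T -> W) : W := \sum_(w \in [set: T]) F w.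

Lemma sumT_fin (D : {fset H}) (F : T -> W) :
  (forall w : T, (exists i, w i \notin D) -> F w = 0) ->
  sumT F = \sum_(w : {ffun 'F_p -> D}) F [ffun i => val (w i)].
Proof.
move=> F0; pose emb (w : {ffun 'F_p -> D}) : T := [ffun i => val (w i)].
have embI : injective emb.
  by move=> w w' /ffunP e; apply/ffunP => i; apply/val_inj; have := e i; rewrite !ffunE.
rewrite /sumT (fsbigE [seq emb w | w <- index_enum {ffun 'F_p -> D}]).
- by rewrite big_map; apply: eq_bigl => w; exact: mem_set.
- by rewrite (map_inj_uniq embI) index_enum_uniq.
- by [].
- move=> w _ wD; apply: F0; apply: contrapT => noi; case/negP: wD.
  have wi i : w i \in D by apply: contrapT => /negP wi; apply: noi; exists i.
  apply/mapP; exists [ffun i => [` wi i]%fset]; first exact: mem_index_enum.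
  by apply/ffunP => i; rewrite !ffunE.
Qed.

End FiniteSums.

Lemma multi_sum (M W : zmodType) (L : W -> Prop) (f : ('F_p -> M) -> W) (D : finType)
    (F : 'F_p -> D -> M) : multi L f ->
  f (fun i => \sum_x F i x) = \sum_(w : {ffun 'F_p -> D}) f (fun i => F i (w i)).
Proof.
move=> mf; have fsum c j (e : D -> M) : f (upd c j (\sum_x e x)) = \sum_x f (upd c j (e x)).
  apply: (big_morph (fun a => f (upd c j a))) => [a b|]; first exact: (multiD mf).
  by apply: (multi_coord0 mf (j := j)); rewrite /upd eqxx.
have expand (s : seq 'F_p) (v : {ffun 'F_p -> D}) : uniq s ->
    f (fun i => if i \in s then \sum_x F i x else F i (v i)) =
    \sum_(w : {ffun 'F_p -> D} | [forall i, (i \notin s) ==> (w i == v i)]) f (fun i => F i (w i)).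
  elim: s v => [|j s IH] v /=.
    move=> _; rewrite (big_pred1 v) // => w; apply/forallP/eqP => [e|-> i]; last exact: eqxx.
    by apply/ffunP => i; apply/eqP; exact: e.
  move=> /andP[js us].
  have -> : (fun i => if i \in j :: s then \sum_x F i x else F i (v i)) =
      upd (fun i => if i \in s then \sum_x F i x else F i (v i)) j (\sum_x F j x).
    by apply/funext => i; rewrite inE /upd; case: eqP => [->|].
  rewrite fsum [RHS](partition_big (fun w : {ffun 'F_p -> D} => w j) xpredT) //=.
  apply: eq_bigr => x _.
  pose v' := [ffun i => if i == j then x else v i].
  have -> : upd (fun i => if i \in s then \sum_x F i x else F i (v i)) j (F j x) =
     fun i => if i \in s then \sum_x F i x else F i (v' i).
    apply/funext => i; rewrite /upd /v' ffunE; case: eqP => [->|//].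
    by rewrite (negPf js).
  rewrite IH //; apply: eq_bigl => w; apply/forallP/andP => [e|[/forallP e /eqP wj] i].
    split; last by have := e j; rewrite js /v' ffunE eqxx.
    apply/forallP => i; rewrite inE negb_or; apply/implyP => /andP[ij si].
    by have := e i; rewrite si /v' ffunE (negPf ij).
  apply/implyP => si; rewrite /v' ffunE; case: (i =P j) => [->|/eqP ij]; first exact/eqP.
  by have := e i; rewrite inE negb_or ij si.
case: (pickP (fun _ : D => true)) => [x0 _|D0]; last first.
  rewrite [RHS]big1 => [|w _]; last by have := D0 (w 0).
  by apply: (multi_coord0 mf (j := 0)); rewrite big_pred0.
have := expand (enum 'F_p) [ffun=> x0] (enum_uniq _).
have -> : (fun i => if i \in enum 'F_p then \sum_x F i x else F i ([ffun=> x0] i)) =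
   fun i => \sum_x F i x by apply/funext => i; rewrite mem_enum.
by move=> ->; apply: eq_bigl => w; apply/forallP => i; rewrite mem_enum.
Qed.

(** The permutation action on families in [H] underlying the tensor-induced module of
    the group algebra. *)
Definition actX (g : G) (w : T) : T := [ffun i : 'F_p => (iter (- i)%R sigma g.1 * w (i - g.2))%g].

Lemma actX1 w : actX 1%g w = w.
Proof. by apply/ffunP => i; rewrite ffunE iter_sigma1 // mul1g subr0. Qed.

Lemma actXM g h w : actX (g * h)%g w = actX g (actX h w).
Proof.
apply/ffunP => i; rewrite !ffunE sdM1 sdM2 iter_sigmaM // mulgA opprD addrA.
suff -> : iter (- i)%R sigma (iter g.2 sigma h.1) = iter (- (i - g.2))%R sigma h.1 by [].
by rewrite -iter_Fp // opprB addrC.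
Qed.

Lemma actXVK g w : actX g^-1%g (actX g w) = w.
Proof. by rewrite -actXM mulVg actX1. Qed.

Lemma actXKV g w : actX g (actX g^-1%g w) = w.
Proof. by rewrite -actXM mulgV actX1. Qed.

(** A representative of the orbit of [w]; it depends on the orbit only. *)
Definition orbit_point (w : T) : T := xget [ffun=> 1%g] (fun v => exists g, actX g w = v).

Lemma orbit_pointP w : exists g, actX g (orbit_point w) = w.
Proof.
rewrite /orbit_point; case: xgetP => [v _ [g <-]|/(_ w) no].
  by exists g^-1%g; rewrite actXVK.
by case: no; exists 1%g; rewrite actX1.
Qed.

Lemma orbit_point_act g w : orbit_point (actX g w) = orbit_point w.
Proof.
rewrite /orbit_point; congr (xget _ _); apply/funext => v; apply/propext; split=> [] [h <-].
  by exists (h * g)%g; rewrite actXM.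
by exists (h * g^-1)%g; rewrite actXM actXVK.
Qed.

(** The only element with second component [i] that can carry [v] to [w]. Stabilisers of
    families thus embed in F_p, and they meet [base] trivially. *)
Definition transporter (i : 'F_p) (w v : T) : G :=
  ((w 0 * (v (- i))^-1)%g, i).

Lemma transporter_uniq g w v : actX g v = w -> g = transporter g.2 w v.
Proof.
move=> <-; rewrite /transporter ffunE.
have -> : iter (- 0 : 'F_p)%R sigma g.1 = g.1 by rewrite oppr0.
by rewrite sub0r mulgK; case: g.
Qed.

Definition carries (i : 'F_p) (w v : T) : bool := actX (transporter i w v) v == w.

Lemma carries_act (g : G) i w v : carries i w v ->
  carries (i + g.2) (actX g w) v /\ transporter (i + g.2) (actX g w) v = (g * transporter i w v)%g.
Proof.
move=> /eqP c; have e : actX (g * (transporter i w v : G))%g v = actX g w by rewrite actXM c.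
have := transporter_uniq e; rewrite sdM2 -[(transporter i w v).2]/i addrC => {}e'.
by split; [rewrite /carries -e' e | rewrite -e'].
Qed.

Lemma carries_actE (g : G) i w v : carries (i + g.2) (actX g w) v = carries i w v.
Proof.
apply/idP/idP => [c|c]; last by case: (carries_act g c).
by have [] := carries_act g^-1%g c; rewrite actXVK sdV2 addrK.
Qed.

Section Coefficients.
Variables (W : zmodType) (aW : G -> W -> W) (L : W -> Prop).
Hypotheses (aWG : gact (whole G) aW) (kW : killed p W) (LU : usub (whole G) aW L).
Hypothesis tr : has_traces aW L.
Let wG (g : G) : g \in whole G. Proof. exact: in_whole. Qed.

(** The stabiliser of [v] is trivial, or generated by an element [y] as in [has_traces]:
    in both cases the identity is a trace over the stabiliser. *)
Lemma stab_trace v : exists theta : W -> W,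
  [/\ forall x y, theta (x - y) = theta x - theta y,
      forall x, L x -> L (theta x)
    & forall x, L x -> x = \sum_(i : 'F_p | carries i v v)
        aW (transporter i v v) (theta (aW (transporter i v v)^-1%g x))].
Proof.
have c0 : carries 0 v v /\ transporter 0 v v = 1%g.
  by have := transporter_uniq (actX1 v) => /= e; rewrite /carries -e actX1.
have [/existsP[i /andP[i0 ci]]|/existsPn noi] := boolP [exists i : 'F_p, (i != 0) && carries i v v]; last first.
  exists id; split=> // x Lx; rewrite (bigD1 0) ?c0.1 //= c0.2 invg1 !(gact1 aWG) big1 ?addr0 //.
  by move=> i /andP[ci i0]; have := noi i; rewrite i0 ci.
set y := transporter i v v; have yv : actX y v = v by exact/eqP.
have yX m : actX (y ^+ m)%g v = v.
  by elim: m => [|m IH]; rewrite ?actX1 // expgS actXM IH.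
have y2 m : (y ^+ m)%g.2 = i *+ m.
  by elim: m => [|m IH] //; rewrite expgS sdM2 IH mulrS.
have ytr m : transporter (i * m%:R) v v = (y ^+ m)%g.
  by rewrite mulr_natr -y2; exact/esym/transporter_uniq.
have [|theta [tB tL tE]] := tr (y := y) i0.
  by rewrite -ytr pchar_Fp_0 // mulr0 c0.2.
exists theta; split=> // x Lx; rewrite {1}(tE x Lx).
rewrite [RHS](reindex_inj (mulfI i0)) /=; apply: eq_big => [m|m _].
  by rewrite -[m]natr_Zp /carries ytr yX eqxx.
by rewrite -{3 4}[m]natr_Zp ytr.
Qed.

(** The stabiliser trace at a point, moved along its orbit. *)
Lemma orbit_trace v w (theta : W -> W) : (exists g, actX g v = w) ->
  (forall x, L x -> x = \sum_(i : 'F_p | carries i v v)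
        aW (transporter i v v) (theta (aW (transporter i v v)^-1%g x))) ->
  forall x, L x -> x = \sum_(i : 'F_p | carries i w v)
        aW (transporter i w v) (theta (aW (transporter i w v)^-1%g x)).
Proof.
move=> [g <-] tE x Lx; rewrite (reindex_inj (addIr g.2)) /=.
rewrite -{1}[x](gactKV aWG (u := g)) // {1}(tE (aW g^-1%g x)); last exact: (usubA LU).
rewrite (gact_sum aWG) //; apply: eq_big => [i|i ci]; first by rewrite carries_actE.
have [_ ->] := carries_act g ci.
by rewrite invgM !(gactM aWG).
Qed.

Section Cochains.
Variables (C : lmodType A) (r : nat) (b : 'I_r -> C) (phi : 'I_r -> C -> A).
Hypotheses (phiB : forall j c c', phi j (c - c') = phi j c - phi j c')
  (phiZ : forall j a c, phi j (a *: c) = a * phi j c)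
  (phiE : forall c, c = \sum_j phi j c *: b j).

(** A dual basis writes [c] as a finite sum of components indexed by [H], which the
    action of [H] permutes. *)
Definition component (h : H) (c : C) : C := \sum_j (gunit p h *: b j) *+ (phi j c)@_h.

Lemma componentB h c c' : component h (c - c') = component h c - component h c'.
Proof.
rewrite /component -sumrB; apply: eq_bigr => j _; rewrite phiB mcoeffB.
apply/eqP; rewrite eq_sym subr_eq -killed_FpD ?subrK //.
exact: killed_algebra.
Qed.

Lemma component_shift k h c : component (k * h)%g (gunit p k *: c) = gunit p k *: component h c.
Proof.
rewrite /component scaler_sumr; apply: eq_bigr => j _.
by rewrite phiZ mcoeff_shift gunitM -scalerA scalerMnr.
Qed.

Definition group_support (c : C) : {fset H} :=
  \big[@fsetU H/fset0]_(j : 'I_r) msupp (phi j c).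

Lemma component_supp h c : h \notin group_support c -> component h c = 0.
Proof.
move=> hc; rewrite /component big1 // => j _; rewrite mcoeff_outdom ?mulr0n //.
by apply: contra hc => hj; apply/bigfcupP; exists j; rewrite ?mem_index_enum.
Qed.

Lemma component_sum (D : {fset H}) c : (group_support c `<=` D)%fset -> c = \sum_(x : D) component (val x) c.
Proof.
move=> sD; rewrite {1}[c]phiE exchange_big /=; apply: eq_bigr => j _.
rewrite scale_pairing (pairingw _ (d := D)).
  by rewrite big_seq_fsetE.
apply: fsubset_trans sD; apply/fsubsetP => h hj.
by apply/bigfcupP; exists j; rewrite ?mem_index_enum.
Qed.

Definition components (w : T) (c : 'F_p -> C) : 'F_p -> C := fun i => component (w i) (c i).

Lemma components_act g w c : components (actX g w) (actT g c) = actT g (components w c).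
Proof. by apply/funext => i; rewrite /components ffunE component_shift. Qed.

Lemma components_upd w c j a : components w (upd c j a) = upd (components w c) j (component (w j) a).
Proof. by apply/funext => i; rewrite /components /upd; case: eqP => [->|]. Qed.

Lemma multi_components (f : ('F_p -> C) -> W) (D : {fset H}) c : multi L f ->
  (forall i, group_support (c i) `<=` D)%fset ->
  f c = \sum_(w : {ffun 'F_p -> D}) f (components [ffun i => val (w i)] c).
Proof.
move=> mf sD.
have {1}-> : c = fun i => \sum_(x : D) component (val x) (c i).
  by apply/funext => i; exact: component_sum.
rewrite (multi_sum _ mf); apply: eq_bigr => w _; congr f; apply/funext => i.
by rewrite /components ffunE.
Qed.

(** A multilinear map decomposes along the families of components, which [G] permutes.
    Prepending the group element that carries the orbit representative to the given
    family, averaged by the stabiliser trace, contracts the complex of cochains. *)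
Lemma acyclic_projective n :
  acyclic (whole G) (fact (@actT C) aW) (multi L) (fun f => f = 0) n.+2.
Proof.
have [TH THP] := choice stab_trace.
have THB v x y : TH v (x - y) = TH v x - TH v y by case: (THP v).
have THL v x : L x -> L (TH v x) by case: (THP v) => _ + _; apply.
have TH0 v : TH v 0 = 0 by rewrite -{1}(subrr 0) THB subrr.
have THE w x : L x -> x = \sum_(i : 'F_p | carries i w (orbit_point w))
    aW (transporter i w (orbit_point w)) (TH (orbit_point w) (aW (transporter i w (orbit_point w))^-1%g x)).
  by apply: orbit_trace; [exact: orbit_pointP | case: (THP (orbit_point w))].
move=> f [f0 Lf fU] df.
(* The contraction on the component w of the argument. *)
pose R t w c := \sum_(i : 'F_p | carries i w (orbit_point w))
    aW (transporter i w (orbit_point w)) (TH (orbit_point w) (aW (transporter i w (orbit_point w))^-1%g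
      (f (transporter i w (orbit_point w) :: t) (components w c)))).
pose s t c := sumT (fun w => R t w c).
pose allsupp (c : 'F_p -> C) := (\big[@fsetU H/fset0]_(i : 'F_p) group_support (c i)).
have allsuppP c i : (group_support (c i) `<=` allsupp c)%fset.
  by apply: bigfcup_sup; rewrite ?mem_index_enum.
have sE (D : {fset H}) t c : (forall i, group_support (c i) `<=` D)%fset ->
    s t c = \sum_(w : {ffun 'F_p -> D}) R t [ffun i => val (w i)] c.
  move=> sD; apply: sumT_fin => w [i wi]; rewrite /R big1 // => k _.
  rewrite (multi_coord0 (Lf _) (j := i)) ?(gact0 aWG) ?TH0 ?(gact0 aWG) //.
  apply: component_supp; apply: contra wi; exact: fsubsetP.
have RL t w c : L (R t w c).
  apply: (usub_sum LU) => i _; apply: (usubA LU) => //; apply: THL; apply: (usubA LU) => //.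
  by case: (Lf (transporter i w (orbit_point w) :: t)).
have sL t : multi L (s t).
  split=> [c|c j x y].
    by rewrite (sE (allsupp c)) //; apply: (usub_sum LU) => w _.
  pose D := (allsupp c `|` (group_support x `|` (group_support y `|` group_support (x - y))))%fset.
  have subD z : (group_support z `<=` group_support x `|` (group_support y `|` group_support (x - y)))%fset ->
      forall i, (group_support (upd c j z i) `<=` D)%fset.
    move=> sz i; rewrite /upd; case: eqP => _.
      by apply: (fsubset_trans sz); exact: fsubsetUr.
    by apply: (fsubset_trans (allsuppP c i)); exact: fsubsetUl.
  have sx : (group_support x `<=` group_support x `|` (group_support y `|` group_support (x - y)))%fset.
    exact: fsubsetUl.
  have sxy : (group_support (x - y) `<=` group_support x `|` (group_support y `|` group_support (x - y)))%fset.
    by apply: (fsubset_trans (fsubsetUr (group_support y) _)); exact: fsubsetUr.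
  have sy : (group_support y `<=` group_support x `|` (group_support y `|` group_support (x - y)))%fset.
    by apply: (fsubset_trans (fsubsetUl _ (group_support (x - y)))); exact: fsubsetUr.
  rewrite (sE D _ _ (subD _ sxy)) (sE D _ _ (subD _ sx)) (sE D _ _ (subD _ sy)) -sumrB.
  apply: eq_bigr => w _; rewrite /R -sumrB; apply: eq_bigr => i _.
  rewrite !components_upd componentB; set g := transporter _ _ _.
  case: (Lf (g :: t)) => _ ->.
  by rewrite (gactB aWG) // THB (gactB aWG).
have actXI u : bijective (actX u).
  by exists (actX u^-1%g) => w; [exact: actXVK | exact: actXKV].
have RU u t w c : R (translate u t) (actX u w) (actT u c) = aW u (R t w c).
  rewrite /R (reindex_inj (addIr u.2)) /= (gact_sum aWG) //.
  apply: eq_big => [i|i]; rewrite orbit_point_act carries_actE // => ci.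
  have [_ ->] := carries_act u ci; set g := transporter i w (orbit_point w).
  have -> : f ((u * g)%g :: translate u t) (components (actX u w) (actT u c)) =
      aW u (f (g :: t) (components w c)).
    rewrite components_act -[_ :: _]/(translate u (g :: t)) fU // /fact actTVK.
    by [].
  by rewrite invgM !(gactM aWG) // (gactVK aWG).
have sU u t c : s (translate u t) (actT u c) = aW u (s t c).
  rewrite /s {1}/sumT (reindex_fsbigT (actX u)) //=.
  rewrite -[LHS]/(sumT (fun w => R (translate u t) (actX u w) (actT u c))).
  have -> : (fun w => R (translate u t) (actX u w) (actT u c)) = fun w => aW u (R t w c).
    by apply/funext => w.
  have R0 (w : T) : (exists i, w i \notin allsupp c) -> R t w c = 0.
    move=> [i wi]; rewrite /R big1 // => k _.
    rewrite (multi_coord0 (Lf _) (j := i)) ?(gact0 aWG) ?TH0 ?(gact0 aWG) //.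
    by apply: component_supp; apply: contra wi; apply: fsubsetP.
  rewrite !(sumT_fin (D := allsupp c)) // ?(gact_sum aWG) // => w /R0 ->.
  exact: (gact0 aWG).
exists (cutoff n.+1 s).
  have faG := gact_actT C aWG (U := whole G).
  split=> // [t|u t _]; rewrite /cutoff ?size_translate; case: eqP => _.
  - exact: sL.
  - exact: usub0 (multi_usub aWG LU C).
  - by apply/funext => c; rewrite /fact -sU actTKV.
  - by rewrite (gact0 faG).
move=> t st; rewrite delta_cutoff //; apply/funext => c.
rewrite -[LHS]/(f t c - delta s t c) delta_app.
set D := allsupp c; have sD i : (group_support (c i) `<=` D)%fset by exact: allsuppP.
have -> : (fun s' => s s' c) = fun s' => \sum_(w : {ffun 'F_p -> D}) R s' [ffun i => val (w i)] c.
  by apply/funext => s'; exact: sE.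
pose ph (F : {ffun 'F_p -> D} -> W) := \sum_w F w.
have phB F F' : ph (F - F') = ph F - ph F' by rewrite /ph -sumrB.
pose Rt s' (w : {ffun 'F_p -> D}) := R s' [ffun i => val (w i)] c.
rewrite (delta_map (V := {ffun 'F_p -> D} -> W) (phi := ph) Rt t phB) /ph.
rewrite (multi_components (Lf t) sD); apply/eqP; rewrite subr_eq0; apply/eqP.
apply: eq_bigr => w _; rewrite delta_app /Rt; set w' := [ffun i => _].
rewrite {1}(THE w' (f t (components w' c))); last by case: (Lf t).
pose gi i := transporter i w' (orbit_point w').
pose ps (F : 'F_p -> W) := \sum_(i : 'F_p | carries i w' (orbit_point w'))
  aW (gi i) (TH (orbit_point w') (aW (gi i)^-1%g (F i))).
have psB F F' : ps (F - F') = ps F - ps F'.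
  rewrite /ps -sumrB; apply: eq_bigr => i _.
  by rewrite -[(F - F') i]/(F i - F' i) (gactB aWG) // THB (gactB aWG).
pose Ft s' i := f (gi i :: s') (components w' c).
rewrite (delta_map (V := 'F_p -> W) (phi := ps) Ft t psB) /ps.
apply: eq_bigr => i _; congr (aW _ (TH _ (aW _ _))).
rewrite delta_app /Ft -[RHS](delta_app (fun s' => f (gi i :: s'))).
have := df (gi i :: t); rewrite /= st => /(_ erefl) /eqP; rewrite subr_eq0 => /eqP ->.
by [].
Qed.

End Cochains.
End Coefficients.

Lemma tensor_acyclic_fgproj (C : lmodType A) n : finitely_generated C -> projective C ->
  tensor_acyclic pr_p sigmaM sigmap C n.+2.
Proof.
move=> fgC prC W aW L aWG kW LU tr.
have [r [b [phi [phiB phiZ phiE]]]] := dual_basis fgC prC.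
exact: (acyclic_projective aWG LU tr phiB phiZ phiE).
Qed.

(** Shift the degree along the resolution; the trivial module over [base] enters through
    the intermediate layers. *)
Lemma tensor_acyclic_resolved n0 m (M : lmodType A) n :
  (forall k, (n0 < k)%N -> Ext p false (base pr_p sigmaM sigmap) (@triv G p) k) ->
  resolved m M -> (n0 + m < n)%N -> tensor_acyclic pr_p sigmaM sigmap M n.
Proof.
move=> ext; elim: m M n => [|m IH] M n /=.
  move=> M0 _ W aW L aWG kW LU tr f [f0 Lf fU] df; exists (fun _ => 0).
    by apply: cochain0; [exact: gact_actT | exact: multi_usub].
  move=> t _; rewrite delta0 subr0; apply/funext => c.
  by apply: (multi_coord0 (Lf t) (j := 0)); exact: M0.
case=> C [q [fgC prC sq res]]; case: n => // n; rewrite addnS ltnS => lt.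
have n_gt0 : (0 < n)%N by exact: leq_ltn_trans lt.
apply: (tensor_acyclic_quot sq); last exact: IH.
  by apply: ext; apply: leq_ltn_trans lt; exact: leq_addr.
by case: n n_gt0 {lt} => // n _; exact: tensor_acyclic_fgproj.
Qed.

End TensorProjective.

(** * Coefficients with traces *)

Section AcyclicSemidirect.
Variables (p : nat) (H : groupType).
Hypothesis pr_p : prime p.
Variable sigma : H -> H.
Hypotheses (sigmaM : {morph sigma : x y / (x * y)%g}) (sigmap : forall x, iter p sigma x = x).
Local Notation G := (semidirect pr_p sigmaM sigmap).
Local Notation base := (base pr_p sigmaM sigmap).

Lemma base_sd_inj (g : G) : g \in base -> exists h, sd_inj pr_p sigmaM sigmap h = g.
Proof. by move=> /baseP g2; exists g.1; rewrite [RHS]surjective_pairing g2. Qed.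

Lemma acyclic_semidirect : type_FP 'F_p H -> exists n1,
  forall (W : zmodType) (aW : G -> W -> W) (L : W -> Prop) n, (n1 < n)%N ->
    gact (whole G) aW -> killed p W -> usub (whole G) aW L ->
    has_traces aW L ->
    acyclic (whole G) aW L (fun w => w = 0) n.
Proof.
move=> fp; have [n0 ext] := Ext_of_type_FP pr_p fp.
have [m res] := resolved_of_resolution fp.
have [extf _] := ext G _ base (@sd_injM p H pr_p sigma sigmaM sigmap)
  (@sd_inj_inj p H pr_p sigma sigmaM sigmap) base_sd_inj.
exists (n0 + m)%N => W aW L n ltn aWG kW LU tr.
apply: (acyclic_of_trivial (pr_p := pr_p)) => //.
exact: (tensor_acyclic_resolved extf res).
Qed.

End AcyclicSemidirect.

Section PowersFp.
Variables (p : nat) (G : groupType) (y : G).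
Hypotheses (pr_p : prime p) (yp : (y ^+ p)%g = 1%g).

Lemma expg_FpD (i j : 'F_p) : (y ^+ (i + j)%R = y ^+ i * y ^+ j)%g.
Proof.
rewrite -expgnDr [in RHS](divn_eq (i + j)%N p) expgnDr mulnC expgnA yp expg1n mul1g.
by congr (y ^+ (_ %% _)%N)%g; exact: Fp_cast.
Qed.

Lemma expg_FpN (i : 'F_p) : (y ^+ (- i)%R = y ^- i)%g.
Proof. by apply: (mulgI (y ^+ i)%g); rewrite -expg_FpD mulgV addrN. Qed.

Variables (X : choiceType) (x0 : X) (lab : G -> X).
Hypothesis labM : forall u v (i : 'F_p), lab u = lab v -> lab (u * y ^+ i)%g = lab (v * y ^+ i)%g.

Definition orbit_rep (u : G) : X := xget x0 (fun v => exists i : 'F_p, v = lab (u * y ^+ i)%g).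
(** Exactly one point of each free orbit of [y] acting through labels is selected. The
    labels will be the cosets of a subgroup, or the points themselves. *)
Definition selected (u : G) : bool := orbit_rep u == lab u.

Lemma selected_lab u v : lab u = lab v -> selected u = selected v.
Proof.
move=> uv; rewrite /selected uv; congr (_ == _); rewrite /orbit_rep; congr (xget _ _).
by apply/funext => w; apply/propext; split=> -[i ->]; exists i; [exact: labM | apply/esym; exact: labM].
Qed.

Lemma orbit_repM u (i : 'F_p) : orbit_rep (u * y ^+ i)%g = orbit_rep u.
Proof.
rewrite /orbit_rep; congr (xget _ _); apply/funext => w; apply/propext; split=> -[j ->].
  by exists (i + j); rewrite expg_FpD mulgA.
by exists (- i + j); rewrite -mulgA -expg_FpD addrA addrN add0r.
Qed.

Lemma selected_unique u : (forall i : 'F_p, i != 0 -> lab (u * y ^+ i)%g <> lab u) ->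
  \sum_(i : 'F_p) (selected (u * y ^+ i)%g : nat) = 1%N.
Proof.
move=> free; have [i0 repE] : exists i : 'F_p, orbit_rep u = lab (u * y ^+ i)%g.
  rewrite /orbit_rep; case: xgetP => [v _ [i ->]|no]; first by exists i.
  by case: (no (lab (u * y ^+ (0 : 'F_p)%R)%g)); exists 0.
rewrite (bigD1 i0) //= /selected orbit_repM repE eqxx big1 // => i ii0.
apply/eqP; rewrite eqb0; apply/eqP => lab_eq; have /free : i - i0 != 0 by rewrite subr_eq0.
rewrite orbit_repM repE in lab_eq.
apply; have := labM (- i0) lab_eq; rewrite -!mulgA -!expg_FpD addrN => <-.
by rewrite /= mulg1.
Qed.

End PowersFp.

(** * Groups of type FP have no element of order p *)

Section TorsionFree.
Variables (p : nat) (H : groupType).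
Hypothesis pr_p : prime p.
Local Notation A := (group_algebra 'F_p H).
Variable y : H.
Hypotheses (yp : (y ^+ p)%g = 1%g) (y1 : y <> 1%g).

Let expg_inj0 (i : 'F_p) : i != 0 -> (y ^+ i)%g <> 1%g.
Proof.
move=> i0 yi; apply: y1; have : (y ^+ (i * i^-1)%R = 1)%g.
  rewrite -[i^-1]natr_Zp; elim: (i^-1 : nat) => [|n IH]; first by rewrite mulr0.
  by rewrite mulrSr mulrDr mulr1 expg_FpD // IH yi mulg1.
by rewrite divff // expg1.
Qed.

Definition norm_y (M : lmodType A) (v : M) : M := \sum_(i : 'F_p) gunit p (y ^+ i)%g *: v.

(** Vanishing of the two Tate cohomology groups of the cyclic group generated by [y]. *)
Definition tate_trivial (M : lmodType A) : Prop :=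
  (forall v : M, gunit p y *: v = v -> exists w, v = norm_y w) /\
  (forall v : M, norm_y v = 0 -> exists w, v = gunit p y *: w - w).

(** Left multiplication by [y] is free on [H]: the projection of [C] onto the
    coordinates selected in each orbit has trace 1. *)
Lemma tate_trivial_fgproj (C : lmodType A) :
  finitely_generated C -> projective C -> tate_trivial C.
Proof.
move=> fgC prC; have [r [b [phi [phiB phiZ phiE]]]] := dual_basis fgC prC.
have phiD j c c' : phi j (c + c') = phi j c + phi j c'.
  have phi0 : phi j 0 = 0 by rewrite -(subrr 0) phiB subrr.
  by rewrite -{1}[c']opprK phiB -[- c']sub0r phiB phi0 sub0r opprK.
pose sel (h : H) := selected p y 1%g id h^-1%g.
have selE h : \sum_(i : 'F_p) (sel ((y ^+ i)^-1 * h)%g : nat) = 1%N.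
  under eq_bigr do rewrite /sel invgM invgK.
  apply: selected_unique => // [u v i -> //|i /expg_inj0 yi /eqP].
  by rewrite -{2}[h^-1%g]mulg1 (inj_eq (mulgI _)) => /eqP.
pose theta c := \sum_j pairing (phi j c) (fun h => gunit p h *: b j *+ sel h).
have kC : killed p C by exact: killed_algebra.
have thD c c' : theta (c + c') = theta c + theta c'.
  by rewrite /theta -big_split; apply: eq_bigr => j _; rewrite phiD pairingD.
have th0 : theta 0 = 0 by apply: (addrI (theta 0)); rewrite -thD !addr0.
have thE c : c = \sum_(i : 'F_p) gunit p (y ^+ i)%g *: theta (gunit p (y ^+ i)^-1%g *: c).
  rewrite {1}[c]phiE /theta.
  under [RHS]eq_bigr => i _ do rewrite scaler_sumr.
  rewrite exchange_big /=; apply: eq_bigr => j _; rewrite scale_pairing.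
  under [RHS]eq_bigr => i _ do rewrite phiZ pairing_shift // /pairing scaler_sumr.
  rewrite exchange_big /=; apply: eq_bigr => h _.
  transitivity (\sum_(i : 'F_p) gunit p h *: b j *+ (phi j c)@_h *+ sel ((y ^+ i)^-1 * h)%g).
    by rewrite sumrMnr selE mulr1n.
  apply: eq_bigr => i _; rewrite -[RHS]scalerMnr -[in RHS]scalerMnr scalerA -gunitM mulVKg.
  exact: mulrnAC.
have yi_v (v : C) (n : nat) : gunit p y *: v = v -> gunit p (y ^+ n)%g *: v = v.
  by move=> yv; elim: n => [|n IH]; rewrite ?scale1r // expgS gunitM -scalerA IH.
split=> v.
  move=> yv; exists (theta v); rewrite {1}(thE v); apply: eq_bigr => i _.
  by rewrite -{1}(yi_v v i yv) scalerA -gunitM mulVg scale1r.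
move=> nv; pose u (i : 'F_p) := theta (gunit p (y ^+ i)^-1%g *: v).
have su : \sum_i u i = 0.
  rewrite -[RHS]th0 -{2}nv /norm_y (reindex_inj oppr_inj) /=.
  rewrite (big_morph theta thD th0); apply: eq_bigr => i _.
  by rewrite /u expg_FpN // invgK.
have coh (n : nat) (w : C) : exists w', gunit p (y ^+ n)%g *: w - w = gunit p y *: w' - w'.
  elim: n => [|n [w' IH]]; first by exists 0; rewrite scale1r scaler0 !subrr.
  exists (gunit p y *: w' + w); rewrite expgS gunitM -scalerA.
  have -> : gunit p (y ^+ n)%g *: w = w + (gunit p y *: w' - w') by rewrite -IH addrC subrK.
  by rewrite !scalerDr scalerN opprD !addrA [gunit p y *: w + _]addrC.
have -> : v = \sum_(i : 'F_p) (gunit p (y ^+ i)%g *: u i - u i).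
  by rewrite sumrB su subr0; exact: thE.
apply: (big_ind (fun v => exists w, v = gunit p y *: w - w)) => [|v1 v2 [w1 ->] [w2 ->]|i _].
- by exists 0; rewrite scaler0 subrr.
- by exists (w1 + w2); rewrite scalerDr opprD addrACA.
- exact: coh.
Qed.

Lemma norm_yB (M : lmodType A) (v w : M) : norm_y (v - w) = norm_y v - norm_y w.
Proof. by rewrite /norm_y -sumrB; apply: eq_bigr => i _; rewrite scalerBr. Qed.

Lemma norm_y_act (M : lmodType A) (v : M) : norm_y (gunit p y *: v) = norm_y v.
Proof.
rewrite /norm_y [RHS](reindex_inj (addIr (1 : 'F_p))); apply: eq_bigr => i _.
by rewrite scalerA -gunitM expg_FpD.
Qed.

Lemma act_norm_y (M : lmodType A) (v : M) : gunit p y *: norm_y v = norm_y v.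
Proof.
rewrite /norm_y [RHS](reindex_inj (addrI (1 : 'F_p))) scaler_sumr; apply: eq_bigr => i _.
by rewrite scalerA -gunitM expg_FpD.
Qed.

Lemma norm_y_linear (M N : lmodType A) (f : {linear M -> N}) v : norm_y (f v) = f (norm_y v).
Proof. by rewrite /norm_y linear_sum; apply: eq_bigr => i _; rewrite linearZ. Qed.

(** Each half uses one short diagram chase in the hexagon of the Herbrand quotient, for
    which the two groups of [C] and of the kernel suffice. *)
Lemma tate_trivial_quot (C B : lmodType A) (q : {linear C -> B}) :
  surjective q -> tate_trivial C -> tate_trivial (kernel q) -> tate_trivial B.
Proof.
move=> sq [C1 C2] [Z1 Z2].
have qv (z : kernel q) : q (val z) = 0 by apply/kernelP; exists z.
have nval (z : kernel q) : val (norm_y z) = norm_y (val z).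
  by rewrite (norm_y_linear (val : {linear kernel q -> C})).
split=> b hb; have [c qc] := sq b.
  have [|z zE] := (kernelP q (gunit p y *: c - c)).1.
    by rewrite linearB linearZ /= qc hb subrr.
  have [|w zw] := Z2 z.
    by apply/val_inj; rewrite nval zE norm_yB norm_y_act subrr.
  have [|c' cE] := C1 (c - val w).
    have e : gunit p y *: c - c = gunit p y *: val w - val w by rewrite -zE zw.
    rewrite scalerBr; apply/eqP; rewrite subr_eq; move/eqP: e; rewrite subr_eq => /eqP ->.
    by rewrite addrC addrA addrAC.
  exists (q c'); rewrite norm_y_linear -cE linearB qc qv subr0 //.
have [|z zE] := (kernelP q (norm_y c)).1; first by rewrite -norm_y_linear qc.
have [|w zw] := Z1 z.
  by apply/val_inj; rewrite -[LHS]/(gunit p y *: val z) zE act_norm_y.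
have [|c' cE] := C2 (c - val w).
  by rewrite norm_yB -zE -nval -zw subrr.
by exists (q c'); rewrite -linearZ -linearB -cE linearB qv qc subr0.
Qed.

Lemma tate_trivial_resolved m (M : lmodType A) : resolved m M -> tate_trivial M.
Proof.
elim: m M => [|m IH] M /=.
  by move=> M0; split=> v _; exists 0; rewrite (M0 v); [exact/esym/M0 | exact/esym/M0].
case=> C [q [fgC prC sq /IH Z]]; apply: (tate_trivial_quot sq) => //.
exact: tate_trivial_fgproj.
Qed.

(** On the trivial module the norm is multiplication by p, which is 0, although
    everything is fixed. *)
Lemma no_torsion : ~ type_FP 'F_p H.
Proof.
move=> /resolved_of_resolution[m /tate_trivial_resolved[T1 _]].
have actE g (v : trivial_module 'F_p H) : gunit p g *: v = v.
  by rewrite -[LHS](_ : augmentation (gunit p g) * (v : 'F_p) = _) // augmentationU mul1r.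
have [w] := T1 (1 : 'F_p) (actE y _).
rewrite /norm_y; under eq_bigr do rewrite actE.
rewrite sumr_const card_Fp // -[X in _ = X](_ : (w : 'F_p) *+ p = _) //.
rewrite -mulr_natr pchar_Fp_0 // mulr0 => /eqP.
by rewrite -[_ == _]/((1 : 'F_p) == 0) oner_eq0.
Qed.

End TorsionFree.

Lemma torsion_free p (H : groupType) (y : H) : prime p -> type_FP 'F_p H ->
  (y ^+ p)%g = 1%g -> y = 1%g.
Proof. by move=> pr_p fp yp; apply: contrapT => y1; exact: (no_torsion pr_p yp y1 fp). Qed.

(** * The centralizing subgroup and its fixed cosets *)

Section QuotientGroup.
Variables (V : zmodType) (I : V -> Prop).
Hypotheses (I0 : I 0) (IB : forall v w, I v -> I w -> I (v - w)).

Let P : {pred V} := fun v => `[< I v >].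
Fact quotient_closed : zmod_closed P.
Proof. by split; [exact/asboolP | move=> v w /asboolP Iv /asboolP Iw; apply/asboolP; exact: IB]. Qed.

(** Quotients are used through a section, so that the module structure on them can be
    read off from the ambient group. *)
Lemma quotient_exists : exists (W : zmodType) (pi : V -> W) (sec : W -> V),
  [/\ forall v w, pi (v - w) = pi v - pi w, forall w, pi (sec w) = w
    & forall v, pi v = 0 <-> I v].
Proof.
pose PI : zmodClosed V := HB.pack_for (zmodClosed V) P (GRing.isZmodClosed.Build V P quotient_closed).
exists (Quotient.quot PI), \pi_(Quotient.quot PI)%qT, (@repr V _).
have piB v w : \pi_(Quotient.quot PI)%qT (v - w) =
    \pi_(Quotient.quot PI)%qT v - \pi_(Quotient.quot PI)%qT w.
  by rewrite Quotient.pi_add Quotient.pi_opp.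
split=> // [w|v]; first exact: reprK.
have pi0 : \pi_(Quotient.quot PI)%qT 0 = 0 by rewrite -(subrr 0) piB subrr.
rewrite -pi0; split=> [/eqP|Iv].
  by rewrite -Quotient.idealrBE subr0 => /asboolP.
by apply/eqP; rewrite -Quotient.idealrBE subr0; apply/asboolP.
Qed.
End QuotientGroup.

Section DirectExt.
Variables (p : nat) (G : groupType) (U : groupClosed G).
Hypothesis pr_p : prime p.

(** A homomorphism from F_p is determined by its value at 1. *)
Lemma Ext_trivE b n : Ext p b U (@triv G p) n ->
  forall (Y : zmodType) (aY : G -> Y -> Y) (L E : Y -> Prop),
  coeff U aY L E -> killed p Y -> forall f : seq G -> Y, cochain U aY L f ->
  (forall t, size t = n.+1 -> E (delta f t)) ->
  exists S : seq Y, [/\ b || nilp S, forall y, y \in S -> L y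
    & exists2 g, cochain U aY L g
      & forall t, size t = n -> gen U aY E S (f t - delta g t)].
Proof.
move=> ext Y aY L E LE kY f [f0 Lf fU] df; have [aYG LU EU EL] := LE.
have [||S [nS SL [g [g0 Lg gU] fg]]] := ext Y aY L E LE kY (fun t (m : 'F_p) => f t *+ m).
- split=> [|t|u t Uu].
  + by apply/funext => m; rewrite f0 mul0rn.
  + split=> [m|m m']; first exact: (usubMn LU).
    by rewrite killed_FpD // addrAC addrK subrr; exact: usub0 EU.
  + by apply/funext => m; rewrite /fact fU // (gactMn aYG).
- move=> t m st; rewrite delta_app (delta_map (phi := fun y => y *+ m)).
    by apply: (usubMn EU); exact: df.
  by move=> v w; rewrite mulrnBl.
exists S; split=> //; exists (fun t => g t 1).
  by split=> [|t|u t Uu]; [rewrite g0 | case: (Lg t) | rewrite gU].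
move=> t st; have := fg t 1 st; rewrite delta_app.
by have -> : f t *+ (1 : 'F_p)%R = f t.
Qed.

Lemma Ext_of_triv b n :
  (forall (Y : zmodType) (aY : G -> Y -> Y) (L E : Y -> Prop),
    coeff U aY L E -> killed p Y -> forall f : seq G -> Y, cochain U aY L f ->
    (forall t, size t = n.+1 -> E (delta f t)) ->
    exists S : seq Y, [/\ b || nilp S, forall y, y \in S -> L y
      & exists2 g, cochain U aY L g
        & forall t, size t = n -> gen U aY E S (f t - delta g t)]) ->
  Ext p b U (@triv G p) n.
Proof.
move=> ext Y aY L E LE kY f [f0 Lf fU] df; have [aYG LU EU EL] := LE.
have [||S [nS SL [g [g0 Lg gU] fg]]] := ext Y aY L E LE kY (fun t => f t 1).
- by split=> [|t|u t Uu]; [rewrite f0 | case: (Lf t) | rewrite fU].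
- by move=> t st; have := df t 1 st; rewrite delta_app.
exists S; split=> //; have LE' := coeff_gen LE SL; have [_ _ EU' _] := LE'.
exists (fun t (m : 'F_p) => g t *+ m).
  split=> [|t|u t Uu].
  + by apply/funext => m; rewrite g0 mul0rn.
  + split=> [m|m m']; first exact: (usubMn LU).
    by rewrite killed_FpD // addrAC addrK subrr; exact: usub0 EU'.
  + by apply/funext => m; rewrite /fact gU // (gactMn aYG).
move=> t m st; rewrite delta_app (delta_map (phi := fun y => y *+ m)); last first.
  by move=> v w; rewrite mulrnBl.
apply: (usub_trans EU' (w := f t 1 *+ m)).
  apply: gen_base; rewrite -{1}[m]natr_Zp.
  exact: (homPMn LE (1 : 'F_p) m (Lf t)).
by rewrite -mulrnBl; apply: (usubMn EU'); exact: fg.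
Qed.

End DirectExt.

Section Centralizer.
Variables (p : nat) (H : groupType).
Hypothesis pr_p : prime p.
Variable sigma : H -> H.
Hypotheses (sigmaM : {morph sigma : x y / (x * y)%g}) (sigmap : forall x, iter p sigma x = x).
Hypothesis tf : forall h : H, (h ^+ p)%g = 1%g -> h = 1%g.
Local Notation G := (semidirect pr_p sigmaM sigmap).
Local Notation rot := (sd_rot pr_p sigmaM sigmap).

Lemma sigma1 : sigma 1%g = 1%g.
Proof. exact: (iter_sigma1 sigmaM 1). Qed.

Lemma iter_fixed n h : sigma h = h -> iter n sigma h = h.
Proof. by move=> hh; elim: n => //= n ->. Qed.

(** The product of the fixed points of [sigma] by the cyclic group generated by (1, 1). *)
Definition centralizing : groupClosed G.
Proof.
refine (subgroup_of (P := fun g : G => sigma g.1 = g.1) _ _ _).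
- exact: sigma1.
- by move=> x y sx sy; rewrite sdM1 iter_fixed // sigmaM sx sy.
- move=> x sx; have xV : sigma x.1^-1%g = x.1^-1%g.
    by apply: (mulgI x.1); rewrite -{1}sx -sigmaM !mulgV sigma1.
  by rewrite sdV /= iter_fixed.
Defined.
Local Notation N := centralizing.

Lemma centralizingP (g : G) : g \in N <-> sigma g.1 = g.1.
Proof. exact: subgroup_ofP. Qed.

Lemma fixed_Fp (i : 'F_p) h : i != 0 -> iter i sigma h = h -> sigma h = h.
Proof.
move=> i0 ih; have it (n : nat) : iter (i * n%:R)%R sigma h = h.
  elim: n => [|n IH]; first by rewrite mulr0.
  by rewrite mulrSr mulrDr mulr1 iter_Fp // ih.
have := it (i^-1 : 'F_p); rewrite natr_Zp divff //.
Qed.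

Lemma sd_expg (g : G) m : sigma g.1 = g.1 -> (g ^+ m)%g = ((g.1 ^+ m)%g, g.2 *+ m) :> G.
Proof.
move=> sg; elim: m => [|m IH] //; rewrite expgS IH sdM /=.
by rewrite iter_fixed ?expgS ?mulrS //; elim: m {IH} => [|m IH]; rewrite ?sigma1 // expgS sigmaM sg IH.
Qed.

Lemma expg_FpM (g : G) (i j : 'F_p) : (g ^+ p)%g = 1%g -> ((g ^+ i) ^+ j = g ^+ (i * j)%R)%g.
Proof.
move=> gp; rewrite -expgnA [in LHS](divn_eq (i * j)%N p) expgnDr mulnC expgnA gp expg1n mul1g.
by congr (g ^+ (_ %% _)%N)%g; apply/esym; exact: Fp_cast.
Qed.

Lemma expg_conj (u g : G) m : ((u * g * u^-1) ^+ m = u * g ^+ m * u^-1)%g.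
Proof.
elim: m => [|m IH]; first by rewrite !expg0 mulg1 mulgV.
by rewrite !expgS IH !mulgA mulgVK.
Qed.

(** An element of order p in the direct product of a p-torsion-free group by Z/p lies in
    the second factor. *)
Lemma fixed_conj (u y : G) (i : 'F_p) : (y ^+ p)%g = 1%g -> y.2 != 0 -> i != 0 ->
  (u * y ^+ i * u^-1)%g \in N -> (u * y * u^-1)%g = rot y.2.
Proof.
move=> yp y2 i0 /centralizingP; set n := (u * _ * _)%g => sn.
have np : (n ^+ p)%g = 1%g by rewrite /n expg_conj -expgnA mulnC expgnA yp expg1n mulg1 mulgV.
have n1 : n.1 = 1%g by apply: tf; have := sd_expg p sn; rewrite np => -[].
have y2M (m : nat) : (y ^+ m)%g.2 = y.2 *+ m.
  by elim: m => [|m IH] //; rewrite expgS sdM2 IH mulrS.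
have n2 : n.2 = y.2 *+ i by rewrite /n !sdM2 sdV2 y2M addrAC addrN add0r.
have := sd_expg (i^-1 : 'F_p) sn; rewrite n1 n2 expg1n /n expg_conj expg_FpM // divff //.
by rewrite expg1 => ->; rewrite -mulrnA -mulr_natr natrM !natr_Zp divff // mulr1.
Qed.

(** When nontrivial powers of [y] fix the cosets of [u] and [v], conjugation by [u] and
    by [v] carries [y] to the same generator of Z/p, so [u v^-1] commutes with it. *)
Lemma fixed_coset (u v y : G) (i j : 'F_p) : (y ^+ p)%g = 1%g -> y.2 != 0 -> i != 0 -> j != 0 ->
  (u * y ^+ i * u^-1)%g \in N -> (v * y ^+ j * v^-1)%g \in N -> (u * v^-1)%g \in N.
Proof.
move=> yp y2 i0 j0 /(fixed_conj yp y2 i0) ue /(fixed_conj yp y2 j0) ve.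
apply/centralizingP; apply: (fixed_Fp y2).
have com : (rot y.2 * (u * v^-1) = (u * v^-1) * rot y.2)%g.
  by rewrite -{1}ue -ve !mulgA !mulgVK.
have := congr1 fst com; rewrite !sdM1 /= mul1g => ->.
by rewrite iter_sigma1 // mulg1.
Qed.

End Centralizer.

(** * Coinduced modulo induced coefficients *)

Section Coinduction.
Variables (p : nat) (H : groupType).
Hypothesis pr_p : prime p.
Variable sigma : H -> H.
Hypotheses (sigmaM : {morph sigma : x y / (x * y)%g}) (sigmap : forall x, iter p sigma x = x).
Hypothesis tf : forall h : H, (h ^+ p)%g = 1%g -> h = 1%g.
Local Notation G := (semidirect pr_p sigmaM sigmap).
Local Notation N := (centralizing pr_p sigmaM sigmap).

Section Coefficients.
Variables (Y : zmodType) (aY : G -> Y -> Y) (L E : Y -> Prop).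
Hypotheses (LE : coeff N aY L E) (kY : killed p Y).
Let aYG : gact N aY. Proof. by case: LE. Qed.
Let LU : usub N aY L. Proof. by case: LE. Qed.
Let EU : usub N aY E. Proof. by case: LE. Qed.
Let EL y : E y -> L y. Proof. by case: LE => _ _ _; apply. Qed.

Definition shift (g : G) (phi : G -> Y) : G -> Y := fun u => phi (u * g)%g.

Lemma gact_shift U : gact U shift.
Proof.
split=> // [v|u u' v _ _]; apply/funext => w; rewrite /shift ?mulg1 //.
by rewrite mulgA.
Qed.

Definition coind (L : Y -> Prop) (phi : G -> Y) : Prop :=
  (forall u, L (phi u)) /\ (forall n u, n \in N -> phi (n * u)%g = aY n (phi u)).

Lemma coind_usub L' : usub N aY L' -> usub (whole G) shift (coind L').
Proof.
move=> L'U; split.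
- by split=> [u|n u Nn]; [exact: usub0 L'U | rewrite (gact0 aYG)].
- move=> v w [Lv vN] [Lw wN]; split=> [u|n u Nn]; first exact: (usubB L'U).
  by rewrite -[LHS]/(v _ - w _) vN // wN // -(gactB aYG).
- move=> g v _ [Lv vN]; split=> [u|n u Nn]; first exact: Lv.
  by rewrite /shift -mulgA vN.
Qed.

(** The induced module: modulo [E], its elements are supported on finitely many cosets. *)
Definition ind (phi : G -> Y) : Prop :=
  coind L phi /\ exists s : seq G, forall u, E (phi u) \/ exists2 v, v \in s & (u * v^-1)%g \in N.

Lemma ind_usub : usub (whole G) shift ind.
Proof.
have [c0 cB cA] := coind_usub LU; split.
- by split=> //; exists [::] => u; left; exact: usub0 EU.
- move=> v w [cv [s sv]] [cw [t tw]]; split; first exact: cB.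
  exists (s ++ t) => u; have [Ev|[x xs ux]] := sv u; last first.
    by right; exists x; rewrite ?mem_cat ?xs.
  have [Ew|[x xs ux]] := tw u; first by left; exact: (usubB EU).
  by right; exists x; rewrite ?mem_cat ?xs ?orbT.
- move=> g v wg [cv [s sv]]; split; first exact: cA.
  exists [seq (x * g^-1)%g | x <- s] => u; have [Ev|[x xs ux]] := sv (u * g)%g; first by left.
  right; exists (x * g^-1)%g; first by apply/mapP; exists x.
  by rewrite invgM invgK mulgA.
Qed.

Lemma ind_of_coind_E phi : coind E phi -> ind phi.
Proof.
move=> [Ephi phiN]; split; first by split=> // u; exact: EL.
by exists [::] => u; left.
Qed.

Lemma killed_cochains : killed p (G -> Y).
Proof. exact: killed_fun. Qed.

(** A representative of the coset of [u], as a function on the group. *)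
Definition coset_label (u : G) : G := ((kappa N u)^-1 * u)%g.

Lemma coset_labelM n u : n \in N -> coset_label (n * u)%g = coset_label u.
Proof. by move=> Nn; rewrite /coset_label kappaM // invgM -mulgA mulKg. Qed.

Lemma coset_label_eq u v : coset_label u = coset_label v -> exists2 n, n \in N & u = (n * v)%g.
Proof.
rewrite /coset_label => e; exists (kappa N u * (kappa N v)^-1)%g.
  by rewrite gpredM ?gpredV ?kappa_mem.
by rewrite -mulgA -e mulVKg.
Qed.

Definition select (y : G) (phi : G -> Y) : G -> Y :=
  fun u => phi u *+ selected p y 1%g coset_label u.

Lemma coset_labelX (y : G) u v (i : 'F_p) : coset_label u = coset_label v ->
  coset_label (u * y ^+ i)%g = coset_label (v * y ^+ i)%g.
Proof. by move=> /coset_label_eq[n Nn ->]; rewrite -mulgA coset_labelM. Qed.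

Lemma coind_select y L' phi : usub N aY L' -> coind L' phi -> coind L' (select y phi).
Proof.
move=> L'U [Lphi phiN]; split=> [u|n u Nn]; first exact: (usubMn L'U).
rewrite /select phiN // (selected_lab 1%g (@coset_labelX y) (coset_labelM u Nn)).
by rewrite (gactMn aYG).
Qed.

Lemma ind_select y phi : ind phi -> ind (select y phi).
Proof.
move=> [cphi [s sphi]]; split; first exact: coind_select.
exists s => u; have [Ephi|] := sphi u; last by right.
by left; exact: (usubMn EU).
Qed.

(** Summed over the powers of [y], the selected part of [phi] gives back [phi], except
    on cosets where [y] does not act freely. There is at most one such coset, so the
    error is induced. *)
Lemma select_trace (y : G) phi : (y ^+ p)%g = 1%g -> y.2 != 0 -> coind L phi ->
  ind (phi - \sum_(i : 'F_p) shift (y ^+ i)%g (select y (shift (y ^- i)%g phi))).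
Proof.
move=> yp y2 cphi.
have cU := coind_usub LU.
have sumE (F : 'F_p -> G -> Y) u : (\sum_i F i) u = \sum_i F i u.
  by apply: (big_morph (fun F : G -> Y => F u)).
split.
  apply: (usubB cU) => //; apply: (usub_sum cU) => i _; apply: (usubA cU); first exact: in_whole.
  by apply: coind_select => //; apply: (usubA cU) => //; exact: in_whole.
pose fixed u := exists2 i : 'F_p, i != 0 & coset_label (u * y ^+ i)%g = coset_label u.
have phiE u : (phi - \sum_(i : 'F_p) shift (y ^+ i)%g (select y (shift (y ^- i)%g phi))) u =
    phi u - phi u *+ (\sum_(i : 'F_p) (selected p y 1%g coset_label (u * y ^+ i)%g : nat)).
  rewrite -[LHS]/(phi u - (\sum_(i : 'F_p) _) u) sumE -sumrMnr; congr (_ - _).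
  by apply: eq_bigr => i _; rewrite /shift /select mulgK.
have [[u0 [i0 i0n fix0]]|nofix] := pselect (exists u, fixed u).
  exists [:: u0] => u; have [[i i_n fixu]|free] := pselect (fixed u).
    right; exists u0; first by rewrite inE.
    apply: (fixed_coset tf yp y2 i_n i0n).
      by have [n Nn ->] := coset_label_eq fixu; rewrite mulgK.
    by have [n Nn ->] := coset_label_eq fix0; rewrite mulgK.
  left; rewrite phiE (selected_unique pr_p yp) ?mulr1n ?subrr; first exact: usub0 EU.
    exact: coset_labelX.
  by move=> i i_n e; apply: free; exists i.
exists [::] => u; left; rewrite phiE (selected_unique pr_p yp) ?mulr1n ?subrr; first exact: usub0 EU.
  exact: coset_labelX.
by move=> i i_n e; apply: nofix; exists u, i.
Qed.

(** Cochains modulo induced functions are cochains in the quotient module, which has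
    traces. *)
Lemma acyclic_coind_ind n :
  (forall (W : zmodType) (aW : G -> W -> W) (LW : W -> Prop),
    gact (whole G) aW -> killed p W -> usub (whole G) aW LW -> has_traces aW LW ->
    acyclic (whole G) aW LW (fun w => w = 0) n) ->
  acyclic (whole G) shift (coind L) ind n.
Proof.
move=> ac f [f0 Lf fU] df; have wG (g : G) := in_whole g.
have iU := ind_usub; have cU := coind_usub LU; have sG := gact_shift (whole G).
have [W [pi [sec [piB secK pi0]]]] := quotient_exists (usub0 iU) (fun v w => usubB iU (v := v) (w := w)).
have piE v w : ind (v - w) -> pi v = pi w.
  by move=> /pi0; rewrite piB => /eqP; rewrite subr_eq0 => /eqP.
have indE v w : pi v = pi w -> ind (v - w) by move=> e; apply/pi0; rewrite piB e subrr.
have pi00 : pi 0 = 0 by apply/pi0; exact: usub0 iU.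
have piD v w : pi (v + w) = pi v + pi w.
  by rewrite -{1}[w]opprK piB -[- w]sub0r piB pi00 sub0r opprK.
pose aW g w := pi (shift g (sec w)).
have aWpi g v : aW g (pi v) = pi (shift g v).
  apply: piE; rewrite -(gactB sG) //; apply: (usubA iU) => //; apply: indE.
  exact: secK.
have aWG : gact (whole G) aW.
  split=> [u v w _|v|u u' v _ _].
  - by rewrite -[v]secK -[w]secK -piD !aWpi (gactD sG) // piD.
  - by rewrite /aW (gact1 sG) secK.
  - by rewrite -[v]secK !aWpi (gactM sG).
have kW : killed p W.
  move=> w; rewrite -[w]secK; have kV := killed_cochains (sec w).
  have piMn k : pi (sec w *+ k) = pi (sec w) *+ k.
    by elim: k => [|k IH]; rewrite ?mulr0n // !mulrS piD IH.
  by rewrite -piMn kV.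
pose LW w := exists2 phi, coind L phi & pi phi = w.
have LWU : usub (whole G) aW LW.
  split=> [|v w [phi cphi <-] [psi cpsi <-]|u v wu [phi cphi <-]].
  - by exists 0 => //; exact: usub0 cU.
  - by exists (phi - psi); [exact: (usubB cU) | exact: piB].
  - by exists (shift u phi); [exact: (usubA cU) | rewrite aWpi].
have selB y v w : select y (v - w) = select y v - select y w.
  by apply/funext => u; rewrite /select -[(v - w) u]/(v u - w u) mulrnBl.
have tr : has_traces aW LW.
  move=> y y2 yp; pose theta w := pi (select y (sec w)).
  have thpi v : theta (pi v) = pi (select y v).
    apply: piE; rewrite -selB; apply: ind_select; apply: indE; exact: secK.
  exists theta; split=> [v w|w [phi cphi <-]|w [phi cphi <-]].
  - by rewrite -[v]secK -[w]secK -piB !thpi selB piB.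
  - by rewrite thpi; exists (select y phi) => //; exact: coind_select.
  rewrite [LHS](piE _ _ (select_trace yp y2 cphi)).
  rewrite (big_morph pi piD pi00); apply: eq_bigr => i _.
  by rewrite (aWpi (y ^- i)%g phi) thpi aWpi.
have [||g [g0 Lg gU] fg] := ac W aW LW aWG kW LWU tr (fun t => pi (f t)).
- split=> [|t|u t _]; first by rewrite f0.
    by exists (f t).
  by rewrite fU // aWpi.
- by move=> t st; rewrite (delta_map (phi := pi)) //; apply/pi0; exact: df.
have lift t : exists phi, coind L phi /\ pi phi = g t.
  by have [phi cphi e] := Lg t; exists phi.
have [g1 g1P] := choice lift.
pose g2 t := if t is [::] then 0 else g1 t.
have g2L t : coind L (g2 t) by case: t => [|x t]; [exact: usub0 cU | case: (g1P (x :: t))].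
have g2E t : pi (g2 t) = g t.
  by case: t => [|x t]; [rewrite pi00 g0 | case: (g1P (x :: t))].
exists (strict (whole G) shift g2); first by apply: cochain_strict.
have Es t : ind (g2 t - strict (whole G) shift g2 t).
  apply: (strictP t iU) => // u s _; apply: indE.
  by rewrite -aWpi !g2E gU.
move=> t st; apply: (usub_trans iU (w := delta g2 t)); last first.
  by rewrite -deltaB; apply: (usub_delta iU) => s _; exact: Es.
apply: indE; rewrite -(delta_map (phi := pi)) //.
have -> : (fun t => pi (g2 t)) = g by apply/funext => s; exact: g2E.
by apply/eqP; rewrite -subr_eq0; apply/eqP; exact: fg.
Qed.

End Coefficients.

(** By Shapiro's lemma a cocycle [c] of the centralizing subgroup gives a cocycle [e0]
    of [G] in the coinduced module. Up to a coboundary it takes values in the induced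
    module, where finitely many functions, hence finitely many values of them, suffice
    to kill it. *)
Lemma Ext_centralizing n1 n :
  (forall k, Ext p true (whole G) (@triv G p) k) -> (n1 < n)%N ->
  (forall (W : zmodType) (aW : G -> W -> W) (LW : W -> Prop) k, (n1 < k)%N ->
    gact (whole G) aW -> killed p W -> usub (whole G) aW LW -> has_traces aW LW ->
    acyclic (whole G) aW LW (fun w => w = 0) k) ->
  Ext p true N (@triv G p) n.
Proof.
move=> extG ltn ac; apply: (Ext_of_triv pr_p) => Y aY L E LE kY c [c0 Lc cU] dc.
have [aYG LU EU EL] := LE; have wG (g : G) := in_whole g.
have sG := gact_shift Y (whole G).
have cU' := coind_usub LE LU; have iU := ind_usub LE.
pose e0 t : G -> Y := fun u => c (translate u t).
have ce0 : cochain (whole G) (@shift Y) (coind aY L) e0.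
  split=> [|t|u t _].
  - by apply/funext => u; rewrite /e0 /= c0.
  - by split=> [u|m u Nm]; [exact: Lc | rewrite /e0 translateM cU].
  - by apply/funext => v; rewrite /e0 /shift translateM.
have de0 t : size t = n.+1 -> coind aY E (delta e0 t).
  move=> st; split=> [u|m u Nm]; rewrite !delta_app.
    by rewrite -[X in E X](delta_translate c); apply: dc; rewrite size_translate.
  rewrite -(delta_map (phi := aY m)); last by move=> *; rewrite (gactB aYG).
  congr (delta _ _); apply/funext => r; have [_ Le0 _] := ce0.
  by have [_ ->] := Le0 r.
have [|e1 ce1 e01] := acyclic_coind_ind LE kY (fun W aW LW => ac W aW LW n ltn) ce0.
  by move=> t st; apply: ind_of_coind_E => //; exact: de0.
pose e t := e0 t - delta e1 t.
have ce : cochain (whole G) (@shift Y) (ind aY L E) (cutoff n e).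
  apply: (cochain_cutoff sG iU (L := coind aY L)) => //.
  by apply: cochainB => //; exact: cochain_delta.
have IE : coeff (whole G) (@shift Y) (ind aY L E) (coind aY E).
  split=> //; first exact: (coind_usub LE).
  by move=> phi; exact: ind_of_coind_E.
have [|S [_ SI [g2 cg2 eg2]]] := Ext_trivE pr_p (extG n) IE (killed_fun kY) ce.
  by move=> t st; rewrite delta_cutoff // /e deltaB delta_delta subr0; exact: de0.
have supp phi : exists s : seq G, ind aY L E phi ->
    forall u, E (phi u) \/ exists2 v, v \in s & (u * v^-1)%g \in N.
  have [[_ [s sP]]|no] := pselect (ind aY L E phi); first by exists s.
  by exists [::].
have [s sP] := choice supp.
(* Modulo [E], the functions in S take, up to the action, their values at finitely many
   points. *)
pose S' := [seq phi v | phi <- S, v <- s phi].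
have SL y : y \in S' -> L y.
  by case/allpairsPdep => phi [v [Sphi _ ->]]; have [[Lphi _] _] := SI _ Sphi.
have genS phi u : gen (whole G) (@shift Y) (coind aY E) S phi -> gen N aY E S' (phi u).
  have gU : usub N aY (gen N aY E S') by exact: gen_usub.
  move=> gphi; move: u; apply: (gphi (fun phi => forall u, gen N aY E S' (phi u))).
  - split=> [u|v w gv gw u|v w _ gw u]; [exact: usub0 gU | exact: (usubB gU) | exact: gw].
  - by move=> psi [Epsi _] u; apply: gen_base.
  - move=> psi Spsi u; have ipsi := SI _ Spsi.
    have [Epsi|[v vs uv]] := sP psi ipsi u; first exact: gen_base.
    have [[_ psiN] _] := ipsi; rewrite -[u](mulgVK v) psiN //.
    by apply: (usubA gU) => //; apply: gen_seed; apply/allpairsPdep; exists psi, v.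
exists S'; split=> //.
have [e10 Le1 e1U] := ce1; have [g20 Lg2 g2U] := cg2.
exists (fun t => e1 t 1%g + g2 t 1%g).
  split=> [|t|u t Nu].
  - by rewrite e10 g20 addr0.
  - by apply: (usubD LU); [case: (Le1 t) | case: (Lg2 t) => -[]].
  - rewrite e1U // g2U // /shift mul1g (gactD aYG) //.
    have [_ e1N] := Le1 t; have [[_ g2N] _] := Lg2 t.
    by rewrite -{1 2}[u]mulg1 e1N // g2N.
move=> t st; have := genS _ 1%g (eg2 t st).
rewrite (cutoffE _ st) -[X in gen _ _ _ _ X]/(c (translate 1%g t) - delta e1 t 1%g - delta g2 t 1%g).
by rewrite translate1 deltaD opprD addrA !delta_app.
Qed.

End Coinduction.

(** * Direct products with a cyclic group *)

Section Prism.
Variables (G : groupType) (P : G -> G).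

(** The homotopy between the identity and the map induced by [P] on the standard
    complex. *)
Fixpoint prism (V : zmodType) (f : seq G -> V) (s : seq G) : V :=
  if s is a :: s' then f (P a :: a :: s') - prism (fun t => f (P a :: t)) s' else 0.

Lemma prismB (V : zmodType) (f g : seq G -> V) s :
  prism (fun t => f t - g t) s = prism f s - prism g s.
Proof.
elim: s f g => [|a s IH] f g /=; first by rewrite subr0.
by rewrite IH !opprD !opprK addrACA.
Qed.

Lemma delta_prism (V : zmodType) (f : seq G -> V) s :
  delta (prism f) s + prism (delta f) s = f s - f (map P s).
Proof.
elim: s f => [|a s IH] f /=; first by rewrite addr0 subrr.
rewrite (deltaB (fun u => f (P a :: a :: u)) (prism (fun u => f (P a :: u)))).
rewrite (prismB f (delta (fun u => f (P a :: u)))).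
have := IH (fun u => f (P a :: u)) => /= IHf.
set X := delta _ s; set Y := delta (prism _) s in IHf *.
set Z := prism (delta _) s in IHf *; set W := prism f s.
have -> : W - (X - Y) + (f (a :: s) - (f (P a :: s) - X) - (W - Z)) =
    f (a :: s) - f (P a :: s) + (Y + Z).
  rewrite !opprD !opprK.
  have -> : W + (- X + Y) + (f (a :: s) + (- f (P a :: s) + X) + (- W + Z)) =
      f (a :: s) - f (P a :: s) + (Y + Z) + (W - W) + (X - X).
    rewrite !addrA.
    by rewrite [LHS](ACl (4*5*3*8*1*7*6*2)).
  by rewrite !subrr !addr0.
by rewrite IHf addrA subrK.
Qed.
End Prism.

Section Periodicity.
Variables (p : nat) (G : groupType).
Hypothesis pr_p : prime p.
Variables (rot : 'F_p -> G) (lab : G -> 'F_p).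
Hypotheses (rotD : forall i j, rot (i + j) = (rot i * rot j)%g)
  (lab_rot : forall i g, lab (rot i * g)%g = i + lab g).

Definition gap (i j : 'F_p) : nat := (j - i)%R.

(** The cocycle of the extension of Z/p by Z/p given by Z/p^2, which generates the
    second cohomology group: the carry in the addition of residues. *)
Definition carry (i j k : 'F_p) : nat := (gap i j + gap j k) %/ p.

Lemma carryE i j k : (gap i j + gap j k = gap i k + carry i j k * p)%N.
Proof.
rewrite [LHS](divn_eq _ p) addnC; congr (_ + _)%N.
rewrite /gap; have -> : k - i = (j - i) + (k - j) by rewrite [RHS]addrC addrA subrK.
by congr (_ %% _)%N; apply/esym; exact: Fp_cast.
Qed.

Lemma carry_cocycle i j k l : (carry j k l + carry i j l = carry i k l + carry i j k)%N.
Proof.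
apply/eqP; rewrite -(eqn_pmul2r (prime_gt0 pr_p)) !mulnDl -(eqn_add2l (gap i l)); apply/eqP.
rewrite [X in (_ + X = _)%N]addnC !addnA -!carryE [RHS]addnAC -carryE.
by rewrite -[LHS]addnA -carryE addnA.
Qed.

(** A residue [e] overflows for exactly [e] values of the other summand. *)
Lemma carry_sum (e : 'F_p) : (\sum_(i : 'F_p) carry 0%R i (i + e)%R = e)%N.
Proof.
have gap0 i : gap 0%R i = i by rewrite /gap subr0.
have gape i : gap i (i + e) = e by rewrite /gap addrAC subrr add0r.
have : (\sum_(i : 'F_p) (gap 0%R i + gap i (i + e)%R) =
    \sum_(i : 'F_p) (gap 0%R (i + e)%R + carry 0%R i (i + e)%R * p))%N.
  by apply: eq_bigr => i _; exact: carryE.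
rewrite !big_split /= -big_distrl /=.
have -> : (\sum_(i : 'F_p) gap 0%R (i + e)%R = \sum_(i : 'F_p) gap 0%R i)%N.
  by rewrite [RHS](reindex_inj (addIr e)).
have -> : (\sum_(i : 'F_p) gap i (i + e)%R = p * e)%N.
  by under eq_bigr => i _ do rewrite gape; rewrite sum_nat_const card_Fp.
move/addnI/eqP; rewrite mulnC eqn_pmul2r ?prime_gt0 // => /eqP.
exact: esym.
Qed.

(** The r-th cup power of the carry cocycle, in degree 2r. *)
Fixpoint periodic_cocycle (r : nat) (t : seq G) : 'F_p :=
  if r is r'.+1 then
    if t is a :: b :: ((c :: _) as t') then (carry (lab a) (lab b) (lab c))%:R * periodic_cocycle r' t'
    else 0
  else 1.

Lemma periodic_cocycle_translate u r t :
  (forall a b, lab (u * b)%g - lab (u * a)%g = lab b - lab a) ->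
  periodic_cocycle r (translate u t) = periodic_cocycle r t.
Proof.
move=> uab; elim: r t => [|r IH] // [|a [|b [|c t]]] //=.
by rewrite /carry /gap !uab -(IH (c :: t)).
Qed.

Lemma periodic_cocycleP r t : size t = r.*2.+2 -> delta (periodic_cocycle r) t = 0.
Proof.
elim: r t => [|r IH]; first by case=> [|a [|b []]] //= _; rewrite subr0 subrr.
move=> [|a [|b [|c [|d t]]]] // [st].
set z := periodic_cocycle r; pose c3 i j k : 'F_p := (carry (lab i) (lab j) (lab k))%:R.
rewrite -[LHS]/(c3 b c d * z (d :: t) - (c3 a c d * z (d :: t) - (c3 a b d * z (d :: t)
  - delta (fun u => c3 a b c * z (c :: u)) (d :: t)))).
rewrite (delta_map (phi := fun v => c3 a b c * v)); last by move=> *; rewrite mulrBr.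
(* Leibniz rule: the coboundary of the carry cocycle is the factor in front of the value
   at d :: t, and it vanishes. *)
have := IH (c :: d :: t); rewrite -[delta _ _]/(z (d :: t) - delta (fun u => z (c :: u)) (d :: t)).
rewrite [size _]/= st => /(_ erefl) /eqP; rewrite subr_eq0 => /eqP <-.
rewrite -!mulrBl opprB !addrA /c3 -natrD carry_cocycle natrD.
by rewrite addrK subrr mul0r.
Qed.

Section Evaluation.
Variable V : zmodType.
Implicit Types f g : seq G -> V.

Definition periodic_step (n : nat) f (s : seq G) : V :=
  if odd n then \sum_(i : 'F_p) f (1%g :: translate (rot i) s)
  else f (1%g :: translate (rot 1) s) - f (1%g :: s).

(** Evaluation on the chains of the periodic resolution of the cyclic group: each one is
    the cone, with apex 1, over the boundary which the resolution prescribes,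
    alternately the norm and the difference. *)
Fixpoint periodic_eval (n : nat) f : V :=
  if n is n'.+1 then periodic_eval n' (periodic_step n' f) else f [:: 1%g].

Lemma periodic_eval_mem (E : V -> Prop) n f :
  E 0 -> (forall v w, E v -> E w -> E (v - w)) ->
  (forall t, size t = n.+1 -> E (f t)) -> E (periodic_eval n f).
Proof.
move=> E0 EB; have ED v w : E v -> E w -> E (v + w).
  by move=> Ev Ew; rewrite -[w]opprK -[- w]sub0r; apply: (EB) => //; exact: (EB).
elim: n f => [|n IH] f Ef /=; first exact: Ef.
apply: IH => t st; rewrite /periodic_step; case: ifP => _.
  by apply: big_ind => // i _; apply: Ef; rewrite /= size_translate st.
by apply: (EB); apply: Ef; rewrite /= ?size_translate st.
Qed.

Lemma periodic_evalB n f g :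
  periodic_eval n (fun t => f t - g t) = periodic_eval n f - periodic_eval n g.
Proof.
elim: n f g => //= n IH f g; rewrite -IH; congr (periodic_eval _ _); apply/funext => t.
rewrite /periodic_step; case: ifP => _; first exact: sumrB.
by rewrite !opprD !opprK addrACA.
Qed.

Lemma eq_periodic_eval n f g : (forall t, size t = n.+1 -> f t = g t) ->
  periodic_eval n f = periodic_eval n g.
Proof.
move=> fg; apply/eqP; rewrite -subr_eq0 -periodic_evalB; apply/eqP.
by apply: (periodic_eval_mem (E := fun v => v = 0)) => [|v w -> ->|t st]; rewrite ?subr0 ?fg ?subrr.
Qed.

Definition periodic_boundary (n : nat) f (s : seq G) : V :=
  if odd n then \sum_(i : 'F_p) f (translate (rot i) s) else f (translate (rot 1) s) - f s.

Lemma periodic_step_delta n f s :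
  periodic_step n (delta f) s = periodic_boundary n f s - delta (periodic_step n f) s.
Proof.
rewrite /periodic_step /periodic_boundary; case: ifP => _ /=.
  pose h (F : 'F_p -> V) := \sum_i F i.
  have hB F F' : h (F - F') = h F - h F' by rewrite /h -sumrB.
  rewrite (delta_map (V := 'F_p -> V) (phi := h) (fun s i => f (1%g :: translate (rot i) s)) s hB).
  rewrite -sumrB; apply: eq_bigr => i _; congr (_ - _).
  by rewrite delta_app delta_translate.
rewrite (deltaB (fun s => f (1%g :: translate (rot 1) s)) (fun s => f (1%g :: s))).
by rewrite delta_translate !opprD !opprK addrACA.
Qed.

Lemma periodic_boundary_step n f s : periodic_boundary n (periodic_step n.+1 f) s = 0.
Proof.
rewrite /periodic_boundary /periodic_step /=; case: (odd n) => /=.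
  rewrite sumrB; apply/eqP; rewrite subr_eq0; apply/eqP; rewrite [RHS](reindex_inj (addrI 1)) /=.
  by apply: eq_bigr => i _; rewrite rotD translateM.
apply/eqP; rewrite subr_eq0; apply/eqP; rewrite [RHS](reindex_inj (addIr 1)) /=.
by apply: eq_bigr => i _; rewrite rotD translateM.
Qed.

(** The chain under the cone is a cycle, as the norm and the difference annihilate each
    other. *)
Lemma periodic_eval_step n f : periodic_eval n (delta (periodic_step n f)) = 0.
Proof.
elim: n f => [|n IH] f /=; first by rewrite subr0 /periodic_step /= subrr.
rewrite (eq_periodic_eval (g := fun t => 0 - delta (periodic_step n (periodic_step n.+1 f)) t)).
  rewrite (periodic_evalB n (fun _ => 0)) IH subr0.
  by apply: (periodic_eval_mem (E := fun v => v = 0)) => // v w -> ->; rewrite subr0.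
by move=> t _; rewrite periodic_step_delta periodic_boundary_step.
Qed.

(** On invariant cochains the boundary of a periodic chain is multiplication by p or by
    0. *)
Lemma periodic_eval_delta n f : killed p V -> f [::] = 0 ->
  (forall i t, f (translate (rot i) t) = f t) -> periodic_eval n (delta f) = 0.
Proof.
move=> kV f0 frot; case: n => [|n] /=; first by rewrite f0 subr0.
rewrite (eq_periodic_eval (g := fun t => 0 - delta (periodic_step n f) t)).
  rewrite (periodic_evalB n (fun _ => 0)) periodic_eval_step subr0.
  by apply: (periodic_eval_mem (E := fun v => v = 0)) => // v w -> ->; rewrite subr0.
move=> t _; rewrite periodic_step_delta /periodic_boundary; congr (_ - _).
case: ifP => _; last by rewrite frot subrr.
by under eq_bigr => i _ do rewrite frot; rewrite sumr_const card_Fp.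
Qed.

End Evaluation.

Lemma periodic_eval_map (V V' : zmodType) (h : V -> V') n f :
  (forall v w, h (v - w) = h v - h w) ->
  periodic_eval n (fun t => h (f t)) = h (periodic_eval n f).
Proof.
move=> hB; have h0 : h 0 = 0 by rewrite -(subrr 0) hB subrr.
have hD v w : h (v + w) = h v + h w.
  by rewrite -{1}[w]opprK hB -[- w]sub0r hB h0 sub0r opprK.
elim: n f => //= n IH f; rewrite -IH; congr (periodic_eval _ _); apply/funext => t.
rewrite /periodic_step; case: ifP => _; last by rewrite hB.
by rewrite (big_morph h hD h0).
Qed.

(** Two successive cones multiply by the difference of two consecutive values of
    [carry_sum], which is 1. *)
Lemma periodic_eval_cocycle r : periodic_eval r.*2 (periodic_cocycle r) = 1.
Proof.
elim: r => [|r IH] //; rewrite -[RHS]IH.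
rewrite -[LHS]/(periodic_eval r.*2 (periodic_step r.*2 (periodic_step r.*2.+1 (periodic_cocycle r.+1)))).
apply: eq_periodic_eval => -[|a t] // _.
have zrot i s : periodic_cocycle r (translate (rot i) s) = periodic_cocycle r s.
  by apply: periodic_cocycle_translate => b c; rewrite !lab_rot opprD addrACA subrr add0r.
have sumE b s : \sum_(i : 'F_p) periodic_cocycle r.+1 (1%g :: translate (rot i) (1%g :: b :: s)) =
    (lab b - lab 1%g) * periodic_cocycle r (b :: s).
  rewrite -[lab b - lab 1%g](natr_Zp) -{1}carry_sum natr_sum mulr_suml; apply: eq_bigr => i _.
  rewrite -(zrot i) /= !lab_rot; congr (_%:R * _).
  rewrite /carry /gap subr0 [i + _ - i]addrAC subrr add0r addrK opprD addrACA subrr add0r.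
  by [].
have e1 := sumE a t.
have e2 : \sum_(i : 'F_p) periodic_cocycle r.+1 
      (1%g :: translate (rot i) (1%g :: translate (rot 1) (a :: t))) =
    (lab (rot 1%R * a)%g - lab 1%g) * periodic_cocycle r (translate (rot 1) (a :: t)).
  exact: (sumE (rot 1%R * a)%g (translate (rot 1) t)).
rewrite /periodic_step oddS odd_double; set z := periodic_cocycle r.+1 in e1 e2 *.
rewrite -[LHS]/(\sum_(i : 'F_p) _ - \sum_(i : 'F_p) _) e1 e2.
rewrite zrot -mulrBl lab_rot.
by rewrite opprB addrA subrK addrK mul1r.
Qed.

End Periodicity.

Section DirectProduct.
Variables (p : nat) (G K : groupType) (N : groupClosed G).
Hypothesis pr_p : prime p.
Variables (tau : G -> K) (lam : K -> G) (rot : 'F_p -> G) (lab : G -> 'F_p).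
Hypotheses (lamM : forall x y, lam (x * y)%g = (lam x * lam y)%g)
  (lamN : forall k, lam k \in N) (tau_lam : forall k, tau (lam k) = k).
Hypotheses (rotD : forall i j, rot (i + j) = (rot i * rot j)%g)
  (rotN : forall i, rot i \in N) (tau_rot : forall i, tau (rot i) = 1%g).
Hypotheses (com : forall k i, (lam k * rot i)%g = (rot i * lam k)%g)
  (tauM : {in N &, {morph tau : x y / (x * y)%g}})
  (decomp : forall u, u \in N -> exists i, u = (lam (tau u) * rot i)%g).
Hypotheses (lab_rot : forall i g, lab (rot i * g)%g = i + lab g)
  (lab_lam : forall k g, lab (lam k * g)%g = lab g).
Local Notation A := (group_algebra 'F_p K).
Local Notation act M := (@ract p K G tau M).

Let lam1 : lam 1%g = 1%g.
Proof. by apply: (mulgI (lam 1%g)); rewrite -lamM !mulg1. Qed.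

Let lamV k : lam k^-1%g = (lam k)^-1%g.
Proof. by apply: (mulgI (lam k)); rewrite -lamM !mulgV lam1. Qed.

Let tau1 : tau 1%g = 1%g.
Proof. by rewrite -lam1 tau_lam. Qed.

Let tauV u : u \in N -> tau u^-1%g = (tau u)^-1%g.
Proof. by move=> Nu; apply: (mulgI (tau u)); rewrite -tauM ?gpredV // !mulgV tau1. Qed.

Let P (g : G) : G := rot (lab g).

Lemma prism_translate (V : zmodType) (f : seq G -> V) i t :
  prism P f (translate (rot i) t) = prism P (fun s => f (translate (rot i) s)) t.
Proof.
elim: t f => //= a t IH f; rewrite IH /P lab_rot rotD.
by rewrite -/(P a).
Qed.

Lemma prism_mem (V : zmodType) (E : V -> Prop) (f : seq G -> V) t :
  E 0 -> (forall v w, E v -> E w -> E (v - w)) ->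
  (forall s, size s = (size t).+1 -> E (f s)) -> E (prism P f t).
Proof.
move=> E0 EB; elim: t f => [|a t IH] f Ef //=.
by apply: EB; [apply: Ef | apply: IH => s st; apply: Ef; rewrite /= st].
Qed.

Lemma prism_map (V V' : zmodType) (h : V -> V') (f : seq G -> V) t :
  (forall v w, h (v - w) = h v - h w) -> prism P (fun s => h (f s)) t = h (prism P f t).
Proof.
move=> hB; have h0 : h 0 = 0 by rewrite -(subrr 0) hB subrr.
by elim: t f => //= a t IH f; rewrite IH hB.
Qed.

(** As a module over [K], [C] contributes the values of the cocycle at a dual basis.
    Those are cochains of the finite group Z/p, and the prism moves their arguments into
    Z/p, so that they take finitely many values. *)
Lemma Ext_true_direct_product (C : lmodType A) n :
  finitely_generated C -> projective C -> Ext p true N (act C) n.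
Proof.
move=> fgC prC; have [r [b [phi [phiB phiZ phiE]]]] := dual_basis fgC prC.
move=> Y aY L E LE kY f cf df; have [aYG LU EU EL] := LE; have [f0 Lf fU] := cf.
have aCG : gact N (act C) by exact: gact_ract.
pose F j t := f t (b j).
have F_rot j i t : F j (translate (rot i) t) = aY (rot i) (F j t).
  by rewrite /F fU // /fact /ract tauV // tau_rot invg1 gunit1 scale1r.
have F_lam j k t : f t (gunit p k *: b j) = aY (lam k) (F j (translate (lam k)^-1%g t)).
  rewrite /F -{1}(translateKV (lam k) t) fU // /fact /ract -lamV tau_lam.
  by rewrite scalerA -gunitM mulVg gunit1 scale1r.
(* The values at sequences in Z/p, the image of the group under the prism. *)
pose S := [seq F j (map rot (w : n.-tuple 'F_p)) | j <- enum 'I_r, w <- enum {: n.-tuple 'F_p}].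
have SF j t : size t = n -> F j (map P t) \in S.
  move=> st; have sw : size (map lab t) == n by rewrite size_map st.
  apply/allpairsP; exists (j, Tuple sw); split; rewrite ?mem_enum //=.
  by rewrite -map_comp.
have LF j t : L (F j t) by case: (Lf t) => + _; exact.
have SL y : y \in S -> L y by case/allpairsP => -[j w] /= [_ _ ->]; exact: LF.
exists S; split=> //; have LE' := coeff_gen LE SL; have [_ _ EU' _] := LE'.
have hE := homP_usub aCG LE'.
have phiD j c c' : phi j (c + c') = phi j c + phi j c'.
  have phi0 : phi j 0 = 0 by rewrite -(subrr 0) phiB subrr.
  by rewrite -{1}[c']opprK phiB -[- c']sub0r phiB phi0 sub0r opprK.
pose g t m := \sum_j pairing (phi j m) (fun k => aY (lam k) (prism P (F j) (translate (lam k)^-1%g t))).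
have gL t : homP L (gen N aY E S) (g t).
  split=> [m|m m'].
    apply: (usub_sum LU) => j _; apply: (usub_sum LU) => k _; apply: (usubMn LU).
    apply: (usubA LU) => //; apply: prism_mem; [exact: usub0 LU | exact: usubB LU |].
    by move=> s _; exact: LF.
  rewrite /g -!sumrB; under eq_bigr => j _ do rewrite phiD pairingD // addrAC addrK subrr.
  by rewrite big1_eq; exact: usub0 EU'.
exists g.
  split=> // [|u t Uu].
  - apply/funext => m; rewrite /g big1 // => j _; rewrite /pairing big1 // => k _.
    by rewrite /= (gact0 aYG) // mul0rn.
  apply/funext => m; have [i uE] := decomp Uu; set k0 := tau u in uE.
  rewrite /fact /g (gact_sum aYG) //; apply: eq_bigr => j _.
  rewrite /ract tauV // phiZ pairing_shift // /pairing (gact_sum aYG) //.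
  apply: eq_bigr => k _; rewrite (gactMn aYG) //; congr (_ *+ _).
  rewrite -(gactM aYG) // -translateM.
  have -> : ((lam k)^-1 * u = rot i * (lam (k0^-1 * k))^-1)%g.
    by rewrite -!lamV invgM invgK -com lamM -mulgA -uE.
  have -> : (u * lam (k0^-1 * k) = lam k * rot i)%g.
    by rewrite uE -mulgA -com mulgA -lamM mulVKg.
  rewrite (gactM aYG) // translateM prism_translate; congr (aY _ _).
  rewrite -(prism_map (h := aY (rot i))) => [|v w]; last by rewrite (gactB aYG).
  by congr (prism _ _ _); apply/funext => s; rewrite F_rot.
move=> t m st; rewrite delta_app.
pose W t j k := aY (lam k) (prism P (F j) (translate (lam k)^-1%g t)).
pose ev (w : 'I_r -> K -> Y) := \sum_j pairing (phi j m) (w j).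
have evB w w' : ev (w - w') = ev w - ev w'.
  by rewrite /ev -sumrB; apply: eq_bigr => j _; exact: pairingBr.
rewrite (delta_map (V := 'I_r -> K -> Y) (phi := ev) W t evB).
have hf : homP L (gen N aY E S) (f t) by apply: homPW (Lf _) => z; exact: gen_base.
apply: (usub_trans EU' (homP_expand phiE (act C) m LE' hf)).
rewrite -[X in gen _ _ _ _ (X - _)]/(ev (fun j k => f t (gunit p k *: b j))) -evB.
apply: (usub_sum EU') => j _; apply: (usub_sum EU') => k _; apply: (usubMn EU').
rewrite -[X in gen _ _ _ _ X]/(f t (gunit p k *: b j) - delta W t j k) !delta_app.
rewrite (delta_map (phi := aY (lam k))); last by move=> v w; rewrite (gactB aYG).
rewrite -(delta_translate (prism P (F j))) F_lam -(gactB aYG) //; apply: (usubA EU') => //.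
set t' := translate _ t; have st' : size t' = n by rewrite size_translate.
have -> : F j t' = delta (prism P (F j)) t' + prism P (delta (F j)) t' + F j (map P t').
  by rewrite delta_prism subrK.
rewrite -[_ + _ + _]addrA [X in X - _]addrC addrK; apply: (usubD EU'); last first.
  by apply: gen_seed; exact: SF.
apply: gen_base; apply: prism_mem; [exact: usub0 EU | exact: usubB EU |].
by move=> s ss; rewrite -delta_app; apply: df; rewrite ss st'.
Qed.

(** The cocycle is the product of the periodicity class with the identity of [M].
    Evaluating on a periodic chain recovers each [m], while it kills coboundaries,
    because Z/p acts trivially on [M]. *)
Lemma fg_of_Ext_odd (M : lmodType A) r : Ext p true N (act M) r.*2.+1 -> finitely_generated M.
Proof.
move=> ext; have aG : gact N (act M) by exact: gact_ract.
have kM : killed p M by exact: (@killed_algebra p pr_p K M).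
have LE : coeff N (act M) (fun _ => True) (fun m => m = 0).
  by split=> //; exact: usub_eq0.
have FpB (m : M) (c d : 'F_p) : m *+ (c - d)%R = m *+ c - m *+ d.
  by apply/eqP; rewrite eq_sym subr_eq -killed_FpD // subrK.
pose z := cutoff r.*2.+1 (periodic_cocycle lab r).
have zN u t : u \in N -> z (translate u t) = z t.
  move=> Nu; rewrite /z /cutoff size_translate; congr (if _ then _ else _).
  apply: periodic_cocycle_translate => a b; have [i ->] := decomp Nu.
  by rewrite -!mulgA !lab_lam !lab_rot opprD addrACA subrr add0r.
have [||S [_ _ [g [g0 _ gN] fg]]] := ext M (act M) _ _ LE kM (fun t m => m *+ z t).
- split=> [|t|u t Nu].
  + by apply/funext => m; rewrite /z /= mulr0n.
  + by split=> // m m'; rewrite mulrnDl addrAC addrK subrr.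
  + by apply/funext => m; rewrite zN // /fact (gactMn aG) // (gactKV aG).
- move=> t m st; rewrite delta_app (delta_map (phi := fun c : 'F_p => m *+ c)).
    by rewrite delta_cutoff // periodic_cocycleP // mulr0n.
  by move=> c d; exact: FpB.
apply: (@fg_of_gen p K G tau N M S) => m.
have gU := gen_usub N (act M) (fun m => m = 0) S.
have := periodic_eval_mem rot (usub0 gU) (fun v w => usubB gU (v := v) (w := w))
  (fun t st => fg t m st).
have -> : (fun t => m *+ z t - delta g t m) = (fun t => m *+ z t - delta (fun t => g t m) t).
  by apply/funext => t; rewrite delta_app.
rewrite periodic_evalB (periodic_eval_delta pr_p rotD _ (f := fun t => g t m)) //; first last.
- by move=> i t; rewrite gN // /fact /ract tauV // tau_rot invg1 gunit1 !scale1r.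
- by rewrite g0.
rewrite subr0 (periodic_eval_map rot (h := fun c : 'F_p => m *+ c)) => [|c d]; last exact: FpB.
rewrite (eq_periodic_eval rot (g := periodic_cocycle lab r)) => [|t st]; last by rewrite /z cutoffE.
by rewrite periodic_eval_cocycle.
Qed.

End DirectProduct.

(** * Fixed points of an automorphism of order p *)

Section FixedPoints.
Variables (p : nat) (H : groupType).
Hypothesis pr_p : prime p.
Variable sigma : H -> H.
Hypotheses (sigmaM : {morph sigma : x y / (x * y)%g}) (sigmap : forall x, iter p sigma x = x).
Local Notation G := (semidirect pr_p sigmaM sigmap).
Local Notation N := (centralizing pr_p sigmaM sigmap).
Local Notation base := (base pr_p sigmaM sigmap).
Local Notation rot := (sd_rot pr_p sigmaM sigmap).

Definition fixed : groupClosed H.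
Proof.
refine (subgroup_of (P := fun h : H => sigma h = h) _ _ _).
- exact: sigma1.
- by move=> x y sx sy; rewrite sigmaM sx sy.
- by move=> x sx; apply: (mulgI x); rewrite -{1}sx -sigmaM !mulgV sigma1.
Defined.

Lemma fixedP h : h \in fixed <-> sigma h = h.
Proof. exact: subgroup_ofP. Qed.

Let K := subgroup_type fixed.
Let lam (k : K) : G := sd_inj pr_p sigmaM sigmap (val k).
Let tau (g : G) : K := insubd (1%g : K) g.1.

Definition fixed_base : groupClosed G.
Proof.
refine (subgroup_of (P := fun g : G => g \in base /\ g \in N) _ _ _).
- by split; exact: gpred1.
- by move=> x y [bx Nx] [by_ Ny]; split; exact: gpredM.
- by move=> x [bx Nx]; split; rewrite gpredV.
Defined.

Lemma fixed_baseP g : g \in fixed_base <-> g \in base /\ g \in N.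
Proof. exact: subgroup_ofP. Qed.

(** The criterion is applied to [K] with the product of [K] by Z/p as the group testing
    finiteness, and the copy of [K] in [base], of finite cohomological dimension, as the
    group testing projectivity. *)
Lemma type_FP_fixed : type_FP 'F_p H -> type_FP 'F_p K.
Proof.
move=> fp.
have tf (h : H) : (h ^+ p)%g = 1%g -> h = 1%g by exact: torsion_free.
have [n1 ac] := acyclic_semidirect pr_p sigmaM sigmap fp.
have [d ext] := Ext_of_type_FP pr_p fp.
have injM := @sd_injM p H pr_p sigma sigmaM sigmap.
have injI := @sd_inj_inj p H pr_p sigma sigmaM sigmap.
have [_ extb] := ext G _ base injM injI (@base_sd_inj p H pr_p sigma sigmaM sigmap).
have FUb u : u \in fixed_base -> exists h, sd_inj pr_p sigmaM sigmap h = u.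
  by move=> /fixed_baseP[bu _]; exact: base_sd_inj.
have [extU _] := ext G _ fixed_base injM injI FUb.
have extG k : Ext p true (whole G) (@triv G p) k.
  apply: Ext_whole => {}k; apply: (extb [:: 1%g]) => h; exists 1%g; first by rewrite inE.
  exact: base_inj.
have lamM x y : lam (x * y)%g = (lam x * lam y)%g by exact: injM.
have lamI : injective lam by move=> x y /injI /val_inj.
have tau_lam k : tau (lam k) = k by rewrite /tau /= valKd.
have lamN k : lam k \in N by apply/centralizingP; apply/fixedP; exact: valP.
have lamU k : lam k \in fixed_base by apply/fixed_baseP; split; [exact: base_inj | exact: lamN].
have Nval u : u \in N -> val (tau u) = u.1.
  by move=> /centralizingP/fixedP Fu; rewrite /tau insubdK.
have tauM : {in N &, {morph tau : x y / (x * y)%g}}.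
  move=> x y Nx Ny; apply: val_inj; rewrite Nval ?gpredM // sdM1.
  have /centralizingP sy := Ny; rewrite iter_fixed // -!Nval //.
have rotN i : rot i \in N by apply/centralizingP; exact: sigma1.
have UN : {subset fixed_base <= N} by move=> u /fixed_baseP[].
have tau_rot i : tau (rot i) = 1%g by apply: val_inj; rewrite Nval.
have com k i : (lam k * rot i)%g = (rot i * lam k)%g.
  by rewrite sd_rot_inj iter_fixed //; apply/fixedP; exact: valP.
have decomp u : u \in N -> exists i, u = (lam (tau u) * rot i)%g.
  by move=> Nu; exists u.2; rewrite /lam Nval // -sd_decomp.
have lab_rot i (g : G) : (rot i * g)%g.2 = i + g.2 by [].
have lab_lam k (g : G) : (lam k * g)%g.2 = g.2 by rewrite sdM2 add0r.
have Uiota u : u \in fixed_base -> exists k, lam k = u.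
  move=> /fixed_baseP[bu Nu]; exists (tau u); rewrite /lam Nval //.
  by have [h <-] := base_sd_inj bu.
have rotD := @sd_rotD p H pr_p sigma sigmaM sigmap.
have tau1 : tau 1%g = 1%g by apply: val_inj; rewrite Nval ?gpred1.
apply: (resolution_of_Ext pr_p tau1 UN tauM lamU tau_lam (n1 := n1.+1) (d := d)).
- move=> F n fgF prF _.
  exact: (Ext_true_direct_product pr_p (N := N) (lab := snd) lamM lamN tau_lam rotD rotN
    tau_rot com tauM decomp lab_rot fgF prF).
- move=> F n fgF prF; refine (Ext_congr _ (Ext_fgproj pr_p lamM lamI Uiota fgF prF)).
  by move=> u m /Uiota[k <-]; rewrite /ract retrK // tau_lam.
- move=> M extM.
  (* Finite generation is detected in even degrees only; any large one will do. *)
  have extM' : Ext p true N (ract tau (M := M)) n1.+1.*2.+1.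
    by apply: extM; rewrite ltnS -addnn addSn leqW ?leq_addr.
  exact: (fg_of_Ext_odd pr_p (N := N) (lab := snd) lamM tau_lam rotD rotN
    tau_rot tauM decomp lab_rot lab_lam extM').
- move=> n ltn; refine (Ext_congr (M := (trivial_module 'F_p K : lmodType _)) _
    (Ext_centralizing tf extG ltn (fun W aW LW k => ac W aW LW k))).
  by move=> u m _; rewrite /ract -[RHS]/(augmentation (gunit p (tau u)) * (m : 'F_p)) augmentationU mul1r.
- move=> n ltn; refine (Ext_congr (M := (trivial_module 'F_p K : lmodType _)) _ (extU n (ltnW ltn))).
  by move=> u m _; rewrite /ract -[RHS]/(augmentation (gunit p (tau u)) * (m : 'F_p)) augmentationU mul1r.
Qed.

End FixedPoints.

(** * Finite index and normal cores *)

(** A section with values in an option type, as [G] may be empty over some values of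
    [F]. *)
Lemma partial_section (T G : Type) (F : G -> T) :
  exists r : T -> option G, forall x, exists2 y, r (F x) = Some y & F y = F x.
Proof.
have ex t : exists y : option G, forall x, F x = t -> exists2 z, y = Some z & F z = t.
  have [[y Fy]|no] := pselect (exists y, F y = t); first by exists (Some y) => x _; exists y.
  by exists None => x Fx; case: no; exists x.
by have [r rP] := choice ex; exists r => x; exact: rP.
Qed.

Lemma finite_fibres (T : finType) (G : choiceType) (F : G -> T) :
  exists s : seq G, forall x, exists2 y, y \in s & F x = F y.
Proof.
have [r rP] := partial_section F; exists (pmap r (enum T)) => x.
have [z rz Fz] := rP x; exists z => //.
by rewrite mem_pmap -rz map_f ?mem_enum.
Qed.

Section NormalCore.
Variables (G : groupType) (H : groupClosed G).

Definition core : groupClosed G.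
Proof.
refine (subgroup_of (P := fun h : G => forall x, (x^-1 * h * x)%g \in H) _ _ _).
- by move=> x; rewrite mulg1 mulVg gpred1.
- move=> x y Cx Cy z; have := gpredM _ _ (Cx z) (Cy z).
  by rewrite !mulgA mulgK.
- by move=> x Cx z; have := Cx z; rewrite -gpredV !invgM invgK mulgA.
Defined.

Lemma coreP h : h \in core <-> forall x, (x^-1 * h * x)%g \in H.
Proof. exact: subgroup_ofP. Qed.

Lemma core_sub h : h \in core -> h \in H.
Proof. by move=> /coreP/(_ 1%g); rewrite invg1 mul1g mulg1. Qed.

Lemma core_normal h x : h \in core -> (x * h * x^-1)%g \in core.
Proof.
move=> /coreP Ch; apply/coreP => z.
by have := Ch (x^-1 * z)%g; rewrite invgM invgK !mulgA.
Qed.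

(** The permutation of the left cosets of [H] defined by an element determines its coset
    modulo the core. *)
Lemma core_finite_fibres : finite_index H ->
  exists (T : finType) (F : G -> T), forall x y, F x = F y -> (y^-1 * x)%g \in core.
Proof.
case=> s sH; have sH' x : exists j : 'I_(size s), ((nth 1%g s j)^-1 * x)%g \in H.
  have [y ys yx] := sH x; have lts : (index y s < size s)%N by rewrite index_mem.
  by exists (Ordinal lts); rewrite nth_index.
have [c cP] := choice sH'.
exists {ffun 'I_(size s) -> 'I_(size s)}, (fun x => [ffun i : 'I_(size s) => c (x * nth 1%g s i)%g]).
move=> x y /ffunP xy; apply/coreP => z; have := xy (c z); rewrite !ffunE => e.
have := cP (x * nth 1%g s (c z))%g; rewrite e => cx.
have cy := cP (y * nth 1%g s (c z))%g; have cz := cP z.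
set u := nth 1%g s (c z) in cx cy cz.
have : (u^-1 * (y^-1 * x) * u)%g \in H.
  have := cy; rewrite -gpredV => {}cy.
  by have := gpredM _ _ cy cx; rewrite !invgM invgK !mulgA mulgK.
move=> Hu; have := cz; rewrite -gpredV => cz'; have := gpredM _ _ (gpredM _ _ cz' Hu) cz.
by rewrite invgM invgK !mulgA !mulgK.
Qed.

End NormalCore.

Lemma torsion_free_pow p (H : groupType) (y : H) k : prime p -> type_FP 'F_p H ->
  (y ^+ (p ^ k) = 1)%g -> y = 1%g.
Proof.
move=> pr_p fp; elim: k => [|k IH]; first by rewrite expn0 expg1.
by rewrite expnSr expgnA => /(torsion_free pr_p fp).
Qed.

(** * Finite p-groups acting by conjugation *)

Section PGroupAction.
Variables (p : nat) (G : groupType) (H : groupClosed G).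
Hypotheses (pr_p : prime p) (fpH : type_FP 'F_p (subgroup_type H)).
Variables (gT : finGroupType) (v : gT -> G).
Hypotheses (vM : forall a b, v (a * b)%g = (v a * v b)%g)
  (Hv : forall a h, h \in H -> (v a * h * (v a)^-1)%g \in H).

Let v1 : v 1%g = 1%g.
Proof. by apply: (mulgI (v 1%g)); rewrite -vM !mulg1. Qed.

Let vV a : v a^-1%g = (v a)^-1%g.
Proof. by apply: (mulgI (v a)); rewrite -vM !mulgV v1. Qed.

Let vX a n : v (a ^+ n)%g = (v a ^+ n)%g.
Proof. by elim: n => [|n IH]; rewrite ?expg0 // !expgS vM IH. Qed.

(** The p-group acts through a homomorphism [v] from a finite group type, so that the
    theory of maximal subgroups applies. *)
Definition centralized (Q : {set gT}) : groupClosed G.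
Proof.
refine (subgroup_of (P := fun h : G => h \in H /\ forall a, a \in Q -> commute h (v a)) _ _ _).
- by split=> [|a _]; [exact: gpred1 | exact/commute_sym/commute1].
- move=> x y [Hx cx] [Hy cy]; split=> [|a Qa]; first exact: gpredM.
  by apply/commute_sym; apply: commuteM; apply/commute_sym; [exact: cx | exact: cy].
- move=> x [Hx cx]; split=> [|a Qa]; first by rewrite gpredV.
  by apply/commute_sym; apply: commuteV; apply/commute_sym; exact: cx.
Defined.

Lemma centralizedP Q h : h \in centralized Q <-> h \in H /\ forall a, a \in Q -> commute h (v a).
Proof. exact: subgroup_ofP. Qed.

Lemma centralized_conj (M : {group gT}) x h : x \in 'N(M)%g -> h \in centralized M ->
  (v x * h * (v x)^-1)%g \in centralized M.
Proof.
move=> Nx /centralizedP[Hh ch]; apply/centralizedP; split=> [|a Ma]; first exact: Hv.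
have Max : (x^-1 * a * x)%g \in M.
  by have := memJ_norm a Nx; rewrite Ma conjgE mulgA.
have := ch _ Max; rewrite /commute !vM vV => e.
have {}e := congr1 (fun z => v x * z * (v x)^-1)%g e.
by move: e; rewrite !mulgA mulgK mulgV mul1g.
Qed.

(** By induction on the order: a maximal subgroup [M] is normal of index p, an element
    [x] outside [M] acts on the centralizer of [M] with trivial p-th power, and its
    fixed points centralize the group generated by [M] and [x]. *)
Lemma type_FP_centralized (Q : {group gT}) : p.-group%g Q ->
  type_FP 'F_p (subgroup_type (centralized Q)).
Proof.
have [n leQ] := ubnP #|Q|; elim: n Q leQ => // n IH Q ltQ pQ.
have [Q1|[M maxM _]] := maximal_exists (sub1G Q).
  pose iota : subgroup_type H -> G := val.
  have iotaI : injective iota by exact: val_inj.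
  apply: (type_FP_finite_index pr_p (iota := iota) (s := [:: 1%g]) _ iotaI _ _ fpH) => //.
    by move=> u /centralizedP[Hu _]; exists (Sub u Hu).
  move=> h; exists 1%g; first by rewrite inE.
  rewrite invg1 mulg1; apply/centralizedP; split=> [|a]; first exact: valP.
  by rewrite -Q1 => /set1P ->; rewrite v1; exact: commute1.
have nMQ := p_maximal_normal pQ maxM; have iMQ := p_maximal_index pQ maxM.
have /maxgroupP[ltMQ maxP] := maxM; have [sMQ [x Qx Mx]] := properP ltMQ.
have Nx : x \in 'N(M)%g by apply: (fintype.subsetP (normal_norm nMQ)).
have xp : (x ^+ p)%g \in M.
  apply: coset_idr; first exact: groupX.
  rewrite morphX // -iMQ -card_quotient ?normal_norm //.
  by apply: expg_cardG; exact: mem_quotient.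
have fpM : type_FP 'F_p (subgroup_type (centralized M)).
  apply: IH; last exact: pgroupS pQ.
  by apply: leq_trans (proper_card ltMQ) _; rewrite -ltnS.
set F := subgroup_type (centralized M) in fpM.
pose sigma (h : F) : F := Sub (v x * val h * (v x)^-1)%g (centralized_conj Nx (valP h)).
have sigmaM : {morph sigma : h k / (h * k)%g}.
  by move=> h k; apply: val_inj; rewrite /= !mulgA mulgVK.
have sigmaX m h : val (iter m sigma h) = (v x ^+ m * val h * (v x ^+ m)^-1)%g.
  elim: m => [|m IHm]; first by rewrite expg0 mul1g invg1 mulg1.
  by rewrite /= IHm expgS invgM !mulgA.
have sigmap h : iter p sigma h = h.
  apply: val_inj; rewrite sigmaX -vX.
  have /centralizedP[_ ch] := valP h; have := ch _ xp => e.
  by rewrite -e mulgK.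
pose iota (h : subgroup_type (fixed sigmaM)) : G := val (val h).
have iotaI : injective iota by move=> h k /val_inj/val_inj.
apply: (type_FP_finite_index pr_p (iota := iota) (s := [:: 1%g]) _ iotaI _ _
  (type_FP_fixed pr_p sigmaM sigmap fpM)) => //.
- move=> u /centralizedP[Hu cu].
  have uM : u \in centralized M.
    by apply/centralizedP; split=> // a Ma; apply: cu; exact: (fintype.subsetP sMQ).
  have uF : Sub u uM \in fixed sigmaM.
    by apply/fixedP; apply: val_inj; rewrite /= -(cu _ Qx) mulgK.
  by exists (Sub (Sub u uM) uF).
move=> h; exists 1%g; first by rewrite inE.
rewrite invg1 mulg1; have /centralizedP[Hh cM] := valP (val h).
have cx : commute (iota h) (v x).
  have /fixedP/(congr1 val) := valP h; rewrite -[\val (sigma _)]/(v x * iota h * (v x)^-1)%g.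
  by rewrite -[\val (\val h)]/(iota h) => e; rewrite /commute -{1}e mulgVK.
apply/centralizedP; split=> //.
pose A := [set a in Q | `[< commute (iota h) (v a) >]]%SET.
have AP a : a \in Q -> commute (iota h) (v a) -> a \in A.
  by move=> Qa ca; rewrite inE Qa; exact/asboolP.
have grA : group_set A.
  apply/group_setP; split=> [|a b].
    by apply: AP => //; rewrite v1; exact: commute1.
  rewrite !inE => /andP[Qa /asboolP ca] /andP[Qb /asboolP cb].
  by rewrite groupM //=; apply/asboolP; rewrite vM; exact: commuteM.
have sMA : M \subset A.
  by apply/fintype.subsetP => a Ma; apply: AP; [exact: (fintype.subsetP sMQ) | exact: cM].
have sQA : Q \subset A.
  apply: contraT => nQA; have ltAQ : A \proper Q.
    by rewrite properE nQA andbT; apply/fintype.subsetP => a; rewrite inE => /andP[].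
  have := maxP (group grA) ltAQ sMA => e; case/negP: Mx; rewrite -e /=.
  exact: AP.
by move=> a /(fintype.subsetP sQA); rewrite inE => /andP[_ /asboolP].
Qed.

End PGroupAction.

(** * Centralizers of p-subgroups *)

Theorem theoremE (p : nat) (G : groupType) (P : groupClosed G) :
  prime p -> type_VFP 'F_p G -> p_subgroup p P ->
  type_VFP 'F_p (subgroup_type (centralizer P)).
Proof.
move=> pr_p [H0 [fiH0 fpH0]] pP; have [T [F FP]] := core_finite_fibres fiH0.
set H := core H0 in FP.
have fpH : type_FP 'F_p (subgroup_type H).
  have [s sF] := finite_fibres (fun h : subgroup_type H0 => F (val h)).
  pose iota : subgroup_type H0 -> G := val.
  have iotaI : injective iota by exact: val_inj.
  apply: (type_FP_finite_index pr_p (iota := iota) (s := s) _ iotaI _ _ fpH0) => //.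
    by move=> u /core_sub Hu; exists (Sub u Hu).
  move=> h; have [y ys hy] := sF h; exists y => //.
  by have := core_normal (iota y) (FP _ _ hy); rewrite mulVKg.
have valX (x : subgroup_type H) n : val (x ^+ n)%g = (val x ^+ n)%g.
  by elim: n => [|n IH]; rewrite ?expg0 // !expgS -IH.
have PH (x : G) : x \in P -> x \in H -> x = 1%g.
  move=> Px Hx; have [k xk] := pP x Px.
  suff /(congr1 val) : (Sub x Hx : subgroup_type H) = 1%g by [].
  by apply: (torsion_free_pow (k := k) pr_p fpH); apply: val_inj; rewrite valX.
pose f (x : subgroup_type P) := F (val x).
have f_inj : injective f.
  move=> x y /FP xy; apply: val_inj; apply: (mulgI (val y)^-1%g); rewrite mulVg.
  by apply: PH => //; rewrite gpredM ?gpredV //; exact: valP.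
have [g gP] := partial_section f.
have fK : pcancel f g by move=> x; have [y -> /f_inj ->] := gP x.
pose cP : countType := HB.pack (Group.sort (subgroup_type P)) (PCanIsCountable fK).
pose gT : finGroupType := HB.pack (Group.sort (subgroup_type P))
  (PCanIsCountable fK) (PCanIsFinite (eT := cP) fK).
pose v (x : gT) : G := val (x : subgroup_type P).
have vM x y : v (x * y)%g = (v x * v y)%g by [].
have vX x n : v (x ^+ n)%g = (v x ^+ n)%g.
  by elim: n => [|n IH]; rewrite ?expg0 // !expgS -IH.
(* P meets H trivially, so it is finite; being of p-power exponent, it is a p-group. *)
have pgP : p.-group%g [set: gT].
  apply/pgroupP => q pr_q /(Cauchy pr_q)[x _ xq].
  have [k xk] := pP (v x) (valP (x : subgroup_type P)).
  have : (q %| p ^ k)%N.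
    rewrite -xq order_dvdn; apply/eqP; apply: (@val_inj _ _ (subgroup_type P)).
    by rewrite -[LHS]/(v (x ^+ (p ^ k))%g) vX.
  by rewrite Euclid_dvdX // => /andP[]; rewrite dvdn_prime2 // => /eqP ->; rewrite inE.
have Hv x h : h \in H -> (v x * h * (v x)^-1)%g \in H by exact: core_normal.
have fpC := type_FP_centralized pr_p fpH vM Hv pgP.
set F' := centralized _ _ _ in fpC.
have F'P h : h \in F' -> h \in centralizer P.
  move=> /centralizedP[_ ch]; apply/centralizerP => y Py.
  exact: (ch (Sub y Py : subgroup_type P) (finset.in_setT _)).
pose C := subgroup_type (centralizer P).
have D1 : val (1%g : C) \in H by exact: gpred1.
have DM (x y : C) : val x \in H -> val y \in H -> val (x * y)%g \in H by exact: gpredM.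
have DV (x : C) : val x \in H -> val (x^-1)%g \in H by rewrite gpredV.
pose D := subgroup_of D1 DM DV.
exists D; split.
  have [s sF] := finite_fibres (fun c : C => F (val c)).
  exists s => x; have [y ys xy] := sF x; exists y => //.
  by apply/subgroup_ofP; exact: FP.
pose iota (h : subgroup_type F') : C := Sub (val h) (F'P _ (valP h)).
have iotaI : injective iota by move=> h k e; apply: val_inj; exact: (congr1 val e).
have iotaM (h k : subgroup_type F') : iota (h * k)%g = (iota h * iota k)%g by exact: val_inj.
apply: (type_FP_finite_index pr_p (iota := iota) (s := [:: 1%g]) iotaM iotaI _ _ fpC).
  move=> c /subgroup_ofP Hc; have Fc : val c \in F'.
    apply/centralizedP; split=> // a _.
    have /centralizerP := valP c; apply; exact: (valP (a : subgroup_type P)).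
  by exists (Sub (val c) Fc); apply: val_inj.
move=> h; exists 1%g; first by rewrite inE.
rewrite invg1 mulg1; apply/subgroup_ofP.
by have /centralizedP[] := valP h.
Qed.
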